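(* Let $k\geq 1$ be an integer and $\beta\in\mathfrak{B}_k$. Then \[ f_{k,\beta}\big\vert_{-\frac{1}{2}}\begin{pmatrix}1&1\\0&1\end{pmatrix}=e\!\left(\frac{k}{12}-\frac{\beta^2}{2k}\right)f_{k,\beta},\qquad f_{k,\beta}\big\vert_{-\frac{1}{2}}\begin{pmatrix}0&-1\\1&0\end{pmatrix}=\sum_{\beta'\in\mathfrak{B}_k}s^{(k)}_{\beta,\beta'}\, f_{k,\beta'}, \] where \[ s^{(k)}_{\beta,\beta'}=\mu_{\beta'/k}\cdot \mathrm{i}^{2\beta}\, e\!\left(\frac{2k+1}{8}\right)\frac{2}{\sqrt{k}}\cos\!\left(\frac{2\pi\beta'(\beta+\frac{k}{2})}{k}\right), \] and $\mu_t=1/2$ if $t=0$ or $t=1/2$, and $\mu_t=1$ otherwise.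
   Context: Notation: $e(x)=\exp(2\pi \mathrm{i} x)$; $\tau$ is in the upper half plane $\mathbb{H}$, $q=e(\tau)$, $z\in\mathbb{C}$, $\zeta=e(z)$. Let $\eta(\tau)=q^{1/24}\prod_{j\ge1}(1-q^j)$ and $\vartheta(\tau,z)=\sum_{n\in\frac12+\mathbb{Z}}\exp\!\big(\pi\mathrm{i}n^2\tau+2\pi\mathrm{i}n(z+\tfrac12)\big)$. For a positive integer $k$ and $\beta\in\frac{k}{2}+\mathbb{Z}$, $C\Psi_{k,\beta}(q)=\sum_{n\ge0}c\psi_{k,\beta}(n)q^n$ is defined as the coefficient of $\zeta^\beta$ in the expansion of $F_k(\tau,z)=\left(\frac{-\vartheta(\tau,z+\frac12)}{q^{1/12}\eta(\tau)}\right)^k$ in powers of $\zeta$, and $f_{k,\beta}(\tau)=q^{\frac{k}{12}-\frac{\beta^2}{2k}}C\Psi_{k,\beta}(q)$. The set $\mathfrak{B}_k$ is $\{0,1,2,\dots,k/2\}$ if $k$ is even and $\{1/2,3/2,\dots,k/2\}$ if $k$ is odd. For a function $f$ on $\mathbb{H}$ and $\begin{pmatrix}a&b\\c&d\end{pmatrix}\in\mathrm{SL}_2(\mathbb{Z})$, $f\vert_{-\frac12}\begin{pmatrix}a&b\\c&d\end{pmatrix}(\tau)=(c\tau+d)^{1/2}f\!\left(\frac{a\tau+b}{c\tau+d}\right)$, where $(c\tau+d)^{1/2}$ is the principal branch (argument in $(-\pi/2,\pi/2]$). *)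

(* Defs.v *)
From Stdlib Require Import Reals ZArith List.
From Coquelicot Require Import Coquelicot.
Open Scope R_scope.

Definition Cexp (z : C) : C :=
  (exp (Re z) * cos (Im z), exp (Re z) * sin (Im z)).

Definition e (x : C) : C := Cexp (RtoC (2 * PI) * Ci * x)%C.

(* [q^x] for [q = e(tau)], and likewise [zeta^x] for [zeta = e(z)]: the
   fractional powers are determined by the logarithm [tau] (resp. [z]). *)
Definition epow (tau : C) (x : R) : C := e (RtoC x * tau)%C.

Definition the (P : C -> Prop) : C := iota (T := C_R_CompleteNormedModule) P.

(* Square root with argument in (-PI/2, PI/2]. *)
Definition Csqrt (w : C) : C :=
  the (fun v => (v * v)%C = w /\
    exists r t : R, 0 <= r /\ - (PI / 2) < t <= PI / 2 /\
      v = (r * cos t, r * sin t)).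

Definition is_Zseries (u : Z -> C) (l : C) : Prop :=
  exists l1 l2 : C,
    is_series (V := C_R_NormedModule) (fun n : nat => u (Z.of_nat n)) l1 /\
    is_series (V := C_R_NormedModule)
      (fun n : nat => u (- Z.of_nat (S n))%Z) l2 /\
    l = (l1 + l2)%C.

Definition ZSeries (u : Z -> C) : C := the (is_Zseries u).

Fixpoint Cprod (u : nat -> C) (n : nat) : C :=
  match n with
  | O => RtoC 1
  | S m => (Cprod u m * u m)%C
  end.

Definition CProduct (u : nat -> C) : C :=
  the (fun l => filterlim (Cprod u) eventually
                  (locally (T := C_R_NormedModule) l)).

Definition eta (tau : C) : C :=
  (epow tau (1 / 24) *
   CProduct (fun j => RtoC 1 - epow tau (INR (S j))))%C.

(* The index [n] ranges over [1/2 + Z]. *)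
Definition vartheta (tau z : C) : C :=
  ZSeries (fun m : Z =>
    let n : C := RtoC (IZR m + 1 / 2) in
    Cexp (RtoC PI * Ci * (n * n) * tau
          + RtoC (2 * PI) * Ci * n * (z + RtoC (1 / 2))))%C.

Definition Fk (k : nat) (tau z : C) : C :=
  ((- vartheta tau (z + RtoC (1 / 2)) / (epow tau (1 / 12) * eta tau)) ^ k)%C.

(* [c beta] is the coefficient of [zeta^beta]; only the values of [c] on
   [k/2 + Z] matter, and those are determined by [G]. *)
Definition zeta_expansion (k : nat) (G : C -> C) (c : R -> C) : Prop :=
  forall z : C,
    is_Zseries (fun m : Z =>
      let beta := INR k / 2 + IZR m in (c beta * epow z beta)%C) (G z).

(* As a function of [tau]; meaningful for [beta] in [k/2 + Z]. *)
Definition CPsi (k : nat) (beta : R) (tau : C) : C :=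
  the (fun a => exists c : R -> C, zeta_expansion k (Fk k tau) c /\ a = c beta).

Definition fk (k : nat) (beta : R) (tau : C) : C :=
  (epow tau (INR k / 12 - beta ^ 2 / (2 * INR k)) * CPsi k beta tau)%C.

Definition frakB (k : nat) : list R :=
  if Nat.even k
  then map INR (seq 0 (S (k / 2)))
  else map (fun j => INR j + 1 / 2) (seq 0 (S (k / 2))).

Definition sum_frakB (k : nat) (g : R -> C) : C :=
  fold_right Cplus (RtoC 0) (map g (frakB k)).

Record SL2Z := mkSL2Z {
  ma : Z; mb : Z; mc : Z; md : Z;
  SL2Z_det : (ma * md - mb * mc = 1)%Z }.

Definition matT : SL2Z := mkSL2Z 1 1 0 1 eq_refl.
Definition matS : SL2Z := mkSL2Z 0 (-1) 1 0 eq_refl.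

Definition slash (g : C -> C) (M : SL2Z) (tau : C) : C :=
  let a := RtoC (IZR (ma M)) in
  let b := RtoC (IZR (mb M)) in
  let c := RtoC (IZR (mc M)) in
  let d := RtoC (IZR (md M)) in
  (Csqrt (c * tau + d) * g ((a * tau + b) / (c * tau + d)))%C.

Definition mu (t : R) : R :=
  if Req_EM_T t 0 then 1 / 2
  else if Req_EM_T t (1 / 2) then 1 / 2
  else 1.

(* [i^(2 beta)] is an ordinary power: for [beta] in [frakB k], [2 beta] is a
   natural number. *)
Definition smat (k : nat) (beta beta' : R) : C :=
  (RtoC (mu (beta' / INR k))
   * Ci ^ Z.to_nat (Int_part (2 * beta))
   * e (RtoC ((2 * INR k + 1) / 8))
   * RtoC (2 / sqrt (INR k))
   * RtoC (cos (2 * PI * beta' * (beta + INR k / 2) / INR k)))%C.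

(* Main.v *)
Require Import Defs.
From Stdlib Require Import Reals ZArith List Lra Lia FunctionalExtensionality.
From Coquelicot Require Import Coquelicot.
Open Scope R_scope.

(* With theta(tau, z) = sum_(n in 1/2 + Z) q^(n^2/2) zeta^n one has
   F_k = (theta / (q^(1/12) eta))^k, so f_(k,beta) = eta^(-k) g_(k,beta), where
   q^(beta^2/2k) g_(k,beta) is the coefficient of zeta^beta in theta^k.  By the
   quasi-period and the parity of theta, g_(k,beta) is unchanged when beta is
   replaced by beta + k or by -beta.  Under tau -> -1/tau, theta becomes, up to
   an elementary factor, theta at a shifted argument; splitting the expansion of
   the k-th power into classes modulo k, each class is a Gaussian sum which is
   inverted again, and comparing coefficients of zeta^b gives the transformation
   of the g_(k,beta) by a discrete Fourier transform, whose folding by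
   beta' -> -beta' produces the cosines.

   Gaussian sums are inverted by discretising: the sum over n of
   exp(-pi s^2 (z+n)^2) is expanded by a finite Fourier transform on (1/N)Z/Z,
   whose coefficients are Riemann sums of a Gaussian along a line in C.  These
   become independent of the line as N grows, and the remaining constant is 1
   because the case s = 1, z = 0 is self-dual.  The transformation of eta follows
   from the same inversion and the pentagonal number theorem. *)


(** The weight comes from counting powers of one root. Fix [r] with r^2 = -i tau and Re r > 0, so
    that exp(pi i tau n^2) = exp(-pi r^2 n^2); no branch is chosen until the very end, where the
    principal root of tau is e(1/8) r. Theta^k contributes i^k r^k, eta^(-k) contributes r^(-k), and
    the second inversion, of Gaussian sums with quadratic coefficient k r^2, contributes 1/(sqrt k
    r). What is left is weight -1/2 together with e(1/8) i^k = e((2k+1)/8).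

    Theta coefficients, infinite products, series and square roots are all given by unique
    descriptions, so each one is identified by exhibiting a value and proving uniqueness.

    On the analytic side a single envelope [env], x -> 1/(1+|x|)^2, dominates every series over Z.
    It is summable, stable under shifts and convolution, and its Riemann sums are bounded uniformly
    in the mesh; every interchange of limits then reduces to dominated convergence, [Tannery]. No
    integral occurs: Riemann sums with explicit error bounds take their place. *)

(** * Limits of complex sequences *)

Definition Clim (u : nat -> C) (l : C) : Prop :=
  is_lim_seq (fun n => Cmod (u n - l)%C) 0.

(** Bridge from the filter limits used in the definitions to real sequences of distances, to which
    squeezing and the order lemmas for real limits apply. *)
Lemma Clim_filterlim (u : nat -> C) (l : C) :
  Clim u l <-> filterlim u eventually (locally (T := C_R_NormedModule) l).
Proof.
  unfold Clim; rewrite <- is_lim_seq_spec; simpl.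
  rewrite (filterlim_locally_ball_norm (K := R_AbsRing) (U := C_R_NormedModule) u l).
  unfold ball_norm.
  assert (E : forall n, Rabs (Cmod (u n - l)%C - 0)
                = norm (minus (u n : C_R_NormedModule) l)).
  { intros n. rewrite <- Cmod_norm, Rminus_0_r, Rabs_pos_eq by apply Cmod_ge_0.
    reflexivity. }
  split; intros H eps; destruct (H eps) as [N HN]; exists N; intros n Hn;
    specialize (HN n Hn); rewrite E in *; exact HN.
Qed.

Lemma Clim_squeeze (u : nat -> C) (l : C) (b : nat -> R) :
  (forall n, Cmod (u n - l)%C <= b n) -> is_lim_seq b 0 -> Clim u l.
Proof.
  intros H Hb. apply (is_lim_seq_le_le (fun _ => 0) _ b); auto.
  - intros n; split; auto. apply Cmod_ge_0.
  - apply is_lim_seq_const.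
Qed.

Lemma Clim_ext (u v : nat -> C) (l : C) :
  (forall n, u n = v n) -> Clim u l -> Clim v l.
Proof.
  intros H; apply is_lim_seq_ext; intros n; now rewrite H.
Qed.

Lemma Clim_const (l : C) : Clim (fun _ => l) l.
Proof.
  apply is_lim_seq_ext with (fun _ => 0); [|apply is_lim_seq_const].
  intros _. replace (l - l)%C with (RtoC 0) by ring. now rewrite Cmod_0.
Qed.

Lemma Clim_plus (u v : nat -> C) (l m : C) :
  Clim u l -> Clim v m -> Clim (fun n => u n + v n)%C (l + m)%C.
Proof.
  intros Hu Hv.
  apply Clim_squeeze with (fun n => Cmod (u n - l)%C + Cmod (v n - m)%C).
  - intros n. replace (u n + v n - (l + m))%C with ((u n - l) + (v n - m))%C by ring.
    apply Cmod_triangle.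
  - replace (Finite 0) with (Finite (0 + 0)) by (f_equal; ring).
    now apply is_lim_seq_plus'.
Qed.

Lemma Clim_scal (a : C) (u : nat -> C) (l : C) :
  Clim u l -> Clim (fun n => a * u n)%C (a * l)%C.
Proof.
  intros Hu.
  apply Clim_squeeze with (fun n => Cmod a * Cmod (u n - l)%C).
  - intros n. rewrite <- Cmod_mult. right; f_equal; ring.
  - replace (Finite 0) with (Rbar_mult (Cmod a) 0) by (simpl; f_equal; ring).
    now apply is_lim_seq_scal_l.
Qed.

Lemma Clim_unique (u : nat -> C) (l m : C) : Clim u l -> Clim u m -> l = m.
Proof.
  intros Hl Hm.
  assert (H : Clim (fun n => u n + (-(1)) * u n)%C (m + (-(1)) * l)%C)
    by (apply Clim_plus; [|apply Clim_scal]; auto).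
  apply (Clim_ext _ (fun _ => RtoC 0)) in H; [|intros; ring].
  unfold Clim in H.
  apply is_lim_seq_unique in H. rewrite Lim_seq_const in H.
  injection H as H. apply Cmod_eq_0 in H.
  replace m with (l - (0 - (m + (-(1)) * l)))%C by ring.
  rewrite H. ring.
Qed.

Lemma Clim_incr_1 (u : nat -> C) (l : C) : Clim (fun n => u (S n)) l <-> Clim u l.
Proof.
  unfold Clim. symmetry. apply (is_lim_seq_incr_1 (fun n => Cmod (u n - l)%C)).
Qed.

Lemma Clim_Cmod_le (u : nat -> C) (l : C) (b : nat -> R) (B : R) :
  Clim u l -> (forall n, Cmod (u n) <= b n) -> is_lim_seq b B -> Cmod l <= B.
Proof.
  intros Hl Hb HB.
  assert (H : is_lim_seq (fun n => b n + Cmod (u n - l)%C) (B + 0))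
    by (apply is_lim_seq_plus'; auto).
  rewrite Rplus_0_r in H.
  refine (is_lim_seq_le (fun _ => Cmod l) _ (Cmod l) B _ (is_lim_seq_const _) H).
  intros n.
  replace l with (u n + - (u n - l))%C at 1 by ring.
  eapply Rle_trans; [apply Cmod_triangle|]. rewrite Cmod_opp.
  specialize (Hb n). lra.
Qed.

(** * Absolutely convergent series over Z *)

(** Quadratic decay is the weakest convenient choice: it is summable by telescoping, changes by a
    bounded factor under a shift, and is reproduced by convolution. *)
Definition env (x : R) : R := / (1 + Rabs x) ^ 2.

Lemma env_pos (x : R) : 0 < env x.
Proof.
  unfold env. apply Rinv_0_lt_compat, pow_lt. pose proof (Rabs_pos x). lra.
Qed.

Lemma env_opp (x : R) : env (- x) = env x.
Proof. unfold env. now rewrite Rabs_Ropp. Qed.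

Lemma env_le_1 (x : R) : env x <= 1.
Proof.
  unfold env. rewrite <- Rinv_1. apply Rinv_le_contravar; [lra|].
  pose proof (Rabs_pos x). nra.
Qed.

Lemma env_le (x y a : R) : 1 + Rabs x <= a * (1 + Rabs y) -> env y <= a ^ 2 * env x.
Proof.
  intros H. unfold env.
  pose proof (Rabs_pos x). pose proof (Rabs_pos y).
  assert (0 < (1 + Rabs x) ^ 2) by (apply pow_lt; lra).
  assert (0 < (1 + Rabs y) ^ 2) by (apply pow_lt; lra).
  apply Rmult_le_reg_r with ((1 + Rabs y) ^ 2); auto.
  rewrite Rinv_l by lra.
  apply Rmult_le_reg_r with ((1 + Rabs x) ^ 2); auto.
  replace (a ^ 2 * / (1 + Rabs x) ^ 2 * (1 + Rabs y) ^ 2 * (1 + Rabs x) ^ 2)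
    with ((a * (1 + Rabs y)) ^ 2) by (field; lra).
  rewrite Rmult_1_l. apply pow_incr. lra.
Qed.

Lemma env_shift (x y : R) : env (x + y) <= (1 + Rabs y) ^ 2 * env x.
Proof.
  apply env_le. pose proof (Rabs_triang (x + y) (- y)).
  replace (x + y + - y) with x in H by ring. rewrite Rabs_Ropp in H.
  pose proof (Rabs_pos (x + y)). pose proof (Rabs_pos y). nra.
Qed.

(* Bounded, with increments dominating [h * env x] for every step [0 <= h <= 1]:
   this bounds sums over [Z] and Riemann sums alike by telescoping. *)
Definition envprim (x : R) : R := 2 * x / (1 + Rabs x).

Lemma envprim_bound (x : R) : -2 <= envprim x <= 2.
Proof.
  unfold envprim. pose proof (Rabs_pos x).
  assert (-Rabs x <= x <= Rabs x) by (split_Rabs; lra).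
  split; apply Rmult_le_reg_r with (1 + Rabs x); try lra;
  unfold Rdiv; rewrite Rmult_assoc, Rinv_l; lra.
Qed.

Lemma envprim_opp (x : R) : envprim (- x) = - envprim x.
Proof. unfold envprim. rewrite Rabs_Ropp. field. pose proof (Rabs_pos x). lra. Qed.

Lemma env_telescope_pos (x h : R) : 0 <= x -> 0 <= h <= 1 ->
  h * env x <= envprim (x + h) - envprim x.
Proof.
  intros Hx Hh. unfold env, envprim. rewrite !Rabs_pos_eq by lra.
  replace (2 * (x + h) / (1 + (x + h)) - 2 * x / (1 + x))
    with (h * (2 / ((1 + (x + h)) * (1 + x)))) by (field; lra).
  apply Rmult_le_compat_l; [lra|].
  apply Rmult_le_reg_r with ((1 + x) ^ 2 * (1 + (x + h))).
  { apply Rmult_lt_0_compat; [apply pow_lt|]; lra. }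
  replace (/ (1 + x) ^ 2 * ((1 + x) ^ 2 * (1 + (x + h)))) with (1 + (x + h)) by (field; lra).
  replace (2 / ((1 + (x + h)) * (1 + x)) * ((1 + x) ^ 2 * (1 + (x + h))))
    with (2 * (1 + x)) by (field; lra). lra.
Qed.

Lemma env_telescope_neg (x h : R) : x + h <= 0 -> 0 <= h <= 1 ->
  h * env x <= envprim (x + h) - envprim x.
Proof.
  intros Hx Hh. unfold env, envprim. rewrite !Rabs_left1 by lra.
  replace (2 * (x + h) / (1 + - (x + h)) - 2 * x / (1 + - x))
    with (h * (2 / ((1 - (x + h)) * (1 - x)))) by (field; lra).
  apply Rmult_le_compat_l; [lra|].
  apply Rmult_le_reg_r with ((1 + - x) ^ 2 * (1 - (x + h))).
  { apply Rmult_lt_0_compat; [apply pow_lt|]; lra. }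
  replace (/ (1 + - x) ^ 2 * ((1 + - x) ^ 2 * (1 - (x + h)))) with (1 - (x + h)) by (field; lra).
  replace (2 / ((1 - (x + h)) * (1 - x)) * ((1 + - x) ^ 2 * (1 - (x + h))))
    with (2 * (1 - x)) by (field; lra). lra.
Qed.

Lemma env_telescope (x h : R) : 0 <= h <= 1 ->
  h * env x <= envprim (x + h) - envprim x.
Proof.
  intros Hh.
  destruct (Rle_lt_dec 0 x) as [Hx|Hx]; [now apply env_telescope_pos|].
  destruct (Rle_lt_dec (x + h) 0) as [Hx'|Hx']; [now apply env_telescope_neg|].
  (* A step containing 0 is cut there; on the part right of 0 the value [env 0] is at least
     [env x]. *)
  pose proof (env_telescope_neg x (-x) ltac:(lra) ltac:(lra)) as H1.
  pose proof (env_telescope_pos 0 (x + h) ltac:(lra) ltac:(lra)) as H2.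
  replace (x + - x) with 0 in H1 by ring. rewrite Rplus_0_l in H2.
  assert (env x <= env 0).
  { unfold env. apply Rinv_le_contravar; rewrite Rabs_R0; [lra|].
    pose proof (Rabs_pos x). nra. }
  nra.
Qed.

(** The window is -K <= n < K: the term k is paired with -(k+1), as in the two halves of
    [is_Zseries]. Shifts and reflections therefore leave boundary terms. *)
Fixpoint part (u : Z -> C) (K : nat) : C :=
  match K with
  | O => RtoC 0
  | S k => (part u k + (u (Z.of_nat k) + u (- Z.of_nat (S k))%Z))%C
  end.

Fixpoint rpart (u : Z -> R) (K : nat) : R :=
  match K with
  | O => 0
  | S k => rpart u k + (u (Z.of_nat k) + u (- Z.of_nat (S k))%Z)
  end.

Lemma rpart_le (u v : Z -> R) (K : nat) :
  (forall n, u n <= v n) -> rpart u K <= rpart v K.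
Proof.
  intros H; induction K as [|k IH]; simpl; [lra|].
  pose proof (H (Z.of_nat k)). pose proof (H (Z.neg (Pos.of_succ_nat k))). lra.
Qed.

Lemma rpart_scal (a : R) (u : Z -> R) (K : nat) :
  rpart (fun n => a * u n) K = a * rpart u K.
Proof. induction K as [|k IH]; simpl; [ring|rewrite IH; ring]. Qed.

Lemma part_ext (u v : Z -> C) (K : nat) :
  (forall n, u n = v n) -> part u K = part v K.
Proof. intros H; induction K as [|k IH]; simpl; [reflexivity|now rewrite IH, !H]. Qed.

Lemma part_plus (u v : Z -> C) (K : nat) :
  part (fun n => u n + v n)%C K = (part u K + part v K)%C.
Proof. induction K as [|k IH]; simpl; [ring|rewrite IH; ring]. Qed.

Lemma part_scal (a : C) (u : Z -> C) (K : nat) :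
  part (fun n => a * u n)%C K = (a * part u K)%C.
Proof. induction K as [|k IH]; simpl; [ring|rewrite IH; ring]. Qed.

Lemma part_Cmod (u : Z -> C) (K : nat) :
  Cmod (part u K) <= rpart (fun n => Cmod (u n)) K.
Proof.
  induction K as [|k IH]; simpl; [rewrite Cmod_0; lra|].
  eapply Rle_trans; [apply Cmod_triangle|].
  apply Rplus_le_compat; [exact IH|apply Cmod_triangle].
Qed.

Lemma part_tail_Cmod (u : Z -> C) (J k : nat) :
  Cmod (part u (k + J) - part u J)%C
  <= rpart (fun n => Cmod (u n)) (k + J) - rpart (fun n => Cmod (u n)) J.
Proof.
  induction k as [|k IH]; simpl.
  { replace (part u J - part u J)%C with (RtoC 0) by ring. rewrite Cmod_0; lra. }
  set (a := u (Z.of_nat (k + J))). set (b := u (Z.neg _)).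
  replace (part u (k + J) + (a + b) - part u J)%C
    with ((part u (k + J) - part u J) + (a + b))%C by ring.
  eapply Rle_trans; [apply Cmod_triangle|].
  pose proof (Cmod_triangle a b). lra.
Qed.

Lemma rpart_env_tail (h x0 : R) (J k : nat) : 0 <= h <= 1 ->
  rpart (fun n => h * env (x0 + h * IZR n)) (k + J)
  - rpart (fun n => h * env (x0 + h * IZR n)) J
  <= (envprim (x0 + h * INR (k + J)) - envprim (x0 + h * INR J))
     + (envprim (x0 - h * INR J) - envprim (x0 - h * INR (k + J))).
Proof.
  intros Hh. induction k as [|k IH].
  { simpl. lra. }
  change (S k + J)%nat with (S (k + J)). cbn [rpart].
  rewrite opp_IZR, <- !INR_IZR_INZ.
  set (P := INR (k + J)) in *.
  pose proof (env_telescope (x0 + h * P) h Hh) as H1.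
  pose proof (env_telescope (x0 + h * - INR (S (k + J))) h Hh) as H2.
  rewrite S_INR in *. fold P in H1, H2 |- *.
  replace (x0 + h * P + h) with (x0 + h * (P + 1)) in H1 by ring.
  replace (x0 + h * - (P + 1) + h) with (x0 - h * P) in H2 by ring.
  replace (x0 + h * - (P + 1)) with (x0 - h * (P + 1)) in * by ring.
  lra.
Qed.

(** The total variation of [envprim] is at most 4, whatever [h] and [x0]. Step h = 1 gives sums over
    Z, and h = 1/N gives Riemann sums with a bound uniform in N. *)
Lemma rpart_env_le (h x0 : R) (K : nat) : 0 <= h <= 1 ->
  rpart (fun n => h * env (x0 + h * IZR n)) K <= 4.
Proof.
  intros Hh. pose proof (rpart_env_tail h x0 0 K Hh) as H.
  rewrite Nat.add_0_r in H. simpl (rpart _ 0) in H. simpl (INR 0) in H.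
  replace (x0 - h * 0) with (x0 + h * 0) in H by ring.
  pose proof (envprim_bound (x0 + h * INR K)). pose proof (envprim_bound (x0 - h * INR K)). lra.
Qed.

Definition domB (B : R) (u : Z -> C) : Prop :=
  forall n : Z, Cmod (u n) <= B * env (IZR n).

Definition dom (u : Z -> C) : Prop := exists B : R, domB B u.

Lemma domB_pos (B : R) (u : Z -> C) : domB B u -> 0 <= B.
Proof.
  intros H. specialize (H 0%Z). pose proof (Cmod_ge_0 (u 0%Z)). pose proof (env_pos (IZR 0)).
  nra.
Qed.

Lemma rpart_env_1 (K : nat) : rpart (fun n => env (IZR n)) K <= 4.
Proof.
  pose proof (rpart_env_le 1 0 K ltac:(lra)) as H.
  eapply Rle_trans; [|exact H]. apply rpart_le. intros n. rewrite Rplus_0_l, !Rmult_1_l. lra.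
Qed.

(** Beyond J, [envprim] can still grow by 2/(1+J) on each side. The estimate depends on the sequence
    only through [B], which is the uniformity [Tannery] relies on. *)
Lemma part_dom_tail (B : R) (u : Z -> C) (J k : nat) : domB B u ->
  Cmod (part u (k + J) - part u J)%C <= 4 * B / (1 + INR J).
Proof.
  intros H. pose proof (domB_pos B u H) as HB.
  eapply Rle_trans; [apply part_tail_Cmod|].
  assert (Hd : forall k, rpart (fun n => Cmod (u n)) (k + J) - rpart (fun n => Cmod (u n)) J
    <= B * (rpart (fun n => 1 * env (0 + 1 * IZR n)) (k + J) -
            rpart (fun n => 1 * env (0 + 1 * IZR n)) J)).
  { clear k. induction k as [|k IH]; [simpl; lra|].
    change (S k + J)%nat with (S (k + J)). cbn [rpart].
    rewrite !Rplus_0_l, !Rmult_1_l.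
    pose proof (H (Z.of_nat (k + J))). pose proof (H (- Z.of_nat (S (k + J)))%Z). lra. }
  eapply Rle_trans; [apply Hd|].
  pose proof (rpart_env_tail 1 0 J k ltac:(lra)) as Ht.
  rewrite !Rplus_0_l, !Rminus_0_l, !Rmult_1_l, !envprim_opp in Ht.
  pose proof (envprim_bound (INR (k + J))) as Hk.
  assert (HJ : 2 - envprim (INR J) = 2 / (1 + INR J)).
  { unfold envprim. pose proof (pos_INR J). rewrite Rabs_pos_eq by lra. field. lra. }
  replace (4 * B / (1 + INR J)) with (B * (2 * (2 / (1 + INR J)))).
  2:{ field. pose proof (pos_INR J). lra. }
  apply Rmult_le_compat_l; lra.
Qed.

Lemma is_lim_seq_inv_INR (B : R) : is_lim_seq (fun J => B / (1 + INR J)) 0.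
Proof.
  replace (Finite 0) with (Rbar_mult B 0) by (simpl; f_equal; ring).
  apply is_lim_seq_scal_l.
  apply is_lim_seq_ext with (fun n => / INR (S n)).
  { intros n. rewrite S_INR. f_equal. ring. }
  apply (is_lim_seq_incr_1 (fun n => / INR n)).
  replace (Finite 0) with (Rbar_inv p_infty) by reflexivity.
  apply is_lim_seq_inv; [apply is_lim_seq_INR|discriminate].
Qed.

Lemma dom_half_ex (a : nat -> C) (B : R) :
  (forall n, Cmod (a n) <= B * env (INR n)) ->
  exists l, is_series (V := C_R_NormedModule) a l.
Proof.
  intros H.
  apply (ex_series_le (K := R_AbsRing) (V := C_R_CompleteNormedModule) a
           (fun n => B * env (INR n))).
  { intros n. change (norm (a n)) with (@norm R_AbsRing C_R_NormedModule (a n)).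
    rewrite <- Cmod_norm. apply H. }
  apply (ex_series_scal_l (K := R_AbsRing) B (fun n => env (INR n))).
  assert (Hl : ex_finite_lim_seq (sum_n (fun n => env (INR n)))).
  { apply ex_finite_lim_seq_incr with 4.
    - intros n. rewrite sum_Sn. pose proof (env_pos (INR (S n))).
      change (sum_n (fun n => env (INR n)) n <= sum_n (fun n => env (INR n)) n + env (INR (S n))). lra.
    - intros n. apply Rle_trans with (rpart (fun n => env (IZR n)) (S n)); [|apply rpart_env_1].
      induction n as [|n IH].
      + rewrite sum_O. simpl. pose proof (env_pos (-1)). lra.
      + rewrite sum_Sn.
        change (sum_n (fun n => env (INR n)) n + env (INR (S n))
          <= rpart (fun n => env (IZR n)) (S n)
             + (env (IZR (Z.of_nat (S n))) + env (IZR (- Z.of_nat (S (S n)))))).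
        rewrite <- INR_IZR_INZ. pose proof (env_pos (IZR (- Z.of_nat (S (S n))))). lra. }
  destruct Hl as [l Hl]. exists l. exact Hl.
Qed.

Lemma is_Zseries_lim (u : Z -> C) (l : C) : is_Zseries u l -> Clim (part u) l.
Proof.
  intros (l1 & l2 & H1 & H2 & ->).
  apply Clim_incr_1.
  apply Clim_ext with (fun n => sum_n (G := C_R_NormedModule) (fun n => u (Z.of_nat n)) n
     + sum_n (G := C_R_NormedModule) (fun n => u (- Z.of_nat (S n))%Z) n)%C.
  { induction n as [|n IH].
    - rewrite !sum_O. simpl. ring.
    - rewrite !sum_Sn.
      change (part u (S (S n))) with
       (part u (S n) + (u (Z.of_nat (S n)) + u (- Z.of_nat (S (S n)))%Z))%C.
      rewrite <- IH.
      set (a := sum_n _ n). set (b := sum_n _ n). clearbody a b.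
      change (a + u (Z.of_nat (S n)) + (b + u (- Z.of_nat (S (S n)))%Z)
        = a + b + (u (Z.of_nat (S n)) + u (- Z.of_nat (S (S n)))%Z))%C. ring. }
  apply Clim_plus; apply Clim_filterlim; assumption.
Qed.

Lemma is_Zseries_unique (u : Z -> C) (l m : C) :
  is_Zseries u l -> is_Zseries u m -> l = m.
Proof.
  intros H1 H2. apply Clim_unique with (part u); now apply is_Zseries_lim.
Qed.

Lemma the_unique (P : C -> Prop) (x : C) : P x -> (forall y, P y -> y = x) -> the P = x.
Proof. intros H1 H2. now apply (iota_unique (V := C_R_CompleteNormedModule)). Qed.

Lemma ZSeries_unique (u : Z -> C) (l : C) : is_Zseries u l -> ZSeries u = l.
Proof.
  intros H. apply the_unique; auto. intros y Hy. now apply is_Zseries_unique with u.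
Qed.

Lemma ZSeries_correct (u : Z -> C) : dom u -> is_Zseries u (ZSeries u).
Proof.
  intros [B HB].
  destruct (dom_half_ex (fun n => u (Z.of_nat n)) B) as [l1 H1].
  { intros n. rewrite INR_IZR_INZ. apply HB. }
  destruct (dom_half_ex (fun n => u (- Z.of_nat (S n))%Z) (B * 1)) as [l2 H2].
  { intros n. eapply Rle_trans; [apply HB|]. pose proof (domB_pos B u HB).
    rewrite Rmult_assoc. apply Rmult_le_compat_l; auto.
    replace 1 with (1 ^ 2) by ring. apply env_le.
    rewrite Rmult_1_l, opp_IZR, Rabs_Ropp, <- INR_IZR_INZ, !Rabs_pos_eq, S_INR; try apply pos_INR. lra. }
  assert (H : is_Zseries u (l1 + l2)%C) by (exists l1, l2; auto).
  now rewrite (ZSeries_unique _ _ H).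
Qed.

Lemma ZSeries_lim (u : Z -> C) : dom u -> Clim (part u) (ZSeries u).
Proof. intros H. now apply is_Zseries_lim, ZSeries_correct. Qed.

Lemma ZSeries_eq (u : Z -> C) (l : C) : dom u -> Clim (part u) l -> ZSeries u = l.
Proof. intros H Hl. apply Clim_unique with (part u); auto. now apply ZSeries_lim. Qed.

Lemma ZSeries_ext (u v : Z -> C) : (forall n, u n = v n) -> ZSeries u = ZSeries v.
Proof.
  intros H. f_equal. now apply functional_extensionality.
Qed.

Lemma dom_ext (u v : Z -> C) : (forall n, u n = v n) -> dom u -> dom v.
Proof. intros H [B HB]. exists B. intros n. rewrite <- H. apply HB. Qed.

Lemma dom_plus (u v : Z -> C) : dom u -> dom v -> dom (fun n => u n + v n)%C.
Proof.
  intros [A HA] [B HB]. exists (A + B). intros n.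
  eapply Rle_trans; [apply Cmod_triangle|]. specialize (HA n). specialize (HB n). lra.
Qed.

Lemma dom_scal (a : C) (u : Z -> C) : dom u -> dom (fun n => a * u n)%C.
Proof.
  intros [B HB]. exists (Cmod a * B). intros n. rewrite Cmod_mult, Rmult_assoc.
  apply Rmult_le_compat_l; [apply Cmod_ge_0|apply HB].
Qed.

Lemma dom_le (u v : Z -> C) (A : R) : 0 <= A ->
  (forall n, Cmod (v n) <= A * Cmod (u n)) -> dom u -> dom v.
Proof.
  intros HA H [B HB]. exists (A * B). intros n. eapply Rle_trans; [apply H|].
  rewrite Rmult_assoc. apply Rmult_le_compat_l; auto.
Qed.

Lemma dom_shift (u : Z -> C) (m : Z) : dom u -> dom (fun n => u (n + m)%Z).
Proof.
  intros [B HB]. exists (B * (1 + Rabs (IZR m)) ^ 2). intros n.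
  eapply Rle_trans; [apply HB|]. rewrite plus_IZR, Rmult_assoc.
  apply Rmult_le_compat_l; [now apply domB_pos with u|apply env_shift].
Qed.

Lemma dom_opp (u : Z -> C) : dom u -> dom (fun n => u (- n)%Z).
Proof.
  intros [B HB]. exists B. intros n. eapply Rle_trans; [apply HB|].
  rewrite opp_IZR, env_opp. lra.
Qed.

Lemma ZSeries_plus (u v : Z -> C) : dom u -> dom v ->
  ZSeries (fun n => u n + v n)%C = (ZSeries u + ZSeries v)%C.
Proof.
  intros Hu Hv. apply ZSeries_eq; [now apply dom_plus|].
  apply Clim_ext with (fun K => part u K + part v K)%C; [intros; now rewrite part_plus|].
  now apply Clim_plus; apply ZSeries_lim.
Qed.

Lemma ZSeries_scal (a : C) (u : Z -> C) : dom u ->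
  ZSeries (fun n => a * u n)%C = (a * ZSeries u)%C.
Proof.
  intros Hu. apply ZSeries_eq; [now apply dom_scal|].
  apply Clim_ext with (fun K => a * part u K)%C; [intros; now rewrite part_scal|].
  now apply Clim_scal, ZSeries_lim.
Qed.

Lemma env_INR_lim (B : R) : is_lim_seq (fun K => B * env (INR K)) 0.
Proof.
  apply is_lim_seq_abs_0.
  apply (is_lim_seq_le_le (fun _ => 0) _ (fun K => Rabs B / (1 + INR K))).
  - intros n. split; [apply Rabs_pos|].
    rewrite Rabs_mult, (Rabs_pos_eq (env _)) by (left; apply env_pos).
    apply Rmult_le_compat_l; [apply Rabs_pos|].
    unfold env. pose proof (pos_INR n). rewrite Rabs_pos_eq by lra.
    apply Rinv_le_contravar; [lra|]. nra.
  - apply is_lim_seq_const.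
  - apply is_lim_seq_inv_INR.
Qed.

Lemma dom_lim_pos (u : Z -> C) : dom u -> Clim (fun K => u (Z.of_nat K)) 0.
Proof.
  intros [B HB]. apply Clim_squeeze with (fun K => B * env (INR K)); [|apply env_INR_lim].
  intros n. replace (u (Z.of_nat n) - 0)%C with (u (Z.of_nat n)) by ring.
  rewrite INR_IZR_INZ. apply HB.
Qed.

Lemma dom_lim_neg (u : Z -> C) : dom u -> Clim (fun K => u (- Z.of_nat K)%Z) 0.
Proof. intros H. now apply (dom_lim_pos (fun n => u (- n)%Z)), dom_opp. Qed.

(** Moving the window by one adds u(K) and removes u(-K), and both tend to 0 by domination. *)
Lemma ZSeries_shift1 (u : Z -> C) : dom u -> ZSeries (fun n => u (n + 1)%Z) = ZSeries u.
Proof.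
  intros Hu. apply ZSeries_eq; [now apply dom_shift|].
  apply Clim_ext with
    (fun K => part u K + (u (Z.of_nat K) + (-(1)) * u (- Z.of_nat K)%Z))%C.
  { induction n as [|n IH]; [simpl; ring|]. cbn [part]. rewrite <- IH.
    replace (Z.of_nat n + 1)%Z with (Z.of_nat (S n)) by lia.
    replace (- Z.of_nat (S n) + 1)%Z with (- Z.of_nat n)%Z by lia. ring. }
  replace (ZSeries u) with (ZSeries u + (0 + (-(1)) * 0))%C by ring.
  apply Clim_plus; [now apply ZSeries_lim|].
  apply Clim_plus; [now apply dom_lim_pos|]. now apply Clim_scal, dom_lim_neg.
Qed.

Lemma ZSeries_shift (u : Z -> C) (m : Z) : dom u ->
  ZSeries (fun n => u (n + m)%Z) = ZSeries u.
Proof.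
  intros Hu. assert (Hp : forall p : nat, ZSeries (fun n => u (n + Z.of_nat p)%Z) = ZSeries u
     /\ ZSeries (fun n => u (n - Z.of_nat p)%Z) = ZSeries u).
  { induction p as [|p [IH1 IH2]].
    - split; apply ZSeries_ext; intros n; f_equal; lia.
    - split.
      + rewrite <- IH1, <- (ZSeries_shift1 (fun n => u (n + Z.of_nat p)%Z)) by now apply dom_shift.
        apply ZSeries_ext; intros n; f_equal; lia.
      + rewrite <- IH2, <- (ZSeries_shift1 (fun n => u (n - Z.of_nat (S p))%Z)).
        2:{ apply (dom_ext (fun n => u (n + (- Z.of_nat (S p)))%Z)); [reflexivity|]. now apply dom_shift. }
        apply ZSeries_ext; intros n; f_equal; lia. }
  destruct (Z_le_gt_dec 0 m) as [H|H].
  - rewrite <- (proj1 (Hp (Z.to_nat m))). apply ZSeries_ext; intros n; f_equal; lia.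
  - rewrite <- (proj2 (Hp (Z.to_nat (- m)))). apply ZSeries_ext; intros n; f_equal; lia.
Qed.

(** Reflecting the window -K <= n < K gives -K < n <= K, hence the same two vanishing boundary terms
    as for a shift. *)
Lemma ZSeries_opp (u : Z -> C) : dom u -> ZSeries (fun n => u (- n)%Z) = ZSeries u.
Proof.
  intros Hu. apply ZSeries_eq; [now apply dom_opp|].
  apply Clim_ext with
    (fun K => part u K + (u (Z.of_nat K) + (-(1)) * u (- Z.of_nat K)%Z))%C.
  { induction n as [|n IH]; [simpl; ring|]. cbn [part]. rewrite <- IH.
    replace (- - Z.of_nat (S n))%Z with (Z.of_nat (S n)) by lia. ring. }
  replace (ZSeries u) with (ZSeries u + (0 + (-(1)) * 0))%C by ring.
  apply Clim_plus; [now apply ZSeries_lim|].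
  apply Clim_plus; [now apply dom_lim_pos|]. now apply Clim_scal, dom_lim_neg.
Qed.

Lemma ZSeries_Cmod_le (u : Z -> C) (M : R) : dom u ->
  (forall K, rpart (fun n => Cmod (u n)) K <= M) -> Cmod (ZSeries u) <= M.
Proof.
  intros Hu H. apply (Clim_Cmod_le (part u) _ (fun _ => M)).
  - now apply ZSeries_lim.
  - intros K. eapply Rle_trans; [apply part_Cmod|apply H].
  - apply is_lim_seq_const.
Qed.

Lemma ZSeries_tail (B : R) (u : Z -> C) (J : nat) : domB B u ->
  Cmod (ZSeries u - part u J)%C <= 4 * B / (1 + INR J).
Proof.
  intros H.
  apply (Clim_Cmod_le (fun k => part u (k + J) - part u J)%C _ (fun _ => 4 * B / (1 + INR J))).
  - apply Clim_plus; [|apply Clim_const].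
    assert (HL : Clim (part u) (ZSeries u)) by (apply ZSeries_lim; now exists B).
    apply is_lim_seq_incr_n with (N := J) in HL. exact HL.
  - intros k. now apply part_dom_tail.
  - apply is_lim_seq_const.
Qed.

Lemma part_Clim (f : nat -> Z -> C) (g : Z -> C) (J : nat) :
  (forall n, Clim (fun K => f K n) (g n)) -> Clim (fun K => part (f K) J) (part g J).
Proof.
  intros H. induction J as [|J IH]; simpl; [apply Clim_const|].
  apply Clim_plus; auto. apply Clim_plus; apply H.
Qed.

(** Dominated convergence for series: J is chosen so that the tails of all [f K] and of [g] are
    below eps/4 at once, and the finite part is then handled by termwise convergence. *)
Lemma Tannery (f : nat -> Z -> C) (g : Z -> C) (B : R) :
  (forall K, domB B (f K)) -> (forall n, Clim (fun K => f K n) (g n)) ->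
  Clim (fun K => ZSeries (f K)) (ZSeries g).
Proof.
  intros Hf Hg.
  assert (HgB : domB B g).
  { intros n. apply (Clim_Cmod_le (fun K => f K n) _ (fun _ => B * env (IZR n))); auto.
    - intros K. apply Hf.
    - apply is_lim_seq_const. }
  unfold Clim. apply is_lim_seq_spec. intros eps.
  pose proof (is_lim_seq_inv_INR (4 * B)) as HJ. apply is_lim_seq_spec in HJ.
  destruct (HJ (pos_div_2 (pos_div_2 eps))) as [J HJ']. specialize (HJ' J (le_n J)).
  pose proof (part_Clim f g J Hg) as HP. apply is_lim_seq_spec in HP.
  destruct (HP (pos_div_2 (pos_div_2 eps))) as [N HN].
  exists N. intros K HK. specialize (HN K HK).
  rewrite Rminus_0_r, Rabs_pos_eq in HN |- * by apply Cmod_ge_0.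
  rewrite Rminus_0_r in HJ'. apply Rabs_def2 in HJ'. simpl in *.
  pose proof (ZSeries_tail B (f K) J (Hf K)). pose proof (ZSeries_tail B g J HgB).
  replace (ZSeries (f K) - ZSeries g)%C with
    ((ZSeries (f K) - part (f K) J) + ((part (f K) J - part g J) + - (ZSeries g - part g J)))%C by ring.
  eapply Rle_lt_trans; [apply Cmod_triangle|].
  pose proof (Cmod_triangle (part (f K) J - part g J) (- (ZSeries g - part g J))).
  rewrite Cmod_opp in H1. lra.
Qed.


Lemma Ci_Ci : (Ci * Ci)%C = (-(1))%C.
Proof. unfold Ci, Cmult, Copp, RtoC; simpl; f_equal; ring. Qed.

(** * The complex exponential and roots of unity *)

Ltac Cpush := repeat first [rewrite RtoC_plus | rewrite RtoC_minus | rewrite RtoC_opp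
  | rewrite RtoC_mult | rewrite RtoC_pow | rewrite RtoC_div by lra | rewrite RtoC_inv by lra ].

Lemma Cexp_add (a b : C) : Cexp (a + b) = (Cexp a * Cexp b)%C.
Proof.
  destruct a as [a1 a2], b as [b1 b2]. unfold Cexp, Cmult. simpl.
  rewrite exp_plus, cos_plus, sin_plus. f_equal; ring.
Qed.

Lemma Cexp_0 : Cexp 0 = 1.
Proof. unfold Cexp, RtoC; simpl. rewrite exp_0, cos_0, sin_0. f_equal; ring. Qed.

Lemma Cmod_Cexp (z : C) : Cmod (Cexp z) = exp (Re z).
Proof.
  unfold Cmod, Cexp; simpl.
  replace (_ + _) with (exp (Re z) * exp (Re z) * (Rsqr (sin (Im z)) + Rsqr (cos (Im z))))
    by (unfold Rsqr; ring).
  rewrite sin2_cos2, Rmult_1_r. apply sqrt_square. left; apply exp_pos.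
Qed.

Lemma Cexp_neq_0 (z : C) : Cexp z <> 0.
Proof.
  intros H. pose proof (Cmod_Cexp z) as E. rewrite H, Cmod_0 in E.
  pose proof (exp_pos (Re z)). lra.
Qed.

Lemma Cexp_pow (z : C) (n : nat) : (Cexp z ^ n)%C = Cexp (RtoC (INR n) * z).
Proof.
  induction n as [|n IH].
  - simpl. replace (0 * z)%C with (RtoC 0) by ring. now rewrite Cexp_0.
  - rewrite Cpow_S, IH, <- Cexp_add, S_INR, RtoC_plus. f_equal. ring.
Qed.

Lemma e_add (a b : C) : e (a + b) = (e a * e b)%C.
Proof. unfold e. rewrite <- Cexp_add. f_equal. ring. Qed.

Lemma e_0 : e 0 = 1.
Proof. unfold e. rewrite <- Cexp_0. f_equal. ring. Qed.

Lemma e_neq_0 (a : C) : e a <> 0.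
Proof. apply Cexp_neq_0. Qed.

Lemma e_pow (a : C) (n : nat) : (e a ^ n)%C = e (RtoC (INR n) * a).
Proof. unfold e. rewrite Cexp_pow. f_equal. ring. Qed.

Lemma e_R (x : R) : e (RtoC x) = (cos (2 * PI * x), sin (2 * PI * x)).
Proof.
  unfold e, Cexp. simpl.
  replace (_ - _) with 0 by ring. rewrite exp_0, !Rmult_1_l.
  f_equal; f_equal; ring.
Qed.

Lemma Cmod_e_R (x : R) : Cmod (e (RtoC x)) = 1.
Proof.
  unfold e. rewrite Cmod_Cexp. simpl. rewrite <- exp_0. f_equal. ring.
Qed.

Lemma e_nat (n : nat) : e (RtoC (INR n)) = 1.
Proof.
  induction n as [|n IH]; [apply e_0|].
  rewrite S_INR, RtoC_plus, e_add, IH, e_R, Rmult_1_r, cos_2PI, sin_2PI.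
  unfold RtoC, Cmult; simpl. f_equal; ring.
Qed.

Lemma e_Z (n : Z) : e (RtoC (IZR n)) = 1.
Proof.
  destruct (Z_le_gt_dec 0 n) as [H|H].
  - rewrite <- (Z2Nat.id n H), <- INR_IZR_INZ. apply e_nat.
  - assert (E : (e (RtoC (IZR n)) * e (RtoC (INR (Z.to_nat (- n)))))%C = 1).
    { rewrite <- e_add, <- RtoC_plus, INR_IZR_INZ, Z2Nat.id, <- plus_IZR by lia.
      replace (n + - n)%Z with 0%Z by lia. apply e_0. }
    rewrite e_nat in E. rewrite <- E. ring.
Qed.

Lemma e_neq_1 (t : R) : 0 < t < 1 -> e (RtoC t) <> 1.
Proof.
  intros Ht E. rewrite e_R in E. injection E as Hc _.
  replace (2 * PI * t) with (2 * (PI * t)) in Hc by ring.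
  rewrite cos_2a_sin in Hc. pose proof PI_RGT_0.
  assert (0 < sin (PI * t)) by (apply sin_gt_0; nra). nra.
Qed.

Fixpoint csum (f : nat -> C) (n : nat) : C :=
  match n with
  | O => RtoC 0
  | S m => (csum f m + f m)%C
  end.

Lemma csum_ext (f g : nat -> C) (n : nat) :
  (forall i, (i < n)%nat -> f i = g i) -> csum f n = csum g n.
Proof.
  induction n as [|n IH]; intros H; simpl; [reflexivity|].
  rewrite IH, H; auto.
Qed.

Lemma csum_scal (a : C) (f : nat -> C) (n : nat) :
  csum (fun i => a * f i)%C n = (a * csum f n)%C.
Proof. induction n as [|n IH]; simpl; [ring|rewrite IH; ring]. Qed.

Lemma csum_plus (f g : nat -> C) (n : nat) :
  csum (fun i => f i + g i)%C n = (csum f n + csum g n)%C.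
Proof. induction n as [|n IH]; simpl; [ring|rewrite IH; ring]. Qed.

Lemma csum_const_0 (n : nat) : csum (fun _ => RtoC 0) n = 0.
Proof. induction n as [|n IH]; simpl; [reflexivity|rewrite IH; ring]. Qed.

Lemma csum_geom (x : C) (n : nat) : ((x - 1) * csum (fun j => x ^ j) n)%C = (x ^ n - 1)%C.
Proof. induction n as [|n IH]; simpl; [ring|]. rewrite Cmult_plus_distr_l, IH. ring. Qed.

(** Orthogonality of the characters of Z/N. Reducing [a] to its remainder r makes the sum geometric
    with ratio e(r/N), which is 1 only for r = 0. *)
Lemma csum_roots (N : nat) (a : Z) : (0 < N)%nat ->
  csum (fun j => e (RtoC (IZR a * INR j / INR N))) N
  = if (a mod Z.of_nat N =? 0)%Z then RtoC (INR N) else 0.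
Proof.
  intros HN. assert (HN' : 0 < INR N) by now apply lt_0_INR.
  set (r := (a mod Z.of_nat N)%Z). set (q := (a / Z.of_nat N)%Z).
  assert (Ha : a = (Z.of_nat N * q + r)%Z) by (apply Z.div_mod; lia).
  assert (Hr : (0 <= r < Z.of_nat N)%Z) by (apply Z.mod_pos_bound; lia).
  set (x := e (RtoC (IZR r / INR N))).
  rewrite (csum_ext _ (fun j => x ^ j)%C).
  2:{ intros j _. unfold x. rewrite e_pow.
      replace (IZR a * INR j / INR N) with (IZR (q * Z.of_nat j) + INR j * (IZR r / INR N)).
      - rewrite RtoC_plus, e_add, e_Z, RtoC_mult. ring.
      - rewrite Ha, plus_IZR, !mult_IZR, <- !INR_IZR_INZ. field. lra. }
  destruct (Z.eqb_spec r 0) as [Hr0|Hr0].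
  - assert (Hx : x = 1).
    { unfold x. rewrite Hr0. unfold Rdiv. rewrite Rmult_0_l. apply e_0. }
    rewrite Hx. clear. induction N as [|N IH]; [reflexivity|].
    cbn [csum]. rewrite IH, Cpow_1_l, S_INR, RtoC_plus. reflexivity.
  - assert (Hx : x <> 1).
    { apply e_neq_1. split.
      - apply Rdiv_lt_0_compat; auto. apply IZR_lt. lia.
      - apply Rmult_lt_reg_r with (INR N); auto. unfold Rdiv.
        rewrite Rmult_assoc, Rinv_l, Rmult_1_r, Rmult_1_l, INR_IZR_INZ by lra.
        apply IZR_lt. lia. }
    pose proof (csum_geom x N) as E.
    assert (Hp : (x ^ N)%C = 1).
    { unfold x. rewrite e_pow, <- RtoC_mult.
      replace (INR N * (IZR r / INR N)) with (IZR r) by (field; lra). apply e_Z. }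
    rewrite Hp in E. replace (1 - 1)%C with (RtoC 0) in E by ring.
    assert (x - 1 <> 0)%C. { intros H. apply Hx. replace x with (x - 1 + 1)%C by ring. rewrite H. ring. }
    replace (csum (fun j : nat => x ^ j) N)%C with (/ (x - 1) * ((x - 1) * csum (fun j : nat => x ^ j) N))%C
      by (field; auto).
    rewrite E. ring.
Qed.

(** * Rearrangement of series over Z *)

Lemma rpart_nonneg (v : Z -> R) (K : nat) : (forall n, 0 <= v n) -> 0 <= rpart v K.
Proof.
  intros H. induction K as [|K IH]; simpl; [lra|].
  pose proof (H (Z.of_nat K)). pose proof (H (Z.neg (Pos.of_succ_nat K))). lra.
Qed.

Lemma rpart_ge_term (v : Z -> R) (n : Z) : (forall n, 0 <= v n) ->
  exists K, v n <= rpart v K.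
Proof.
  intros H. destruct (Z_le_gt_dec 0 n) as [Hn|Hn].
  - exists (S (Z.to_nat n)). cbn [rpart]. rewrite Z2Nat.id by lia.
    pose proof (rpart_nonneg v (Z.to_nat n) H). pose proof (H (- Z.of_nat (S (Z.to_nat n)))%Z). lra.
  - exists (S (Z.to_nat (- n - 1))). cbn [rpart].
    replace (- Z.of_nat (S (Z.to_nat (- n - 1))))%Z with n by lia.
    pose proof (rpart_nonneg v (Z.to_nat (- n - 1)) H). pose proof (H (Z.of_nat (Z.to_nat (- n - 1)))). lra.
Qed.

Lemma dom_0 : dom (fun _ => RtoC 0).
Proof. exists 0. intros n. rewrite Cmod_0. lra. Qed.

Lemma ZSeries_0 : ZSeries (fun _ => RtoC 0) = 0.
Proof.
  apply ZSeries_eq; [apply dom_0|]. apply Clim_ext with (fun _ => RtoC 0); [|apply Clim_const].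
  induction n as [|n IH]; simpl; [reflexivity|rewrite <- IH; ring].
Qed.

Lemma part_ZSeries (u : Z -> Z -> C) (K : nat) : (forall n, dom (fun m => u m n)) ->
  part (fun n => ZSeries (fun m => u m n)) K = ZSeries (fun m => part (u m) K)
  /\ dom (fun m => part (u m) K).
Proof.
  intros H. induction K as [|K [IH1 IH2]]; simpl.
  - rewrite ZSeries_0. split; [reflexivity|apply dom_0].
  - split.
    + rewrite ZSeries_plus, ZSeries_plus, IH1; auto. now apply dom_plus.
    + apply dom_plus; auto. now apply dom_plus.
Qed.

(** Fubini through [Tannery]: a partial sum over n commutes with the sum over m, and the partial
    sums of row m are bounded by B env(m) uniformly in K. *)
Lemma ZSeries_swap_lim (u : Z -> Z -> C) (B : R) : (forall m, dom (u m)) ->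
  (forall m K, rpart (fun n => Cmod (u m n)) K <= B * env (IZR m)) ->
  Clim (part (fun n => ZSeries (fun m => u m n))) (ZSeries (fun m => ZSeries (u m))).
Proof.
  intros Hd HB.
  assert (Hc : forall n, dom (fun m => u m n)).
  { intros n. exists B. intros m.
    destruct (rpart_ge_term (fun n => Cmod (u m n)) n) as [K HK]; [intros; apply Cmod_ge_0|].
    eapply Rle_trans; [exact HK|apply HB]. }
  apply Clim_ext with (fun K => ZSeries (fun m => part (u m) K)).
  { intros K. now rewrite (proj1 (part_ZSeries u K Hc)). }
  apply Tannery with B.
  - intros K m. eapply Rle_trans; [apply part_Cmod|apply HB].
  - intros m. now apply ZSeries_lim.
Qed.

(** Convergence of the windowed sums does not give the two one-sided limits that [ZSeries] asks for;
    the domination of the column sums supplies them. *)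
Lemma ZSeries_swap (u : Z -> Z -> C) (B : R) : (forall m, dom (u m)) ->
  (forall m K, rpart (fun n => Cmod (u m n)) K <= B * env (IZR m)) ->
  dom (fun n => ZSeries (fun m => u m n)) ->
  ZSeries (fun n => ZSeries (fun m => u m n)) = ZSeries (fun m => ZSeries (u m)).
Proof. intros H1 H2 H3. apply ZSeries_eq; auto. now apply ZSeries_swap_lim with B. Qed.

Definition single (a : Z) (x : C) (n : Z) : C := if (n =? a)%Z then x else 0.

Lemma part_single (a : Z) (x : C) (K : nat) :
  part (single a x) K = if andb (- Z.of_nat K <=? a)%Z (a <? Z.of_nat K)%Z then x else 0.
Proof.
  induction K as [|K IH].
  - simpl. destruct (Z.leb_spec 0 a), (Z.ltb_spec a 0); simpl; try reflexivity; lia.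
  - cbn [part]. rewrite IH. unfold single.
    destruct (Z.leb_spec (- Z.of_nat K) a), (Z.ltb_spec a (Z.of_nat K)),
      (Z.leb_spec (- Z.of_nat (S K)) a), (Z.ltb_spec a (Z.of_nat (S K))),
      (Z.eqb_spec (Z.of_nat K) a), (Z.eqb_spec (- Z.of_nat (S K)) a); simpl; try lia; ring.
Qed.

Lemma rpart_single (a : Z) (x : C) (K : nat) :
  rpart (fun n => Cmod (single a x n)) K <= Cmod x.
Proof.
  assert (E : rpart (fun n => Cmod (single a x n)) K
    = if andb (- Z.of_nat K <=? a)%Z (a <? Z.of_nat K)%Z then Cmod x else 0).
  { induction K as [|K IH].
    - simpl. destruct (Z.leb_spec 0 a), (Z.ltb_spec a 0); simpl; try reflexivity; lia.
    - cbn [rpart]. rewrite IH. unfold single.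
      destruct (Z.leb_spec (- Z.of_nat K) a), (Z.ltb_spec a (Z.of_nat K)),
      (Z.leb_spec (- Z.of_nat (S K)) a), (Z.ltb_spec a (Z.of_nat (S K))),
      (Z.eqb_spec (Z.of_nat K) a), (Z.eqb_spec (- Z.of_nat (S K)) a); simpl; try lia;
      rewrite ?Cmod_0; ring. }
  rewrite E. pose proof (Cmod_ge_0 x). destruct (andb _ _); lra.
Qed.

Lemma dom_single (a : Z) (x : C) : dom (single a x).
Proof.
  exists (Cmod x * / env (IZR a)). intros n. pose proof (env_pos (IZR a)). unfold single.
  destruct (Z.eqb_spec n a) as [->|_].
  - rewrite Rmult_assoc, Rinv_l by lra. lra.
  - rewrite Cmod_0. pose proof (env_pos (IZR n)). pose proof (Cmod_ge_0 x).
    apply Rmult_le_pos; [|lra]. apply Rmult_le_pos; auto. left; now apply Rinv_0_lt_compat.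
Qed.

Lemma ZSeries_single (a : Z) (x : C) : ZSeries (single a x) = x.
Proof.
  apply ZSeries_eq; [apply dom_single|].
  apply is_lim_seq_incr_n with (N := S (Z.abs_nat a)).
  apply is_lim_seq_ext with (fun _ => 0); [|apply is_lim_seq_const].
  intros n. rewrite part_single.
  destruct (Z.leb_spec (- Z.of_nat (n + S (Z.abs_nat a))) a),
     (Z.ltb_spec a (Z.of_nat (n + S (Z.abs_nat a)))); simpl; try lia.
  replace (x - x)%C with (RtoC 0) by ring. now rewrite Cmod_0.
Qed.

Lemma dom_affine (u : Z -> C) (c k : Z) : (k <> 0)%Z -> dom u -> dom (fun l => u (c + k * l)%Z).
Proof.
  intros Hk [B HB]. exists (B * (1 + Rabs (IZR c)) ^ 2). intros l.
  eapply Rle_trans; [apply HB|]. rewrite Rmult_assoc. apply Rmult_le_compat_l.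
  { now apply domB_pos with u. }
  replace (c + k * l)%Z with (k * l + c)%Z by ring. rewrite plus_IZR.
  eapply Rle_trans; [apply env_shift|]. apply Rmult_le_compat_l; [apply pow2_ge_0|].
  replace (env (IZR l)) with (1 ^ 2 * env (IZR l)) by ring. apply env_le.
  rewrite <- !abs_IZR, Rmult_1_l. apply Rplus_le_compat_l, IZR_le. nia.
Qed.

(** The restricted term is a sum over l of point masses at c + k l; exchanging the two summations
    leaves one mass per l. *)
Lemma ZSeries_residue (u : Z -> C) (c k : Z) : (k <> 0)%Z -> dom u ->
  ZSeries (fun n => if ((n - c) mod k =? 0)%Z then u n else 0)
  = ZSeries (fun l => u (c + k * l)%Z).
Proof.
  intros Hk Hu. pose proof (dom_affine u c k Hk Hu) as [B HB].
  assert (E : forall n, ZSeries (fun l => single (c + k * l)%Z (u (c + k * l)%Z) n)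
     = if ((n - c) mod k =? 0)%Z then u n else 0).
  { intros n. destruct (Z.eqb_spec ((n - c) mod k) 0) as [H|H].
    - apply Z.mod_divide in H; auto. destruct H as [l0 Hl0].
      rewrite <- (ZSeries_single l0 (u n)). apply ZSeries_ext. intros l. unfold single.
      destruct (Z.eqb_spec n (c + k * l)) as [->|], (Z.eqb_spec l l0); try reflexivity; nia.
    - rewrite <- ZSeries_0. apply ZSeries_ext. intros l. unfold single.
      destruct (Z.eqb_spec n (c + k * l)) as [->|]; [|reflexivity].
      exfalso. apply H. replace (c + k * l - c)%Z with (l * k)%Z by ring. now apply Z.mod_mul. }
  rewrite <- (ZSeries_ext _ _ E).
  rewrite (ZSeries_swap (fun l n => single (c + k * l)%Z (u (c + k * l)%Z) n) B).
  - apply ZSeries_ext. intros l. apply ZSeries_single.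
  - intros l. apply dom_single.
  - intros l K. eapply Rle_trans; [apply rpart_single|apply HB].
  - apply dom_ext with (fun n => if ((n - c) mod k =? 0)%Z then u n else 0); [intros; now rewrite E|].
    apply dom_le with u 1; auto; [lra|]. intros n. rewrite Rmult_1_l.
    destruct (_ =? _)%Z; [lra|]. rewrite Cmod_0. apply Cmod_ge_0.
Qed.

Lemma ZSeries_csum (f : nat -> Z -> C) (n : nat) : (forall i, dom (f i)) ->
  ZSeries (fun m => csum (fun i => f i m) n) = csum (fun i => ZSeries (f i)) n
  /\ dom (fun m => csum (fun i => f i m) n).
Proof.
  intros H. induction n as [|n [IH1 IH2]]; simpl.
  - split; [apply ZSeries_0|apply dom_0].
  - split; [rewrite ZSeries_plus, IH1; auto|now apply dom_plus].
Qed.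

(** For each n exactly one i < k is congruent to n - c. The starting residue [c] is kept free so
    that the classes can later be aligned with [frakB]. *)
Lemma ZSeries_mod_split (u : Z -> C) (c : Z) (k : nat) : (0 < k)%nat -> dom u ->
  ZSeries u = csum (fun i => ZSeries (fun l => u (c + Z.of_nat i + Z.of_nat k * l)%Z)) k.
Proof.
  intros Hk Hu.
  rewrite (csum_ext _ (fun i => ZSeries (fun n =>
     if ((n - (c + Z.of_nat i)) mod Z.of_nat k =? 0)%Z then u n else 0))).
  2:{ intros i _. symmetry. apply ZSeries_residue; [lia|auto]. }
  rewrite <- (proj1 (ZSeries_csum (fun i n =>
     if ((n - (c + Z.of_nat i)) mod Z.of_nat k =? 0)%Z then u n else 0) k ltac:(
       intros i; apply dom_le with u 1; auto; [lra|]; intros n; rewrite Rmult_1_l;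
       destruct (_ =? _)%Z; [lra|]; rewrite Cmod_0; apply Cmod_ge_0))).
  apply ZSeries_ext. intros n. symmetry.
  set (i0 := Z.to_nat ((n - c) mod Z.of_nat k)).
  pose proof (Z.mod_pos_bound (n - c) (Z.of_nat k) ltac:(lia)) as Hb.
  assert (G : forall p, (p <= k)%nat -> csum (fun i =>
     if ((n - (c + Z.of_nat i)) mod Z.of_nat k =? 0)%Z then u n else 0) p
     = if (i0 <? p)%nat then u n else 0).
  { induction p as [|p IH]; intros Hp; [reflexivity|]. cbn [csum]. rewrite IH by lia.
    assert (Hq : ((n - (c + Z.of_nat p)) mod Z.of_nat k =? 0)%Z = (i0 =? p)%nat).
    { pose proof (Z.div_mod (n - c) (Z.of_nat k) ltac:(lia)) as Hd.
      destruct (Nat.eqb_spec i0 p) as [Hi|Hi].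
      - apply Z.eqb_eq. replace (n - (c + Z.of_nat p))%Z with ((n - c) / Z.of_nat k * Z.of_nat k)%Z by lia.
        apply Z.mod_mul. lia.
      - apply Z.eqb_neq. intros H. apply Z.mod_divide in H; [|lia]. destruct H as [q Hq].
        apply Hi. unfold i0. replace (n - c)%Z with (Z.of_nat p + q * Z.of_nat k)%Z by lia.
        rewrite Z.mod_add by lia. rewrite Z.mod_small by lia. lia. }
    rewrite Hq. destruct (Nat.ltb_spec i0 p), (Nat.eqb_spec i0 p), (Nat.ltb_spec i0 (S p)); try lia; ring. }
  rewrite G by lia. destruct (Nat.ltb_spec i0 k); [reflexivity|lia].
Qed.

(** * Convolutions and Cauchy products *)

Definition conv (a b : Z -> C) (m : Z) : C := ZSeries (fun j => a j * b (m - j)%Z)%C.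

(** With p = 1+|x|, q = 1+|y| and r = 1+|x+y|, the inequality r <= p + q gives r^2 <= 2(p^2 + q^2);
    divide by p^2 q^2 r^2. *)
Lemma env_conv (x y : R) : env x * env y <= 2 * env (x + y) * (env x + env y).
Proof.
  unfold env. pose proof (Rabs_triang x y) as T.
  pose proof (Rabs_pos x). pose proof (Rabs_pos y). pose proof (Rabs_pos (x + y)).
  set (p := 1 + Rabs x) in *. set (q := 1 + Rabs y) in *. set (r := 1 + Rabs (x + y)) in *.
  assert (1 <= p) by (unfold p; lra). assert (1 <= q) by (unfold q; lra).
  assert (1 <= r) by (unfold r; lra). assert (r <= p + q) by (unfold p, q, r; lra).
  apply Rmult_le_reg_r with (p ^ 2 * q ^ 2 * r ^ 2).
  { apply Rmult_lt_0_compat; [apply Rmult_lt_0_compat|]; apply pow_lt; lra. }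
  replace (/ p ^ 2 * / q ^ 2 * (p ^ 2 * q ^ 2 * r ^ 2)) with (r ^ 2) by (field; lra).
  replace (2 * / r ^ 2 * (/ p ^ 2 + / q ^ 2) * (p ^ 2 * q ^ 2 * r ^ 2))
    with (2 * (p ^ 2 + q ^ 2)) by (field; lra).
  pose proof (pow2_ge_0 (p - q)). assert (r ^ 2 <= (p + q) ^ 2) by (apply pow_incr; lra). lra.
Qed.

(** The constant is 2(4 + 4): the 2 of [env_conv], and 4 for each of the two sums of [env]. *)
Lemma conv_bound (a b : Z -> C) (A B : R) (m : Z) (K : nat) : domB A a -> domB B b ->
  rpart (fun j => Cmod (a j * b (m - j)%Z)) K <= 16 * A * B * env (IZR m).
Proof.
  intros Ha Hb. pose proof (domB_pos A a Ha). pose proof (domB_pos B b Hb).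
  pose proof (env_pos (IZR m)).
  apply Rle_trans with (rpart (fun j => (2 * A * B * env (IZR m)) *
     (1 * env (0 + 1 * IZR j) + 1 * env (- IZR m + 1 * IZR j))) K).
  { apply rpart_le. intros j. rewrite Cmod_mult. rewrite !Rmult_1_l, Rplus_0_l.
    replace (- IZR m + IZR j) with (- (IZR (m - j))) by (rewrite minus_IZR; ring).
    rewrite env_opp. pose proof (env_conv (IZR j) (IZR (m - j))) as E.
    rewrite <- plus_IZR in E. replace (j + (m - j))%Z with m in E by ring.
    apply Rle_trans with ((A * env (IZR j)) * (B * env (IZR (m - j)))).
    { apply Rmult_le_compat; try apply Cmod_ge_0; auto. }
    replace (A * env (IZR j) * (B * env (IZR (m - j)))) with (A * B * (env (IZR j) * env (IZR (m - j)))) by ring.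
    replace (2 * A * B * env (IZR m) * (env (IZR j) + env (IZR (m - j)))) with
      (A * B * (2 * env (IZR m) * (env (IZR j) + env (IZR (m - j))))) by ring.
    apply Rmult_le_compat_l; [nra|exact E]. }
  rewrite rpart_scal.
  assert (Hs : forall v w, rpart (fun j => v j + w j) K = rpart v K + rpart w K).
  { intros v w. clear. induction K as [|K IH]; simpl; [ring|rewrite IH; ring]. }
  rewrite (Hs (fun j => 1 * env (0 + 1 * IZR j))).
  pose proof (rpart_env_le 1 0 K ltac:(lra)). pose proof (rpart_env_le 1 (- IZR m) K ltac:(lra)).
  replace (16 * A * B * env (IZR m)) with (2 * A * B * env (IZR m) * (4 + 4)) by ring.
  apply Rmult_le_compat_l; [|lra]. repeat apply Rmult_le_pos; lra.
Qed.

Lemma dom_conv_term (a b : Z -> C) (m : Z) : dom a -> dom b ->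
  dom (fun j => a j * b (m - j)%Z)%C.
Proof.
  intros Ha [B Hb]. apply dom_le with a B; auto; [now apply domB_pos with b|].
  intros n. rewrite Cmod_mult, Rmult_comm. apply Rmult_le_compat_r; [apply Cmod_ge_0|].
  eapply Rle_trans; [apply Hb|]. pose proof (env_le_1 (IZR (m - n))). pose proof (domB_pos B b Hb). nra.
Qed.

Lemma dom_conv (a b : Z -> C) : dom a -> dom b -> dom (conv a b).
Proof.
  intros [A Ha] [B Hb]. exists (16 * A * B). intros m. apply ZSeries_Cmod_le.
  - apply dom_conv_term; [now exists A|now exists B].
  - intros K. now apply conv_bound.
Qed.

(** Fubini for a(j) b(m-j); for fixed j the sum over m is the full series of [b] by shift
    invariance. *)
Lemma ZSeries_conv (a b : Z -> C) : dom a -> dom b ->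
  ZSeries (conv a b) = (ZSeries a * ZSeries b)%C.
Proof.
  intros Ha Hb. pose proof (dom_conv a b Ha Hb) as Hc. unfold conv.
  destruct Ha as [A HA]. destruct Hb as [B HB].
  assert (Hsh : forall j, dom (fun m => b (m - j)%Z)).
  { intros j. apply (dom_shift b (- j)). now exists B. }
  rewrite (ZSeries_swap (fun j m => a j * b (m - j)%Z)%C (A * (B * 4))).
  - rewrite (ZSeries_ext _ (fun j => ZSeries b * a j)%C).
    + rewrite ZSeries_scal by now exists A. ring.
    + intros j. rewrite (ZSeries_scal (a j) (fun m => b (m - j)%Z)); auto.
      pose proof (ZSeries_shift b (- j) ltac:(now exists B)) as E.
      unfold Z.sub. rewrite E. ring.
  - intros j. now apply dom_scal.
  - intros j K. apply Rle_trans with (Cmod (a j) * (B * rpart (fun m => 1 * env (- IZR j + 1 * IZR m)) K)).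
    + rewrite <- !rpart_scal. apply rpart_le. intros m. rewrite Cmod_mult.
      apply Rmult_le_compat_l; [apply Cmod_ge_0|].
      eapply Rle_trans; [apply HB|]. rewrite minus_IZR. right. do 2 f_equal; ring_simplify; f_equal; ring.
    + pose proof (rpart_env_le 1 (- IZR j) K ltac:(lra)). pose proof (HA j). pose proof (Cmod_ge_0 (a j)).
      pose proof (domB_pos B b HB). replace (A * (B * 4) * env (IZR j)) with (A * env (IZR j) * (B * 4)) by ring.
      apply Rmult_le_compat; auto.
      * apply Rmult_le_pos; auto. apply rpart_nonneg. intros n.
        pose proof (env_pos (- IZR j + 1 * IZR n)). lra.
      * now apply Rmult_le_compat_l.
  - exact Hc.
Qed.

(** * Uniqueness of the coefficients of an expansion in zeta *)

Lemma is_series_terms_bounded (a : nat -> C) (l : C) :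
  is_series (V := C_R_NormedModule) a l -> exists M, forall n, Cmod (a n) <= M.
Proof.
  intros H. apply Clim_filterlim in H. unfold Clim in H.
  assert (Hb : exists M, forall n, Cmod (sum_n (G := C_R_NormedModule) a n - l)%C <= M).
  { apply is_lim_seq_spec in H. destruct (H (mkposreal 1 Rlt_0_1)) as [N HN]. simpl in HN.
    assert (Hf : forall (v : nat -> R) N, exists M, forall n, (n < N)%nat -> v n <= M).
    { intros v. induction N0 as [|p [M HM]]; [exists 0; intros; lia|].
      exists (Rmax M (v p)). intros n Hn. destruct (Nat.eq_dec n p) as [->|].
      - apply Rmax_r.
      - eapply Rle_trans; [apply HM; lia|apply Rmax_l]. }
    destruct (Hf (fun n => Cmod (sum_n (G := C_R_NormedModule) a n - l)%C) N) as [M HM].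
    exists (Rmax M 1). intros n. destruct (lt_dec n N) as [Hn|Hn].
    - eapply Rle_trans; [apply (HM n Hn)|apply Rmax_l].
    - eapply Rle_trans; [|apply Rmax_r]. specialize (HN n ltac:(lia)).
      rewrite Rminus_0_r in HN. apply Rabs_def2 in HN. lra. }
  destruct Hb as [M HM]. exists (2 * M + Cmod l). intros n.
  pose proof (Cmod_ge_0 l) as Hl0.
  destruct n as [|n].
  - specialize (HM 0%nat). rewrite sum_O in HM.
    replace (a 0%nat) with (a 0%nat - l + l)%C by ring.
    eapply Rle_trans; [apply Cmod_triangle|].
    pose proof (Cmod_ge_0 (a 0%nat - l)). lra.
  - pose proof (HM n) as H1. pose proof (HM (S n)) as H2. rewrite sum_Sn in H2.
    set (s := sum_n _ n) in *. clearbody s.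
    change (Cmod (s + a (S n) - l)%C <= M) in H2.
    replace (a (S n)) with ((s + a (S n) - l) + - (s - l))%C by ring.
    eapply Rle_trans; [apply Cmod_triangle|]. rewrite Cmod_opp. lra.
Qed.

Lemma exp_le_env (n : nat) : exp (- INR n) <= 4 * env (INR n).
Proof.
  pose proof (pos_INR n). unfold env. rewrite Rabs_pos_eq by lra.
  rewrite exp_Ropp.
  replace (4 * / (1 + INR n) ^ 2) with (/ (((1 + INR n) / 2) ^ 2)) by (field; lra).
  apply Rinv_le_contravar; [apply pow_lt; lra|].
  replace (INR n) with (INR n / 2 + INR n / 2) at 2 by lra. rewrite exp_plus.
  assert (1 + INR n / 2 <= exp (INR n / 2)).
  { apply exp_ineq1_le. }
  simpl. rewrite Rmult_1_r. apply Rmult_le_compat; lra.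
Qed.

(* Averaging over the [N]-th roots of unity isolates the coefficients whose
   index is congruent to [m0] modulo [N]; only [d m0] survives as [N] grows. *)
Lemma zeta_coef_zero (d : Z -> C) (m0 : Z) :
  (forall z : C, is_Zseries (fun m => d m * e (RtoC (IZR m) * z))%C 0) -> d m0 = 0.
Proof.
  intros H.
  (* At z = -i/(2 pi) and z = i/(2 pi) the modulus of e(m z) is exp(m) and exp(-m). Terms of a
     convergent series are bounded, so [d] decays exponentially in both directions. *)
  assert (Hd : dom d).
  { destruct (H (0, - / (2 * PI))) as (l1 & _ & Hp & _ & _).
    destruct (H (0, / (2 * PI))) as (_ & l2 & _ & Hn & _).
    apply is_series_terms_bounded in Hp. apply is_series_terms_bounded in Hn.
    destruct Hp as [M1 H1]. destruct Hn as [M2 H2]. pose proof PI_RGT_0 as HPI.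
    assert (Hpos : forall n : nat, Cmod (d (Z.of_nat n)) <= M1 * (4 * env (INR n))).
    { intros n. specialize (H1 n). rewrite Cmod_mult in H1.
      unfold e in H1. rewrite Cmod_Cexp in H1. simpl in H1.
      replace (_ - _) with (INR n) in H1 by (rewrite INR_IZR_INZ; field; lra).
      pose proof (exp_pos (INR n)).
      assert (0 <= M1) by (pose proof (Cmod_ge_0 (d (Z.of_nat n))); nra).
      apply Rle_trans with (M1 * exp (- INR n)).
      - rewrite exp_Ropp. apply Rmult_le_reg_r with (exp (INR n)); auto.
        rewrite Rmult_assoc, Rinv_l by lra. lra.
      - apply Rmult_le_compat_l; auto. apply exp_le_env. }
    assert (Hneg : forall n : nat, Cmod (d (- Z.of_nat (S n))%Z) <= M2 * (4 * env (INR (S n)))).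
    { intros n. specialize (H2 n). rewrite Cmod_mult in H2.
      unfold e in H2. rewrite Cmod_Cexp in H2. cbn [Re Im fst snd RtoC Ci Cmult] in H2.
      match type of H2 with _ * exp ?x <= _ => replace x with (INR (S n)) in H2 end.
      2:{ unfold Re, Im, Cmult, RtoC, Ci. cbn [fst snd]. rewrite opp_IZR, <- INR_IZR_INZ. field. lra. }
      pose proof (exp_pos (INR (S n))).
      assert (0 <= M2) by (pose proof (Cmod_ge_0 (d (- Z.of_nat (S n))%Z)); nra).
      apply Rle_trans with (M2 * exp (- INR (S n))).
      - rewrite exp_Ropp. apply Rmult_le_reg_r with (exp (INR (S n))); auto.
        rewrite Rmult_assoc, Rinv_l by lra. lra.
      - apply Rmult_le_compat_l; auto. apply exp_le_env. }
    exists (4 * Rmax M1 M2). intros n. destruct (Z_le_gt_dec 0 n) as [Hn|Hn].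
    - specialize (Hpos (Z.to_nat n)). rewrite INR_IZR_INZ, Z2Nat.id in Hpos by lia.
      pose proof (Rmax_l M1 M2). pose proof (env_pos (IZR n)). nra.
    - specialize (Hneg (Z.to_nat (- n - 1))).
      replace (- Z.of_nat (S (Z.to_nat (- n - 1))))%Z with n in Hneg by lia.
      rewrite <- (env_opp (INR _)), INR_IZR_INZ, <- opp_IZR in Hneg.
      replace (- Z.of_nat (S (Z.to_nat (- n - 1))))%Z with n in Hneg by lia.
      pose proof (Rmax_r M1 M2). pose proof (env_pos (IZR n)). nra. }
  set (f := fun (K : nat) (m : Z) =>
     if ((m - m0) mod Z.of_nat (S K) =? 0)%Z then d m else 0).
  assert (Hf : forall K, ZSeries (f K) = 0).
  { intros K. set (N := S K).
    assert (HN : 0 < INR N) by (apply lt_0_INR; unfold N; lia).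
    assert (HNC : RtoC (INR N) <> 0) by (intros E; apply RtoC_inj in E; lra).
    set (h := fun (j : nat) (m : Z) =>
      ((/ RtoC (INR N) * e (RtoC (- IZR m0 * INR j / INR N))) *
        (d m * e (RtoC (IZR m) * RtoC (INR j / INR N))))%C).
    assert (Hh : forall j, dom (fun m => (d m * e (RtoC (IZR m) * RtoC (INR j / INR N)))%C)).
    { intros j. apply dom_le with d 1; auto; [lra|]. intros m.
      rewrite Cmod_mult, <- RtoC_mult, Cmod_e_R. lra. }
    rewrite (ZSeries_ext _ (fun m => csum (fun j => h j m) N)).
    - rewrite (proj1 (ZSeries_csum h N ltac:(intros j; now apply dom_scal))).
      rewrite (csum_ext _ (fun _ => RtoC 0)); [apply csum_const_0|].
      intros j _. unfold h. rewrite ZSeries_scal by auto.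
      rewrite (ZSeries_unique _ _ (H (RtoC (INR j / INR N)))). ring.
    - intros m. unfold f. fold N.
      rewrite (csum_ext _ (fun j => (/ RtoC (INR N) * d m) * e (RtoC (IZR (m - m0) * INR j / INR N)))%C).
      + rewrite csum_scal, csum_roots by (unfold N; lia).
        destruct (_ =? _)%Z; [field; auto|ring].
      + intros j _. unfold h.
        replace (IZR (m - m0) * INR j / INR N) with
          (- IZR m0 * INR j / INR N + IZR m * (INR j / INR N))
          by (rewrite minus_IZR; field; lra).
        rewrite RtoC_plus, e_add, RtoC_mult. ring. }
  assert (HL : Clim (fun K => ZSeries (f K)) (ZSeries (single m0 (d m0)))).
  { destruct Hd as [B HB]. apply Tannery with B.
    - intros K n. unfold f. destruct (_ =? _)%Z; [apply HB|].
      rewrite Cmod_0. pose proof (domB_pos B d HB). pose proof (env_pos (IZR n)). nra.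
    (* Once the modulus exceeds |n - m0|, the class of m0 contains n only if n = m0. *)
    - intros n. apply is_lim_seq_incr_n with (N := Z.abs_nat (n - m0)).
      apply is_lim_seq_ext with (fun _ => 0); [|apply is_lim_seq_const].
      intros K. unfold f, single.
      assert (E : ((n - m0) mod Z.of_nat (S (K + Z.abs_nat (n - m0))) =? 0)%Z = (n =? m0)%Z).
      { destruct (Z.eqb_spec n m0) as [->|Hn].
        - rewrite Z.sub_diag. apply Z.eqb_eq. apply Z.mod_0_l. lia.
        - apply Z.eqb_neq. intros Hm. apply Z.mod_divide in Hm; [|lia].
          destruct Hm as [q Hq].
          set (P := Z.of_nat (S (K + Z.abs_nat (n - m0)))) in *.
          assert (Z.abs (n - m0) < P)%Z by lia. clearbody P.
          destruct (Z.eq_dec q 0) as [->|]; [lia|]. nia. }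
      rewrite E. destruct (Z.eqb_spec n m0) as [->|_];
        [replace (d m0 - d m0)%C with (RtoC 0) by ring|replace (0 - 0)%C with (RtoC 0) by ring];
        now rewrite Cmod_0. }
  rewrite ZSeries_single in HL. symmetry.
  apply Clim_unique with (fun K => ZSeries (f K)); auto.
  apply Clim_ext with (fun _ => RtoC 0); [intros K; now rewrite Hf|apply Clim_const].
Qed.


(** * Complex-valued functions of a real variable *)

Definition Cder (f : R -> C) (t : R) (d : C) : Prop :=
  is_derive (fun x => Re (f x)) t (Re d) /\ is_derive (fun x => Im (f x)) t (Im d).

Lemma Cder_eq (f : R -> C) (t : R) (d d' : C) : Cder f t d -> d = d' -> Cder f t d'.
Proof. intros H <-. exact H. Qed.

Lemma Cder_const (c : C) (t : R) : Cder (fun _ => c) t 0.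
Proof. split; apply (is_derive_const (K := R_AbsRing) (V := R_NormedModule)). Qed.

Lemma Cder_id (t : R) : Cder RtoC t 1.
Proof.
  split; [apply (is_derive_id (K := R_AbsRing))|
    exact (is_derive_const (K := R_AbsRing) (V := R_NormedModule) 0 t)].
Qed.

Lemma Cder_plus (f g : R -> C) (t : R) (a b : C) :
  Cder f t a -> Cder g t b -> Cder (fun x => f x + g x)%C t (a + b)%C.
Proof.
  intros [H1 H2] [H3 H4]; split;
    apply (is_derive_plus (K := R_AbsRing) (V := R_NormedModule)); assumption.
Qed.

Lemma is_derive_mult_R (u v : R -> R) (t x y : R) : is_derive u t x -> is_derive v t y ->
  is_derive (fun z => u z * v z) t (x * v t + u t * y).
Proof.
  intros Hu Hv. apply (is_derive_mult (K := R_AbsRing) u v t x y Hu Hv).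
  intros; apply Rmult_comm.
Qed.

Lemma Cder_mult (f g : R -> C) (t : R) (a b : C) :
  Cder f t a -> Cder g t b -> Cder (fun x => f x * g x)%C t (a * g t + f t * b)%C.
Proof.
  intros [H1 H2] [H3 H4].
  split.
  - replace (Re (a * g t + f t * b))
      with ((Re a * Re (g t) + Re (f t) * Re b) - (Im a * Im (g t) + Im (f t) * Im b))
      by (unfold Re, Im; simpl; ring).
    apply (is_derive_minus (K := R_AbsRing) (V := R_NormedModule)
      (fun x => Re (f x) * Re (g x)) (fun x => Im (f x) * Im (g x)));
      now apply is_derive_mult_R.
  - replace (Im (a * g t + f t * b))
      with ((Re a * Im (g t) + Re (f t) * Im b) + (Im a * Re (g t) + Im (f t) * Re b))
      by (unfold Re, Im; simpl; ring).
    apply (is_derive_plus (K := R_AbsRing) (V := R_NormedModule)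
      (fun x => Re (f x) * Im (g x)) (fun x => Im (f x) * Re (g x)));
      now apply is_derive_mult_R.
Qed.

Lemma Cder_Cexp (f : R -> C) (t : R) (a : C) :
  Cder f t a -> Cder (fun x => Cexp (f x)) t (a * Cexp (f t))%C.
Proof.
  intros [H1 H2].
  assert (He : is_derive (fun x => exp (Re (f x))) t (Re a * exp (Re (f t))))
    by exact (is_derive_comp exp _ t _ _ (is_derive_exp (Re (f t))) H1).
  assert (Hc : is_derive (fun x => cos (Im (f x))) t (Im a * - sin (Im (f t))))
    by exact (is_derive_comp cos _ t _ _ (is_derive_cos (Im (f t))) H2).
  assert (Hs : is_derive (fun x => sin (Im (f x))) t (Im a * cos (Im (f t))))
    by exact (is_derive_comp sin _ t _ _ (is_derive_sin (Im (f t))) H2).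
  split.
  - pose proof (is_derive_mult_R _ _ _ _ _ He Hc) as H.
    match type of H with is_derive _ _ ?d => replace (Re (a * Cexp (f t))) with d end; [exact H|].
    unfold Re, Im, Cexp; simpl; unfold Re, Im; ring.
  - pose proof (is_derive_mult_R _ _ _ _ _ He Hs) as H.
    match type of H with is_derive _ _ ?d => replace (Im (a * Cexp (f t))) with d end; [exact H|].
    unfold Re, Im, Cexp; simpl; unfold Re, Im; ring.
Qed.

Lemma Cder_affine (f : R -> C) (x h u : R) (d : C) :
  Cder f (x + u * h) d -> Cder (fun v => f (x + v * h)) u (RtoC h * d)%C.
Proof.
  intros [H1 H2].
  assert (A : is_derive (fun v => x + v * h) u h) by (auto_derive; auto; ring).
  split.
  - pose proof (is_derive_comp (fun y => Re (f y)) _ u _ _ H1 A) as H.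
    replace (Re (h * d)) with (scal h (Re d)); [exact H|].
    unfold Re, scal; simpl; unfold mult; simpl; ring.
  - pose proof (is_derive_comp (fun y => Im (f y)) _ u _ _ H2 A) as H.
    replace (Im (h * d)) with (scal h (Im d)); [exact H|].
    unfold Im, scal; simpl; unfold mult; simpl; ring.
Qed.

Lemma im_le_Cmod (z : C) : Rabs (Im z) <= Cmod z.
Proof. eapply Rle_trans; [apply Rmax_r|apply Rmax_Cmod]. Qed.

Lemma Cmod_le_parts (z : C) : Cmod z <= Rabs (Re z) + Rabs (Im z).
Proof.
  replace z with (RtoC (Re z) + Ci * RtoC (Im z))%C at 1.
  2:{ destruct z as [x y]. unfold RtoC, Ci, Cplus, Cmult; simpl. f_equal; ring. }
  eapply Rle_trans; [apply Cmod_triangle|].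
  rewrite Cmod_mult, Cmod_Ci, !Cmod_R. lra.
Qed.

(** No single intermediate point serves both components, so the mean value theorem is applied to the
    real and imaginary parts separately; this costs the factor 2. *)
Lemma Cder_MVT_le (f f' : R -> C) (a b M : R) : a <= b ->
  (forall t, a <= t <= b -> Cder f t (f' t) /\ Cmod (f' t) <= M) ->
  Cmod (f b - f a)%C <= 2 * M * (b - a).
Proof.
  intros Hab H.
  assert (R1 : forall (p : C -> R), (forall z, Rabs (p z) <= Cmod z) ->
    (forall t, a <= t <= b -> is_derive (fun x => p (f x)) t (p (f' t))) ->
    Rabs (p (f b) - p (f a)) <= M * (b - a)).
  { intros p Hp Hd.
    destruct (MVT_gen (fun x => p (f x)) a b (fun x => p (f' x))) as [c [Hc E]];
      rewrite ?Rmin_left, ?Rmax_right by lra.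
    - intros t Ht. apply Hd. lra.
    - intros t Ht. apply derivable_continuous_pt. exists (p (f' t)).
      apply is_derive_Reals, Hd. lra.
    - rewrite Rmin_left, Rmax_right in Hc by lra. rewrite E, Rabs_mult, (Rabs_pos_eq (b - a)) by lra.
      apply Rmult_le_compat_r; [lra|].
      eapply Rle_trans; [apply Hp|]. now apply H. }
  eapply Rle_trans; [apply Cmod_le_parts|].
  pose proof (R1 Re re_le_Cmod (fun t Ht => proj1 (proj1 (H t Ht)))) as HRe.
  pose proof (R1 Im im_le_Cmod (fun t Ht => proj2 (proj1 (H t Ht)))) as HIm.
  change (Rabs (Re (f b) - Re (f a)) + Rabs (Im (f b) - Im (f a)) <= 2 * M * (b - a)). lra.
Qed.

(** Two uses of [Cder_MVT_le], on [f1] and then on [f] minus its tangent, each contributing a factor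
    2. *)
Lemma Cder_Taylor2 (f f1 f2 : R -> C) (x h M : R) :
  (forall y, Cder f y (f1 y)) -> (forall y, Cder f1 y (f2 y)) ->
  (forall y, Rabs (y - x) <= Rabs h -> Cmod (f2 y) <= M) ->
  Cmod (f (x + h)%R - f x - RtoC h * f1 x)%C <= 4 * M * h ^ 2.
Proof.
  intros H1 H2 HM.
  assert (HM0 : 0 <= M).
  { eapply Rle_trans; [apply Cmod_ge_0|apply (HM x)]. rewrite Rminus_diag, Rabs_R0. apply Rabs_pos. }
  pose proof (Rabs_pos h) as Hh.
  assert (A : forall u, 0 <= u <= 1 -> Cmod (f1 (x + u * h)%R - f1 x)%C <= 2 * (Rabs h * M)).
  { intros u Hu. replace (f1 x) with (f1 (x + 0 * h)%R) by (f_equal; ring).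
    eapply Rle_trans.
    - apply (Cder_MVT_le (fun v => f1 (x + v * h)%R) (fun v => (RtoC h * f2 (x + v * h)%R)%C) 0 u (Rabs h * M)); [lra|].
      intros t Ht. split; [apply Cder_affine, H2|].
      rewrite Cmod_mult, Cmod_R. apply Rmult_le_compat_l; auto. apply HM.
      replace (x + t * h - x) with (t * h) by ring. rewrite Rabs_mult, (Rabs_pos_eq t) by lra.
      rewrite <- (Rmult_1_l (Rabs h)) at 2. apply Rmult_le_compat_r; lra.
    - rewrite Rminus_0_r. assert (0 <= Rabs h * M) by nra. nra. }
  pose proof (Cder_MVT_le (fun v => f (x + v * h)%R + (- (h * f1 x)) * RtoC v)%C
    (fun v => h * f1 (x + v * h)%R + (- (h * f1 x)))%C 0 1 (Rabs h * (2 * (Rabs h * M))) ltac:(lra)) as B.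
  replace (f (x + h)%R - f x - h * f1 x)%C with
    (f (x + 1 * h)%R + - (h * f1 x) * 1 - (f (x + 0 * h)%R + - (h * f1 x) * 0))%C.
  2:{ replace (x + 1 * h)%R with (x + h)%R by ring. replace (x + 0 * h)%R with x by ring. ring. }
  eapply Rle_trans; [apply B|].
  - intros t Ht. split.
    + apply Cder_plus; [apply Cder_affine, H1|].
      eapply Cder_eq; [apply Cder_mult; [apply Cder_const|apply Cder_id]|]. cbv beta. ring.
    + replace (h * f1 (x + t * h)%R + - (h * f1 x))%C with (h * (f1 (x + t * h)%R - f1 x))%C by ring.
      rewrite Cmod_mult, Cmod_R. apply Rmult_le_compat_l; auto.
  - right. rewrite <- (pow2_abs h). ring.
Qed.

(** * Inversion of Gaussian sums *)

(** The quadratic coefficient is given through its root [s], so that inversion formulas carry the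
    factor s without any choice of branch. Decay in x amounts to Re(s^2) > 0. *)
Definition gauss (w s : C) (x : R) : C :=
  Cexp (RtoC (- PI) * ((w + s * RtoC x) * (w + s * RtoC x)))%C.

Definition glog (w s : C) (x : R) : C := (RtoC (- PI) * 2 * s * (w + s * RtoC x))%C.

(** A linear polynomial times the Gaussian, followed by its first and second derivatives; [glog] is
    the logarithmic derivative of [gauss]. The linear factor is there for the deformation of the
    line of integration. *)
Definition pg (al be w s : C) (x : R) : C := ((al + be * RtoC x) * gauss w s x)%C.
Definition pg1 (al be w s : C) (x : R) : C :=
  ((be + (al + be * RtoC x) * glog w s x) * gauss w s x)%C.
Definition pg2 (al be w s : C) (x : R) : C :=
  ((2 * be * glog w s x + (al + be * RtoC x) * (RtoC (- PI) * 2 * s * s)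
    + (al + be * RtoC x) * (glog w s x * glog w s x)) * gauss w s x)%C.

Lemma Cder_gauss (w s : R -> C) (x : R -> C) (w' s' x' : C) (t : R) :
  Cder w t w' -> Cder s t s' -> Cder x t x' ->
  Cder (fun t => Cexp (RtoC (- PI) * ((w t + s t * x t) * (w t + s t * x t))))%C t
    (RtoC (- PI) * 2 * (w t + s t * x t) * (w' + (s' * x t + s t * x'))
      * Cexp (RtoC (- PI) * ((w t + s t * x t) * (w t + s t * x t))))%C.
Proof.
  intros Hw Hs Hx.
  assert (HL : Cder (fun t => w t + s t * x t)%C t (w' + (s' * x t + s t * x'))%C).
  { apply Cder_plus; auto. now apply Cder_mult. }
  eapply Cder_eq.
  - apply Cder_Cexp. apply Cder_mult; [apply Cder_const|].
    apply (Cder_mult _ _ t _ _ HL HL).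
  - cbv beta. ring.
Qed.

Lemma Cder_gauss_x (w s : C) (x : R) : Cder (gauss w s) x (glog w s x * gauss w s x)%C.
Proof.
  eapply Cder_eq.
  - apply (Cder_gauss (fun _ => w) (fun _ => s) RtoC); [apply Cder_const|apply Cder_const|apply Cder_id].
  - unfold glog, gauss; cbv beta; ring.
Qed.

Lemma Cder_affine_poly (al be : C) (x : R) : Cder (fun x => al + be * RtoC x)%C x be.
Proof.
  eapply Cder_eq.
  - apply Cder_plus; [apply Cder_const|]. apply Cder_mult; [apply Cder_const|apply Cder_id].
  - cbv beta; ring.
Qed.

Lemma Cder_pg (al be w s : C) (x : R) : Cder (pg al be w s) x (pg1 al be w s x).
Proof.
  eapply Cder_eq.
  - apply Cder_mult; [apply Cder_affine_poly|apply Cder_gauss_x].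
  - unfold pg1; cbv beta; ring.
Qed.

Lemma Cder_glog (w s : C) (x : R) : Cder (glog w s) x (RtoC (- PI) * 2 * s * s)%C.
Proof.
  eapply Cder_eq.
  - apply Cder_mult; [apply Cder_const|apply Cder_affine_poly].
  - cbv beta; ring.
Qed.

Lemma Cder_pg1 (al be w s : C) (x : R) : Cder (pg1 al be w s) x (pg2 al be w s x).
Proof.
  eapply Cder_eq.
  - apply Cder_mult; [|apply Cder_gauss_x].
    apply Cder_plus; [apply Cder_const|].
    apply Cder_mult; [apply Cder_affine_poly|apply Cder_glog].
  - unfold pg2. ring.
Qed.

(** The exponent 5 is 3 + 2: the polynomial factor of [pg2] has degree 3, and two further powers are
    needed for [env]. *)
Lemma exp_neg_le_pow (y : R) : 0 < y -> exp (- y) <= 5 ^ 5 * / y ^ 5.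
Proof.
  intros Hy. rewrite exp_Ropp.
  replace (5 ^ 5 * / y ^ 5) with (/ (y / 5) ^ 5) by (field; lra).
  apply Rinv_le_contravar; [apply pow_lt; lra|].
  replace (exp y) with (exp (y / 5) ^ 5).
  - apply pow_incr. split; [lra|]. pose proof (exp_ineq1_le (y / 5)). lra.
  - simpl. rewrite Rmult_1_r, <- !exp_plus. f_equal. field.
Qed.

(** Completing the square in |x|. The constant depends only on [B] and [m], so it serves along a
    whole path of parameters. *)
Lemma gauss_bound (B m : R) : 0 <= B -> 0 < m -> exists G, 0 <= G /\
  forall w s x, Cmod w <= B -> Cmod s <= B -> m <= Re (s * s) ->
    Cmod (gauss w s x) <= G * / (1 + Rabs x) ^ 5.
Proof.
  intros HB Hm. pose proof PI_RGT_0 as HPI.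
  (* The exponent is at most -pi m X^2 + 2 pi B^2 X + pi B^2 with X = |x|, and it must stay below D
     - 1 - X. Thus [b] is the total coefficient of X, and b^2/(4 pi m) completes the square. *)
  set (b := 2 * PI * (B * B) + 1).
  set (D := PI * (B * B) + b ^ 2 / (4 * PI * m) + 1).
  exists (exp D * 5 ^ 5). split.
  { apply Rmult_le_pos; [left; apply exp_pos|apply pow_le; lra]. }
  intros w s x Hw Hs Hss.
  unfold gauss. rewrite Cmod_Cexp.
  set (y := 1 + Rabs x). pose proof (Rabs_pos x) as Hx.
  apply Rle_trans with (exp (D + - y)).
  2:{ rewrite exp_plus, Rmult_assoc. apply Rmult_le_compat_l; [left; apply exp_pos|].
      apply exp_neg_le_pow. unfold y; lra. }
  assert (E : Re (RtoC (- PI) * ((w + s * RtoC x) * (w + s * RtoC x))) <= D + - y).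
  2:{ destruct E as [E|E]; [left; now apply exp_increasing|right; now rewrite E]. }
  replace (Re (RtoC (- PI) * ((w + s * RtoC x) * (w + s * RtoC x)))) with
    (- PI * (Re (s * s) * x ^ 2 + 2 * Re (w * s) * x + Re (w * w)))
    by (unfold Re; simpl; ring).
  pose proof (re_le_Cmod (w * s)) as H1. rewrite Cmod_mult in H1.
  pose proof (re_le_Cmod (w * w)) as H2. rewrite Cmod_mult in H2.
  pose proof (Cmod_ge_0 w). pose proof (Cmod_ge_0 s).
  assert (H3 : Rabs (Re (w * s)) <= B * B) by (eapply Rle_trans; [exact H1|apply Rmult_le_compat; auto]).
  assert (H4 : Rabs (Re (w * w)) <= B * B) by (eapply Rle_trans; [exact H2|apply Rmult_le_compat; auto]).
  assert (H5 : - (B * B * Rabs x) <= Re (w * s) * x).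
  { pose proof (Rabs_maj2 (Re (w * s) * x)) as A. rewrite Rabs_mult in A.
    assert (Rabs (Re (w * s)) * Rabs x <= B * B * Rabs x) by (apply Rmult_le_compat_r; auto). lra. }
  pose proof (Rabs_maj2 (Re (w * w))) as H6.
  rewrite <- (pow2_abs x). set (X := Rabs x) in *.
  assert (H7 : m * X ^ 2 <= Re (s * s) * X ^ 2) by (apply Rmult_le_compat_r; [apply pow2_ge_0|auto]).
  assert (H8 : 0 <= PI * m * X ^ 2 - b * X + b ^ 2 / (4 * PI * m)).
  { replace (PI * m * X ^ 2 - b * X + b ^ 2 / (4 * PI * m))
      with (PI * m * (X - b / (2 * PI * m)) ^ 2) by (field; lra).
    apply Rmult_le_pos; [nra|apply pow2_ge_0]. }
  unfold D, y. fold X. unfold b in *.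
  assert (PI * (m * X ^ 2 - 2 * (B * B * X) - B * B)
    <= PI * (Re (s * s) * X ^ 2 + 2 * Re (w * s) * x + Re (w * w))).
  { apply Rmult_le_compat_l; lra. }
  lra.
Qed.

(** The three summands of [pg2] contribute 16, 8 and 64 (with pi <= 4), in all 88; the value 100
    leaves room for [pg] as well. *)
Lemma pg_bound (B m : R) : 1 <= B -> 0 < m -> exists K, 0 <= K /\
  forall al be w s x, Cmod al <= B -> Cmod be <= B -> Cmod w <= B -> Cmod s <= B ->
    m <= Re (s * s) ->
    Cmod (pg al be w s x) <= K * env x /\ Cmod (pg2 al be w s x) <= K * env x.
Proof.
  intros HB Hm. destruct (gauss_bound B m ltac:(lra) Hm) as [G [HG H]].
  exists (100 * B ^ 5 * G). pose proof PI_RGT_0 as HPI. pose proof PI_4 as HPI4.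
  assert (HB5 : 1 <= B ^ 5) by (apply pow_R1_Rle; lra).
  split. { apply Rmult_le_pos; lra. }
  intros al be w s x Ha Hb Hw Hs Hss. specialize (H w s x Hw Hs Hss).
  unfold pg, pg2, env. rewrite !Cmod_mult.
  pose proof (Rabs_pos x) as Hx. set (y := 1 + Rabs x) in *.
  assert (Hy : 1 <= y) by (unfold y; lra).
  assert (Lin : forall p q : C, Cmod p <= B -> Cmod q <= B -> Cmod (p + q * RtoC x)%C <= B * y).
  { intros p q Hp Hq. eapply Rle_trans; [apply Cmod_triangle|].
    rewrite Cmod_mult, Cmod_R. unfold y.
    assert (Cmod q * Rabs x <= B * Rabs x) by (apply Rmult_le_compat_r; auto). lra. }
  pose proof (Lin al be Ha Hb) as H1. pose proof (Lin w s Hw Hs) as H2.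
  pose proof (Cmod_ge_0 (al + be * RtoC x)) as P1. pose proof (Cmod_ge_0 (w + s * RtoC x)) as P2.
  pose proof (Cmod_ge_0 s) as Ps. pose proof (Cmod_ge_0 be) as Pb.
  assert (HL : Cmod (glog w s x) <= 8 * B ^ 2 * y).
  { unfold glog. rewrite !Cmod_mult, !Cmod_R, Rabs_Ropp, !Rabs_pos_eq by lra.
    apply Rle_trans with (4 * 2 * B * (B * y)); [|right; ring].
    apply Rmult_le_compat; auto; [apply Rmult_le_pos; lra|].
    apply Rmult_le_compat; auto; lra. }
  pose proof (Cmod_ge_0 (glog w s x)) as PL.
  assert (Hinv : forall c n, 0 <= c -> (n <= 3)%nat -> c <= 100 * B ^ 5 ->
     c * y ^ n * (G * / y ^ 5) <= 100 * B ^ 5 * G * / y ^ 2).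
  { intros c n Hc Hn Hc'.
    replace (100 * B ^ 5 * G * / y ^ 2) with (100 * B ^ 5 * y ^ 3 * (G * / y ^ 5)) by (field; lra).
    apply Rmult_le_compat_r.
    { apply Rmult_le_pos; auto. left. apply Rinv_0_lt_compat, pow_lt. lra. }
    apply Rmult_le_compat; auto; [apply pow_le; lra|]. apply Rle_pow; auto. }
  split.
  - apply Rle_trans with (B * y ^ 1 * (G * / y ^ 5)).
    + rewrite pow_1. apply Rmult_le_compat; auto. apply Cmod_ge_0.
    + apply Hinv; [lra|lia|]. assert (B ^ 1 <= B ^ 5) by (apply Rle_pow; [auto|lia]).
      rewrite pow_1 in H0. lra.
  - apply Rle_trans with (88 * B ^ 5 * y ^ 3 * (G * / y ^ 5)).
    2:{ apply Hinv; [lra|lia|lra]. }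
    apply Rmult_le_compat; auto; try apply Cmod_ge_0.
    eapply Rle_trans; [apply Cmod_triangle|].
    eapply Rle_trans; [apply Rplus_le_compat_r, Cmod_triangle|].
    rewrite !Cmod_mult, !Cmod_R, Rabs_Ropp, !Rabs_pos_eq by lra.
    set (L := Cmod (glog w s x)) in *. set (Q := Cmod (al + be * RtoC x)) in *.
    assert (B1 : 2 * Cmod be * L <= 16 * B ^ 5 * y ^ 3).
    { apply Rle_trans with (2 * B * (8 * B ^ 2 * y)).
      - apply Rmult_le_compat; auto; [lra|]. apply Rmult_le_compat; lra.
      - replace (2 * B * (8 * B ^ 2 * y)) with (16 * (B ^ 3 * y ^ 1)) by ring.
        rewrite Rmult_assoc. apply Rmult_le_compat_l; [lra|].
        apply Rmult_le_compat; try (apply pow_le; lra); apply Rle_pow; auto; lia. }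
    assert (B2 : Q * (PI * 2 * Cmod s * Cmod s) <= 8 * B ^ 5 * y ^ 3).
    { apply Rle_trans with (B * y * (4 * 2 * B * B)).
      - apply Rmult_le_compat; auto.
        + apply Rmult_le_pos; [apply Rmult_le_pos|]; lra.
        + apply Rmult_le_compat; auto; [apply Rmult_le_pos; lra|].
          apply Rmult_le_compat; auto; lra.
      - replace (B * y * (4 * 2 * B * B)) with (8 * (B ^ 3 * y ^ 1)) by ring.
        rewrite Rmult_assoc. apply Rmult_le_compat_l; [lra|].
        apply Rmult_le_compat; try (apply pow_le; lra); apply Rle_pow; auto; lia. }
    assert (B3 : Q * (L * L) <= 64 * B ^ 5 * y ^ 3).
    { apply Rle_trans with (B * y * ((8 * B ^ 2 * y) * (8 * B ^ 2 * y))); [|right; ring].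
      apply Rmult_le_compat; auto; [now apply Rmult_le_pos|]. apply Rmult_le_compat; auto. }
    lra.
Qed.


(** * Riemann sums of Gaussians along lines in the complex plane *)

Lemma env_div (N : nat) (n : Z) : (1 <= N)%nat ->
  env (IZR n / INR N) <= INR N ^ 2 * env (IZR n).
Proof.
  intros HN. assert (HN' : 1 <= INR N) by (apply (le_INR 1); auto).
  apply env_le. unfold Rdiv. rewrite Rabs_mult, (Rabs_pos_eq (/ INR N)).
  2:{ left; apply Rinv_0_lt_compat; lra. }
  rewrite Rmult_plus_distr_l. rewrite (Rmult_comm (Rabs _)), <- Rmult_assoc, Rinv_r by lra. lra.
Qed.

Lemma dom_sample (f : R -> C) (K : R) (N : nat) : (1 <= N)%nat ->
  (forall x, Cmod (f x) <= K * env x) -> dom (fun n => f (IZR n / INR N)).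
Proof.
  intros HN H. assert (0 <= K).
  { pose proof (H 0). pose proof (Cmod_ge_0 (f 0)). pose proof (env_pos 0). nra. }
  exists (K * INR N ^ 2). intros n. eapply Rle_trans; [apply H|].
  rewrite Rmult_assoc. apply Rmult_le_compat_l; auto. now apply env_div.
Qed.

Lemma rpart_sample_le (N K : nat) : (1 <= N)%nat ->
  rpart (fun n => / INR N * env (IZR n / INR N)) K <= 4.
Proof.
  intros HN. assert (HN' : 1 <= INR N) by (apply (le_INR 1); auto).
  eapply Rle_trans; [|apply (rpart_env_le (/ INR N) 0 K)].
  - apply rpart_le. intros n. rewrite Rplus_0_l. unfold Rdiv. rewrite (Rmult_comm (IZR n)). lra.
  - split; [left; apply Rinv_0_lt_compat; lra|]. rewrite <- Rinv_1. apply Rinv_le_contravar; lra.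
Qed.

Lemma gauss_pg (w s : C) (x : R) : gauss w s x = pg 1 0 w s x.
Proof. unfold pg. ring. Qed.

Lemma gauss_env (w s : C) : 0 < Re (s * s) -> exists K, 0 <= K /\ forall x,
  Cmod (gauss w s x) <= K * env x /\ Cmod (pg2 1 0 w s x) <= K * env x.
Proof.
  intros Hs. pose proof (Cmod_ge_0 w). pose proof (Cmod_ge_0 s).
  destruct (pg_bound (1 + Cmod w + Cmod s) (Re (s * s)) ltac:(lra) Hs) as [K [HK H']].
  exists K. split; auto. intros x. rewrite gauss_pg.
  apply H'; rewrite ?Cmod_1, ?Cmod_0; lra.
Qed.

(** Riemann sum of mesh 1/N for the integral of exp(-pi u^2) du along the line u = w + s x; the
    factor s is du/dx. *)
Definition riem (w s : C) (N : nat) : C :=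
  ZSeries (fun n => / RtoC (INR N) * (s * gauss w s (IZR n / INR N)%R))%C.

Lemma dom_riem (w s : C) (N : nat) : (1 <= N)%nat -> 0 < Re (s * s) ->
  dom (fun n => / RtoC (INR N) * (s * gauss w s (IZR n / INR N)%R))%C.
Proof.
  intros HN Hs. do 2 apply dom_scal. destruct (gauss_env w s Hs) as [K [HK H]].
  apply dom_sample with K; auto. apply H.
Qed.

Lemma Cder_part (f : R -> Z -> C) (f' : Z -> C) (K : nat) (t : R) :
  (forall n, Cder (fun u => f u n) t (f' n)) -> Cder (fun u => part (f u) K) t (part f' K).
Proof.
  intros H. induction K as [|K IH]; simpl; [apply Cder_const|].
  apply Cder_plus; auto. apply Cder_plus; apply H.
Qed.

Lemma Cinv_INR (N : nat) : (1 <= N)%nat -> (/ RtoC (INR N))%C = RtoC (/ INR N).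
Proof.
  intros HN. assert (1 <= INR N) by (apply (le_INR 1); auto). rewrite RtoC_inv; [reflexivity|lra].
Qed.

Lemma part_telescope (h : Z -> C) (K : nat) :
  part (fun n => h (n + 1)%Z - h n)%C K = (h (Z.of_nat K) - h (- Z.of_nat K)%Z)%C.
Proof.
  induction K as [|K IH]; [simpl; ring|]. cbn [part]. rewrite IH.
  replace (- Z.of_nat (S K) + 1)%Z with (- Z.of_nat K)%Z by lia.
  replace (Z.of_nat K + 1)%Z with (Z.of_nat (S K)) by lia. ring.
Qed.

(** Within distance 1 the envelope grows by at most the factor 4, and the Taylor constant is 4. *)
Lemma Cmod_Taylor_sample (f f1 f2 : R -> C) (x h K : R) : 0 <= K -> Rabs h <= 1 ->
  (forall y, Cder f y (f1 y)) -> (forall y, Cder f1 y (f2 y)) ->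
  (forall y, Cmod (f2 y) <= K * env y) ->
  Cmod (f (x + h)%R - f x - RtoC h * f1 x)%C <= 16 * K * env x * h ^ 2.
Proof.
  intros HK Hh H1 H2 H3.
  replace (16 * K * env x * h ^ 2) with (4 * (K * (4 * env x)) * h ^ 2) by ring.
  apply (Cder_Taylor2 f f1 f2); auto. intros y Hy. eapply Rle_trans; [apply H3|].
  apply Rmult_le_compat_l; auto.
  replace 4 with (2 ^ 2) by ring. apply env_le.
  replace x with (y - (y - x)) by ring.
  pose proof (Rabs_triang y (- (y - x))) as A. rewrite Rabs_Ropp in A.
  change (y - (y - x)) with (y + - (y - x)). pose proof (Rabs_pos y). lra.
Qed.

(* Rotating and translating the line of integration: along the path
   [s(t) = 1 + t (s - 1)], [w(t) = t w], the [t]-derivative of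
   [s(t) exp (- PI (w(t) + s(t) x)^2)] is the [x]-derivative of
   [(w + (s - 1) x) exp (- PI (w(t) + s(t) x)^2)], so its Riemann sums telescope
   up to an error of order [1/N]. *)
Lemma riem_diff (w s : C) : 0 < Re s -> 0 < Re (s * s) ->
  exists K, forall N, (1 <= N)%nat -> Cmod (riem w s N - riem 0 1 N)%C <= K / INR N.
Proof.
  intros Hs1 Hs2.
  set (m := Rmin 1 (Rmin (Re s) (Re (s * s)))).
  assert (Hm : 0 < m) by (unfold m; repeat apply Rmin_glb_lt; lra).
  assert (Hm1 : m <= 1) by apply Rmin_l.
  assert (Hm2 : m <= Re s) by (eapply Rle_trans; [apply Rmin_r|apply Rmin_l]).
  assert (Hm3 : m <= Re (s * s)) by (eapply Rle_trans; [apply Rmin_r|apply Rmin_r]).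
  set (st := fun t : R => (1 + (s - 1) * RtoC t)%C).
  set (wt := fun t : R => (0 + w * RtoC t)%C).
  (* Re(s(t)^2) is the average of 1, Re s and Re(s^2) with weights (1-t)^2, 2t(1-t) and t^2;
     positivity of Re s keeps the path inside the region of decay. *)
  assert (Hst : forall t, 0 <= t <= 1 -> m <= Re (st t * st t)).
  { intros t Ht. unfold st.
    replace (Re ((1 + (s - 1) * t) * (1 + (s - 1) * t))) with
      ((1 - t) ^ 2 + 2 * t * (1 - t) * Re s + t ^ 2 * Re (s * s)).
    2:{ unfold Re; destruct s; simpl; ring. }
    assert (t * (1 - t) * m <= t * (1 - t) * Re s) by (apply Rmult_le_compat_l; nra).
    assert (t ^ 2 * m <= t ^ 2 * Re (s * s)) by (apply Rmult_le_compat_l; nra).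
    assert ((1 - t) ^ 2 * m <= (1 - t) ^ 2 * 1) by (apply Rmult_le_compat_l; nra).
    assert (m = (1 - t) ^ 2 * m + 2 * (t * (1 - t) * m) + t ^ 2 * m) by ring. lra. }
  pose proof (Cmod_ge_0 w) as Pw. pose proof (Cmod_ge_0 s) as Ps.
  set (B := 2 + Cmod w + Cmod s).
  assert (Bs : Cmod (s - 1) <= 1 + Cmod s).
  { eapply Rle_trans; [apply Cmod_triangle|]. rewrite Cmod_opp, Cmod_1. lra. }
  assert (Bst : forall t, 0 <= t <= 1 -> Cmod (st t) <= B).
  { intros t Ht. unfold st, B. eapply Rle_trans; [apply Cmod_triangle|].
    rewrite Cmod_mult, Cmod_1, Cmod_R, Rabs_pos_eq by lra. pose proof (Cmod_ge_0 (s - 1)). nra. }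
  assert (Bwt : forall t, 0 <= t <= 1 -> Cmod (wt t) <= B).
  { intros t Ht. unfold wt, B. rewrite Cplus_0_l, Cmod_mult, Cmod_R, Rabs_pos_eq by lra. nra. }
  destruct (pg_bound B m ltac:(unfold B; lra) Hm) as [K [HK Hpg]].
  exists (128 * K). intros N HN.
  assert (HN' : 1 <= INR N) by (apply (le_INR 1); auto).
  assert (Hh : 0 < / INR N <= 1).
  { split; [apply Rinv_0_lt_compat; lra|]. rewrite <- Rinv_1. apply Rinv_le_contravar; lra. }
  set (h := / INR N) in *.
  set (F := fun (t : R) (n : Z) => (/ RtoC (INR N) * (st t * gauss (wt t) (st t) (IZR n / INR N)%R))%C).
  set (H := fun t => pg w (s - 1) (wt t) (st t)).
  set (F' := fun (t : R) (n : Z) => (/ RtoC (INR N) * pg1 w (s - 1) (wt t) (st t) (IZR n / INR N)%R)%C).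
  assert (HF : forall t n, Cder (fun u => F u n) t (F' t n)).
  { intros t n. unfold F, F'.
    assert (Dst : Cder st t (s - 1)) by (apply (Cder_affine_poly 1 (s - 1))).
    assert (Dwt : Cder wt t w) by (apply (Cder_affine_poly 0 w)).
    eapply Cder_eq.
    - apply Cder_mult; [apply Cder_const|]. apply Cder_mult; [exact Dst|].
      apply (Cder_gauss wt st (fun _ => RtoC (IZR n / INR N)%R)); [exact Dwt|exact Dst|apply Cder_const].
    - unfold pg1, gauss, glog. cbv beta. ring. }
  assert (Hbound : forall t P, 0 <= t <= 1 ->
     Cmod (part (F' t) P) <= 2 * K * env (INR P / INR N) + 64 * K / INR N).
  { intros t P Ht.
    assert (Hpgt := fun x => Hpg w (s - 1)%C (wt t) (st t) x ltac:(unfold B; lra) ltac:(unfold B; lra)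
       (Bwt t Ht) (Bst t Ht) (Hst t Ht)).
    set (g := fun n : Z => H t (IZR n / INR N)).
    rewrite (part_ext _ (fun n => (g (n + 1)%Z - g n) + (-(1)) * (g (n + 1)%Z - g n - F' t n))%C)
      by (intros; ring).
    rewrite part_plus, part_scal, part_telescope.
    eapply Rle_trans; [apply Cmod_triangle|]. rewrite Cmod_mult, Cmod_opp, Cmod_1, Rmult_1_l.
    apply Rplus_le_compat.
    - eapply Rle_trans; [apply Cmod_triangle|]. rewrite Cmod_opp. unfold g, H.
      pose proof (proj1 (Hpgt (IZR (Z.of_nat P) / INR N))) as E1.
      pose proof (proj1 (Hpgt (IZR (- Z.of_nat P) / INR N))) as E2.
      rewrite opp_IZR, Rdiv_opp_l, env_opp in E2. rewrite <- Rdiv_opp_l, <- opp_IZR in E2.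
      rewrite <- INR_IZR_INZ in *. rewrite opp_IZR, <- INR_IZR_INZ in *. lra.
    - eapply Rle_trans; [apply part_Cmod|].
      apply Rle_trans with (rpart (fun n => (16 * K * h) * (h * env (IZR n / INR N))) P).
      + apply rpart_le. intros n. unfold g, F', H. rewrite Cinv_INR by auto.
        replace (IZR (n + 1) / INR N) with (IZR n / INR N + h)
          by (rewrite plus_IZR; unfold h; field; lra).
        eapply Rle_trans.
        * apply (Cmod_Taylor_sample _ _ (pg2 w (s - 1) (wt t) (st t)) _ h K); auto.
          -- rewrite Rabs_pos_eq; lra.
          -- apply Cder_pg.
          -- apply Cder_pg1.
          -- intros y. apply Hpgt.
        * right; ring.
      + rewrite rpart_scal. pose proof (rpart_sample_le N P HN) as E. fold h in E.
        replace (64 * K / INR N) with (16 * K * h * 4) by (unfold h; field; lra).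
        apply Rmult_le_compat_l; auto. apply Rmult_le_pos; lra. }
  (* For fixed N the boundary terms of the telescoped sum vanish as the window grows, leaving only
     the Taylor error. *)
  apply (Clim_Cmod_le (fun P => part (F 1) P - part (F 0) P)%C _
    (fun P => 4 * K * INR N ^ 2 * env (INR P) + 128 * K / INR N)).
  - unfold riem. apply (Clim_ext (fun P => part (F 1) P + (-(1)) * part (F 0) P)%C).
    { intros; ring. }
    assert (E1 : riem w s N = ZSeries (F 1)).
    { apply ZSeries_ext. intros n. unfold F, st, wt.
      replace (1 + (s - 1) * 1)%C with s by ring. replace (0 + w * 1)%C with w by ring. reflexivity. }
    assert (E0 : riem 0 1 N = ZSeries (F 0)).
    { apply ZSeries_ext. intros n. unfold F, st, wt.
      replace (1 + (s - 1) * 0)%C with (RtoC 1) by ring.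
      replace (0 + w * 0)%C with (RtoC 0) by ring. reflexivity. }
    unfold riem in E1, E0. rewrite E1, E0.
    replace (ZSeries (F 1) - ZSeries (F 0))%C with (ZSeries (F 1) + (-(1)) * ZSeries (F 0))%C by ring.
    apply Clim_plus; [|apply Clim_scal]; apply ZSeries_lim; apply dom_riem; auto;
      eapply Rlt_le_trans; try exact Hm; apply Hst; lra.
  - intros P.
    pose proof (Cder_MVT_le (fun u => part (F u) P) (fun u => part (F' u) P) 0 1
      (2 * K * env (INR P / INR N) + 64 * K / INR N) ltac:(lra)) as E.
    eapply Rle_trans; [apply E|].
    + intros t Ht. split; [apply Cder_part; intros; apply HF|now apply Hbound].
    + pose proof (env_div N (Z.of_nat P) HN) as E'. rewrite <- INR_IZR_INZ in E'.
      assert (K * env (INR P / INR N) <= K * (INR N ^ 2 * env (INR P))) by (apply Rmult_le_compat_l; auto).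
      replace (64 * K / INR N) with (64 * (K / INR N)) by (unfold Rdiv; ring).
      replace (128 * K / INR N) with (128 * (K / INR N)) by (unfold Rdiv; ring). lra.
  - replace (Finite (128 * K / INR N)) with (Finite (0 + 128 * K / INR N)) by (f_equal; ring).
    apply is_lim_seq_plus'; [apply env_INR_lim|apply is_lim_seq_const].
Qed.

(** * Finite Fourier transform of the periodised Gaussian *)

Lemma sin_ge_third (x : R) : 0 <= x <= PI / 2 -> x / 3 <= sin x.
Proof.
  intros Hx. pose proof PI_4. pose proof PI_RGT_0.
  destruct (sin_bound x 0 ltac:(lra) ltac:(lra)) as [H1 _].
  unfold sin_approx, sum_f_R0, sin_term in H1. simpl in H1.
  eapply Rle_trans; [|exact H1].
  assert (x <= 2) by lra. assert (0 <= x * (4 - x * x)) by (apply Rmult_le_pos; nra). nra.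
Qed.

(** The expression is -4 sin(pi x)^2, the eigenvalue of the second difference on the character of
    frequency x. From sin(pi |x|) >= pi |x| / 3 >= 2|x|/3 one gets at least 16 x^2 / 9. *)
Lemma e_second_difference (x : R) : Rabs x <= 1 / 2 ->
  x ^ 2 <= Cmod (e (RtoC x) + e (RtoC (- x)) - 2)%C.
Proof.
  intros Hx. rewrite !e_R.
  replace (2 * PI * - x) with (- (2 * PI * x)) by ring. rewrite cos_neg, sin_neg.
  replace ((cos (2 * PI * x), sin (2 * PI * x)) + (cos (2 * PI * x), (- sin (2 * PI * x))%R) - 2)%C
    with (RtoC (- (4 * (sin (PI * x)) ^ 2))).
  2:{ replace (2 * PI * x) with (2 * (PI * x)) by ring. rewrite cos_2a_sin.
      unfold RtoC, Cminus, Cplus, Copp; simpl. f_equal; ring. }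
  rewrite Cmod_R, Rabs_Ropp, Rabs_pos_eq by nra.
  pose proof PI2_1 as H1. pose proof PI_RGT_0.
  assert (E : sin (PI * x) ^ 2 = sin (PI * Rabs x) ^ 2).
  { unfold Rabs. destruct (Rcase_abs x); [|reflexivity].
    replace (PI * - x) with (- (PI * x)) by ring. rewrite sin_neg. ring. }
  rewrite E, <- (pow2_abs x). pose proof (Rabs_pos x).
  pose proof (sin_ge_third (PI * Rabs x) ltac:(split; nra)) as H2.
  assert (H3 : 2 * Rabs x / 3 <= sin (PI * Rabs x)) by nra.
  assert ((2 * Rabs x / 3) ^ 2 <= sin (PI * Rabs x) ^ 2) by (apply pow_incr; lra). nra.
Qed.

Lemma ZSeries_support (f : Z -> C) (M : nat) :
  (forall m, (Z.of_nat M < Z.abs m)%Z -> f m = 0) ->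
  ZSeries f = csum (fun j => f (Z.of_nat j - Z.of_nat M)%Z) (2 * M + 1).
Proof.
  intros H.
  rewrite (csum_ext _ (fun j => ZSeries (single (Z.of_nat j - Z.of_nat M) (f (Z.of_nat j - Z.of_nat M)%Z))))
    by (intros; now rewrite ZSeries_single).
  rewrite <- (proj1 (ZSeries_csum _ _ (fun j => dom_single _ _))).
  apply ZSeries_ext. intros m.
  assert (E : forall p, csum (fun j => single (Z.of_nat j - Z.of_nat M) (f (Z.of_nat j - Z.of_nat M)%Z) m) p
    = if andb (- Z.of_nat M <=? m)%Z (m <? Z.of_nat p - Z.of_nat M)%Z then f m else 0).
  { induction p as [|p IH].
    - simpl. destruct (Z.leb_spec (- Z.of_nat M) m), (Z.ltb_spec m (- Z.of_nat M)); simpl; try reflexivity; lia.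
    - cbn [csum]. rewrite IH. unfold single.
      destruct (Z.leb_spec (- Z.of_nat M) m), (Z.ltb_spec m (Z.of_nat p - Z.of_nat M)),
        (Z.ltb_spec m (Z.of_nat (S p) - Z.of_nat M)), (Z.eqb_spec m (Z.of_nat p - Z.of_nat M));
        simpl; try lia; subst; ring. }
  rewrite E.
  destruct (Z.leb_spec (- Z.of_nat M) m), (Z.ltb_spec m (Z.of_nat (2 * M + 1) - Z.of_nat M)); simpl;
    try reflexivity; apply H; lia.
Qed.

Section Inversion.
Variables (s z : C).
Hypotheses (Hs1 : 0 < Re s) (Hs2 : 0 < Re (s * s)).

Let s_neq_0 : s <> 0.
Proof. intros E. rewrite E in Hs1. simpl in Hs1. lra. Qed.

(** Fourier coefficient on (1/N)Z/Z of the 1-periodic function x -> sum over n of s exp(-pi s^2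
    (z+x+n)^2); the sums over residues and over n are merged into one over Z. *)
Definition fourier (N : nat) (m : Z) : C :=
  (s * (/ RtoC (INR N) * ZSeries (fun n => gauss (s * z) s (IZR n / INR N)%R
     * e (RtoC (- (IZR m * IZR n / INR N)))))%C)%C.

Definition dual (m : Z) : C :=
  (e (RtoC (IZR m) * z) * Cexp (RtoC (- PI) * (RtoC (IZR m) * RtoC (IZR m)) / (s * s)))%C.

Lemma dom_modulated (u : Z -> C) (r : Z -> R) : dom u -> dom (fun n => u n * e (RtoC (r n)))%C.
Proof.
  intros H. apply dom_le with u 1; auto; [lra|]. intros n. rewrite Cmod_mult, Cmod_e_R. lra.
Qed.

Lemma dom_gauss_sample (N : nat) : (1 <= N)%nat ->
  dom (fun n => gauss (s * z) s (IZR n / INR N)).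
Proof.
  intros HN. destruct (gauss_env (s * z) s Hs2) as [K [HK H]].
  apply dom_sample with K; auto. apply H.
Qed.

(** Completing the square absorbs the character e(-m x) into the Gaussian and moves the line of
    integration by i m / s. *)
Lemma fourier_dual (N : nat) (m : Z) : (1 <= N)%nat ->
  fourier N m = (dual m * riem (s * z + Ci * RtoC (IZR m) / s) s N)%C.
Proof.
  intros HN. unfold fourier, riem.
  rewrite <- ZSeries_scal by (apply dom_modulated, dom_gauss_sample; auto).
  rewrite <- ZSeries_scal by (apply dom_scal, dom_modulated, dom_gauss_sample; auto).
  rewrite <- ZSeries_scal by (apply dom_riem; auto).
  apply ZSeries_ext. intros n. set (x := IZR n / INR N).
  replace (IZR m * IZR n / INR N) with (IZR m * x) by (unfold x; unfold Rdiv; ring).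
  unfold dual, gauss.
  transitivity (/ RtoC (INR N) * s * (Cexp (RtoC (- PI) * ((s * z + s * x) * (s * z + s * x))) *
     e (RtoC (- (IZR m * x)))))%C; [ring|].
  transitivity (/ RtoC (INR N) * s * (e (RtoC (IZR m) * z) * Cexp (RtoC (- PI) * (RtoC (IZR m) * RtoC (IZR m)) / (s * s))
     * Cexp (RtoC (- PI) * ((s * z + Ci * RtoC (IZR m) / s + s * x) * (s * z + Ci * RtoC (IZR m) / s + s * x)))))%C; [|ring].
  f_equal. unfold e. rewrite <- !Cexp_add. f_equal.
  rewrite !RtoC_opp, !RtoC_mult.
  set (mm := RtoC (IZR m)). set (X := RtoC x). set (P := RtoC PI).
  replace ((s * z + Ci * mm / s + s * X) * (s * z + Ci * mm / s + s * X))%C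
    with ((s * z + s * X) * (s * z + s * X) + 2 * Ci * mm * (z + X) + (Ci * Ci) * mm * mm / (s * s))%C
    by (field; auto).
  rewrite Ci_Ci. field. auto.
Qed.

(** Up to a constant, [dual] is again a Gaussian, with 1/s in place of s, and Re(1/s^2) > 0. *)
Lemma dom_dual : dom dual.
Proof.
  assert (Hinv : 0 < Re (/ s * / s)).
  { replace (/ s * / s)%C with (/ (s * s))%C by (field; auto).
    assert (E : (s * s)%C <> 0) by now apply Cmult_neq_0.
    destruct (s * s)%C as [x y]. unfold Cinv, Re in *; simpl in *.
    apply Rdiv_lt_0_compat; auto. nra. }
  destruct (gauss_env (- (Ci * z * s)) (/ s) Hinv) as [K [HK H]].
  apply dom_ext with (fun m => Cexp (RtoC (- PI) * (z * z * (s * s))) *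
     gauss (- (Ci * z * s)) (/ s) (IZR m / INR 1)%R)%C.
  - intros m. unfold dual, gauss, e. rewrite <- !Cexp_add. f_equal.
    replace (IZR m / INR 1) with (IZR m) by (simpl; field).
      rewrite RtoC_opp, RtoC_mult. set (mm := RtoC (IZR m)). set (P := RtoC PI).
    replace ((- (Ci * z * s) + / s * mm) * (- (Ci * z * s) + / s * mm))%C with
      ((Ci * Ci) * z * z * s * s + (- (2)) * Ci * z * mm + mm * mm / (s * s))%C by (field; auto).
    rewrite Ci_Ci. field. auto.
  - apply dom_scal, dom_sample with K; [lia|]. apply H.
Qed.

(** Domination uniform in N, as [Tannery] requires. Two discrete summations by parts multiply the
    coefficient by e(m/N) + e(-m/N) - 2, of size at least (m/N)^2 because |m/N| <= 1/2, while second
    differences of the samples are of order 1/N^2. *)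
Lemma fourier_bound : exists K, 0 <= K /\ forall (M : nat) (m : Z), (Z.abs m <= Z.of_nat M)%Z ->
  Cmod (fourier (2 * M + 1) m) <= K * env (IZR m).
Proof.
  destruct (gauss_env (s * z) s Hs2) as [K [HK H]].
  exists (Cmod s * (512 * K)). pose proof (Cmod_ge_0 s) as Ps.
  split; [apply Rmult_le_pos; lra|].
  intros M m Hm. set (N := (2 * M + 1)%nat).
  assert (HN : (1 <= N)%nat) by (unfold N; lia).
  assert (HN' : 1 <= INR N) by (apply (le_INR 1); auto).
  assert (Hh : 0 < / INR N <= 1).
  { split; [apply Rinv_0_lt_compat; lra|]. rewrite <- Rinv_1. apply Rinv_le_contravar; lra. }
  unfold fourier. rewrite Cmod_mult, Rmult_assoc. apply Rmult_le_compat_l; auto.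
  rewrite Cmod_mult, Cinv_INR, Cmod_R, Rabs_pos_eq by (auto; lra).
  set (h := / INR N) in *.
  set (G := fun n : Z => gauss (s * z) s (IZR n / INR N)).
  set (lam := fun n : Z => e (RtoC (- (IZR m * IZR n / INR N)))).
  set (E := ZSeries (fun n => G n * lam n)%C).
  change (h * Cmod E <= 512 * K * env (IZR m)).
  assert (dG : dom G) by now apply dom_gauss_sample.
  assert (Hsum : forall P, rpart (fun n => h * env (IZR n / INR N)) P <= 4)
    by (intros; now apply rpart_sample_le).
  (* For m = 0 the multiplier vanishes, so the sum is bounded directly. *)
  destruct (Z.eq_dec m 0) as [->|Hm0].
  - assert (Hr : Cmod E <= K * INR N * 4).
    { apply ZSeries_Cmod_le; [now apply dom_modulated|]. intros P.
      apply Rle_trans with (rpart (fun n => (K * INR N) * (h * env (IZR n / INR N))) P).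
      - apply rpart_le. intros n. rewrite Cmod_mult. unfold lam. rewrite Cmod_e_R, Rmult_1_r.
        eapply Rle_trans; [apply (proj1 (H _))|]. right. unfold h. field. lra.
      - rewrite rpart_scal. apply Rmult_le_compat_l; [nra|apply Hsum]. }
    replace (env 0) with 1 by (unfold env; rewrite Rabs_R0; field).
    apply Rle_trans with (h * (K * INR N * 4)); [apply Rmult_le_compat_l; lra|].
    replace (h * (K * INR N * 4)) with (4 * K) by (unfold h; field; lra). lra.
  - assert (Hx : Rabs (IZR m / INR N) <= 1 / 2).
    { unfold Rdiv. rewrite Rabs_mult, (Rabs_pos_eq (/ INR N)) by (fold h; lra).
      apply Rmult_le_reg_r with (INR N); [lra|]. rewrite Rmult_assoc, Rinv_l by lra.
      assert (Rabs (IZR m) <= INR M) by (rewrite <- abs_IZR, INR_IZR_INZ; now apply IZR_le).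
      unfold N. rewrite plus_INR, mult_INR. simpl. lra. }
    pose proof (e_second_difference (IZR m / INR N) Hx) as Hlow.
    set (D := (e (RtoC (IZR m / INR N)) + e (RtoC (- (IZR m / INR N))) - 2)%C) in *.
    (* The first-order terms h and -h cancel, so the second difference is written as a sum of two
       Taylor remainders. *)
    assert (Eq : (D * E)%C = ZSeries (fun n => (G (n + 1)%Z - G n - (h * pg1 1 0 (s * z) s (IZR n / INR N)%R)
         + (G (n + (- 1))%Z - G n - (RtoC (- h)) * pg1 1 0 (s * z) s (IZR n / INR N)%R)) * lam n)%C).
    { rewrite (ZSeries_ext _ (fun n => e (RtoC (IZR m / INR N)) * (G (n + 1)%Z * lam (n + 1)%Z)
          + (e (RtoC (- (IZR m / INR N))) * (G (n + (-1))%Z * lam (n + (-1))%Z)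
          + (- (2)) * (G n * lam n)))%C).
      - assert (dGl : dom (fun n => G n * lam n)%C) by now apply dom_modulated.
        pose proof (dom_shift _ 1 dGl) as d1. pose proof (dom_shift _ (-1) dGl) as d2. cbv beta in d1, d2.
        rewrite ZSeries_plus, ZSeries_plus, !ZSeries_scal; auto; try (apply dom_scal; auto; fail).
        + pose proof (ZSeries_shift _ 1 dGl) as s1. pose proof (ZSeries_shift _ (-1) dGl) as s2.
          cbv beta in s1, s2. rewrite s1, s2. fold E. unfold D. ring.
        + apply dom_plus; apply dom_scal; auto.
      - intros n.
        assert (l1 : (e (RtoC (IZR m / INR N)) * lam (n + 1)%Z)%C = lam n).
        { unfold lam. rewrite <- e_add, <- RtoC_plus. do 2 f_equal. rewrite plus_IZR. field. lra. }
        assert (l2 : (e (RtoC (- (IZR m / INR N))) * lam (n + -1)%Z)%C = lam n).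
        { unfold lam. rewrite <- e_add, <- RtoC_plus. do 2 f_equal. rewrite plus_IZR. field. lra. }
        replace (e (RtoC (IZR m / INR N)) * (G (n + 1)%Z * lam (n + 1)%Z))%C with
          (G (n + 1)%Z * lam n)%C by (rewrite <- l1; ring).
        replace (e (RtoC (- (IZR m / INR N))) * (G (n + (-1))%Z * lam (n + (-1))%Z))%C with
          (G (n + -1)%Z * lam n)%C by (rewrite <- l2; ring).
        rewrite RtoC_opp. ring. }
    assert (Hr : Cmod (D * E) <= 32 * K * h * 4).
    { rewrite Eq. apply ZSeries_Cmod_le.
      - apply dom_modulated.
        apply dom_ext with (fun n => G (n + 1)%Z + (G (n + -1)%Z + (- (2)) * G n))%C.
        { intros n. rewrite RtoC_opp. ring. }
        apply dom_plus; [now apply dom_shift|]. apply dom_plus; [now apply dom_shift|now apply dom_scal].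
      - intros P.
        apply Rle_trans with (rpart (fun n => (32 * K * h) * (h * env (IZR n / INR N))) P).
        + apply rpart_le. intros n. rewrite Cmod_mult. unfold lam. rewrite Cmod_e_R, Rmult_1_r.
          eapply Rle_trans; [apply Cmod_triangle|].
          assert (T : forall h', Rabs h' = h -> forall n', IZR n' / INR N = IZR n / INR N + h' ->
            Cmod (G n' - G n - RtoC h' * pg1 1 0 (s * z) s (IZR n / INR N)%R)%C
              <= 16 * K * env (IZR n / INR N) * h ^ 2).
          { intros h' Hh' n' Hn'. unfold G. rewrite Hn', !gauss_pg.
            eapply Rle_trans.
            - apply (Cmod_Taylor_sample _ _ (pg2 1 0 (s * z) s) _ h' K); auto.
              + lra. + apply Cder_pg. + apply Cder_pg1. + intros y. apply H.
            - right. rewrite <- (pow2_abs h'), Hh'. ring. }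
          pose proof (T h ltac:(apply Rabs_pos_eq; lra) (n + 1)%Z
            ltac:(rewrite plus_IZR; unfold h; field; lra)) as T1.
          pose proof (T (- h) ltac:(rewrite Rabs_Ropp; apply Rabs_pos_eq; lra) (n + -1)%Z
            ltac:(rewrite plus_IZR; unfold h; field; lra)) as T2.
          lra.
        + rewrite rpart_scal. apply Rmult_le_compat_l; [|apply Hsum]. apply Rmult_le_pos; lra. }
    rewrite Cmod_mult in Hr. pose proof (Cmod_ge_0 E) as PE.
    assert (Hr2 : (IZR m / INR N) ^ 2 * Cmod E <= 128 * K * h).
    { apply Rle_trans with (Cmod D * Cmod E); [apply Rmult_le_compat_r; auto|lra]. }
    assert (Habs : 1 <= Rabs (IZR m)) by (rewrite <- abs_IZR; apply IZR_le; lia).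
    unfold env. set (a := Rabs (IZR m)) in *.
    assert (Ha2 : IZR m ^ 2 = a ^ 2) by (unfold a; now rewrite pow2_abs).
    apply Rmult_le_reg_r with ((1 + a) ^ 2); [apply pow_lt; lra|].
    rewrite (Rmult_assoc (512 * K)), Rinv_l, Rmult_1_r by (apply pow_nonzero; lra).
    assert (Hr3 : a ^ 2 * (h * Cmod E) <= 128 * K).
    { rewrite <- Ha2. apply Rmult_le_reg_r with h; [lra|].
      replace (IZR m ^ 2 * (h * Cmod E) * h) with ((IZR m / INR N) ^ 2 * Cmod E) by (unfold h; field; lra). exact Hr2. }
    assert (0 <= h * Cmod E) by (apply Rmult_le_pos; lra).
    assert ((1 + a) ^ 2 <= 4 * a ^ 2) by nra. nra.
Qed.

(** Finite Fourier inversion at the origin. The indices |m| <= M form a complete residue system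
    modulo N = 2M+1, so orthogonality keeps only the sample points n/N that are integers. *)
Lemma fourier_sum (M : nat) :
  ZSeries (fun m => if (Z.abs m <=? Z.of_nat M)%Z then fourier (2 * M + 1) m else 0)
  = (s * ZSeries (fun n => gauss (s * z) s (IZR n)))%C.
Proof.
  set (N := (2 * M + 1)%nat). assert (HN : (1 <= N)%nat) by (unfold N; lia).
  assert (HN' : 1 <= INR N) by (apply (le_INR 1); auto).
  assert (HNC : RtoC (INR N) <> 0) by (intros E; apply RtoC_inj in E; lra).
  rewrite (ZSeries_support _ M).
  2:{ intros m Hm. destruct (Z.leb_spec (Z.abs m) (Z.of_nat M)); [lia|reflexivity]. }
  fold N.
  set (G := fun n : Z => gauss (s * z) s (IZR n / INR N)).
  assert (dG : dom G) by now apply dom_gauss_sample.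
  set (f := fun (j : nat) (n : Z) => (G n * e (RtoC (- (IZR (Z.of_nat j - Z.of_nat M) * IZR n / INR N))))%C).
  rewrite (csum_ext _ (fun j => (s * / RtoC (INR N)) * ZSeries (f j))%C).
  2:{ intros j Hj. destruct (Z.leb_spec (Z.abs (Z.of_nat j - Z.of_nat M)) (Z.of_nat M)); [|unfold N in Hj; lia].
      unfold fourier. fold N. unfold f, G. ring. }
  rewrite csum_scal, <- (proj1 (ZSeries_csum f N (fun j => dom_modulated _ _ dG))).
  rewrite (ZSeries_ext _ (fun n => RtoC (INR N) * (if ((n - 0) mod Z.of_nat N =? 0)%Z then G n else 0))%C).
  - rewrite ZSeries_scal, ZSeries_residue; auto; try lia.
    + rewrite (ZSeries_ext _ (fun n => gauss (s * z) s (IZR n))); [field; auto|].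
      intros l. unfold G. f_equal. rewrite Z.add_0_l, mult_IZR, <- INR_IZR_INZ. field. lra.
    + apply dom_le with G 1; auto; [lra|]. intros n. rewrite Rmult_1_l.
      destruct (_ =? _)%Z; [lra|]. rewrite Cmod_0. apply Cmod_ge_0.
  - intros n. rewrite Z.sub_0_r. unfold f.
    rewrite (csum_ext _ (fun j => (G n * e (RtoC (INR M * IZR n / INR N))) *
       e (RtoC (IZR (- n) * INR j / INR N)))%C).
    + rewrite csum_scal, csum_roots by lia.
      destruct (Z.eqb_spec (n mod Z.of_nat N) 0) as [E|E].
      * apply Z.mod_divide in E; [|lia]. destruct E as [q Hq].
        replace ((- n) mod Z.of_nat N)%Z with 0%Z.
        2:{ rewrite Hq, <- Z.mul_opp_l. symmetry. apply Z.mod_mul. lia. }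
        simpl. replace (INR M * IZR n / INR N) with (IZR (Z.of_nat M * q)).
        -- rewrite e_Z. ring.
        -- rewrite Hq, !mult_IZR, <- !INR_IZR_INZ. field. lra.
      * destruct (Z.eqb_spec ((- n) mod Z.of_nat N) 0) as [E'|]; [|ring].
        exfalso. apply E. apply Z.mod_divide in E'; [|lia]. apply Z.mod_divide; [lia|].
        rewrite <- (Z.opp_involutive n). now apply Z.divide_opp_r.
    + intros j _.
      replace (- (IZR (Z.of_nat j - Z.of_nat M) * IZR n / INR N)) with
        (INR M * IZR n / INR N + IZR (- n) * INR j / INR N)
        by (rewrite minus_IZR, opp_IZR, <- !INR_IZR_INZ; field; lra).
      rewrite RtoC_plus, e_add. ring.
Qed.

Lemma riem_1_bounded : exists K, 0 <= K /\ forall N, (1 <= N)%nat -> Cmod (riem 0 1 N) <= K.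
Proof.
  destruct (gauss_env 0 1) as [K [HK H]]; [simpl; lra|].
  exists (K * 4). split; [lra|]. intros N HN.
  assert (HN' : 1 <= INR N) by (apply (le_INR 1); auto).
  assert (0 < / INR N) by (apply Rinv_0_lt_compat; lra).
  apply ZSeries_Cmod_le; [apply dom_riem; auto; simpl; lra|].
  intros P. apply Rle_trans with (rpart (fun n => K * (/ INR N * env (IZR n / INR N))) P).
  - apply rpart_le. intros n. rewrite !Cmod_mult, Cmod_1, Cinv_INR, Cmod_R, Rabs_pos_eq, Rmult_1_l by (auto; lra).
    pose proof (proj1 (H (IZR n / INR N))).
    replace (K * (/ INR N * env (IZR n / INR N))) with (/ INR N * (K * env (IZR n / INR N))) by ring.
    apply Rmult_le_compat_l; lra.
  - rewrite rpart_scal. apply Rmult_le_compat_l; auto. now apply rpart_sample_le.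
Qed.

(** Termwise, [fourier_dual] and [riem_diff] bring the coefficient close to [dual] times [riem 0 1],
    and [Tannery] sums this. The factor [riem 0 1] stays inside the limit because at this stage it
    is only known to be bounded. *)
Lemma inversion_up_to_constant :
  Clim (fun M => s * ZSeries (fun n => gauss (s * z) s (IZR n))
     + (-(1)) * (riem 0 1 (2 * M + 1) * ZSeries dual))%C 0.
Proof.
  destruct fourier_bound as [K [HK HF]]. destruct riem_1_bounded as [R [HR Hr]].
  pose proof dom_dual as dd. assert (dd' := dd). destruct dd' as [B HB].
  pose proof (domB_pos B dual HB) as HB0.
  set (f := fun M m => ((if (Z.abs m <=? Z.of_nat M)%Z then fourier (2 * M + 1) m else 0)
     + (-(1)) * (riem 0 1 (2 * M + 1) * dual m))%C).
  assert (df : forall M, domB K (fun m => if (Z.abs m <=? Z.of_nat M)%Z then fourier (2 * M + 1) m else 0)).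
  { intros M m. destruct (Z.leb_spec (Z.abs m) (Z.of_nat M)); [now apply HF|].
    rewrite Cmod_0. pose proof (env_pos (IZR m)). nra. }
  apply Clim_ext with (fun M => ZSeries (f M)).
  { intros M. unfold f. rewrite ZSeries_plus, fourier_sum.
    - rewrite (ZSeries_scal (-(1)) (fun m => riem 0 1 (2 * M + 1) * dual m)%C) by now apply dom_scal.
      rewrite ZSeries_scal; auto.
    - now exists K.
    - now do 2 apply dom_scal. }
  rewrite <- ZSeries_0. apply Tannery with (K + R * B).
  - intros M m. unfold f. eapply Rle_trans; [apply Cmod_triangle|].
    rewrite !Cmod_mult, Cmod_opp, Cmod_1, Rmult_1_l, Rmult_plus_distr_r.
    apply Rplus_le_compat; [apply df|].
    rewrite Rmult_assoc. apply Rmult_le_compat; try apply Cmod_ge_0; [apply Hr; lia|apply HB].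
  - intros m.
    destruct (riem_diff (s * z + Ci * RtoC (IZR m) / s) s Hs1 Hs2) as [D HD].
    apply is_lim_seq_incr_n with (N := Z.abs_nat m).
    apply (Clim_squeeze (fun M => f (M + Z.abs_nat m)%nat m) 0 (fun M => (Cmod (dual m) * Rabs D) / (1 + INR M))).
    2:{ apply is_lim_seq_inv_INR. }
    intros M. set (M' := (M + Z.abs_nat m)%nat). unfold f.
    destruct (Z.leb_spec (Z.abs m) (Z.of_nat M')); [|unfold M' in *; lia].
    rewrite fourier_dual by lia.
    replace (dual m * riem (s * z + Ci * IZR m / s) s (2 * M' + 1) +
      - (1) * (riem 0 1 (2 * M' + 1) * dual m) - 0)%C with
      (dual m * (riem (s * z + Ci * IZR m / s) s (2 * M' + 1) - riem 0 1 (2 * M' + 1)))%C by ring.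
    rewrite Cmod_mult. unfold Rdiv. rewrite Rmult_assoc.
    apply Rmult_le_compat_l; [apply Cmod_ge_0|].
    eapply Rle_trans; [apply HD; lia|]. pose proof (pos_INR M).
    assert (HM : 1 + INR M <= INR (2 * M' + 1)).
    { rewrite Rplus_comm, <- S_INR. apply le_INR. unfold M'. lia. }
    apply Rle_trans with (Rabs D * / INR (2 * M' + 1)).
    + apply Rmult_le_compat_r; [left; apply Rinv_0_lt_compat; lra|apply Rle_abs].
    + apply Rmult_le_compat_l; [apply Rabs_pos|]. apply Rinv_le_contravar; lra.
Qed.

End Inversion.

(** All terms are positive and the term n = 0 is 1; this permits the division that determines the
    remaining constant. *)
Lemma ZSeries_gauss_pos : ZSeries (fun n => gauss 0 1 (IZR n)) <> 0.
Proof.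
  intros E.
  assert (d : dom (fun n => gauss 0 1 (IZR n))).
  { destruct (gauss_env 0 1) as [K [HK H]]; [simpl; lra|]. exists K. intros n. apply H. }
  pose proof (ZSeries_lim _ d) as L. rewrite E in L.
  assert (Hg : forall x, gauss 0 1 x = RtoC (exp (- PI * x ^ 2))).
  { intros x. unfold gauss, Cexp, RtoC. simpl.
    match goal with |- (exp ?u * cos ?v, _) = _ => replace v with 0 by ring; replace u with (- PI * (x * (x * 1))) by ring end.
    rewrite cos_0, sin_0. f_equal; ring. }
  assert (P : forall K, 1 <= Re (part (fun n => gauss 0 1 (IZR n)) (S K))).
  { induction K as [|K IH].
    - simpl part. rewrite !Hg. simpl. replace (- PI * (0 * (0 * 1))) with 0 by ring. rewrite exp_0.
      pose proof (exp_pos (- PI * (-1 * (-1 * 1)))). lra.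
    - change (part (fun n => gauss 0 1 (IZR n)) (S (S K))) with
        (part (fun n => gauss 0 1 (IZR n)) (S K) +
         (gauss 0 1 (IZR (Z.of_nat (S K))) + gauss 0 1 (IZR (- Z.of_nat (S (S K))))))%C.
      rewrite !Hg.
      pose proof (exp_pos (- PI * IZR (Z.of_nat (S K)) ^ 2)).
      pose proof (exp_pos (- PI * IZR (- Z.of_nat (S (S K))) ^ 2)).
      unfold Re in *. cbn [fst Cplus RtoC] in *. lra. }
  apply Clim_incr_1 in L.
  assert (H : 1 <= 0).
  { refine (is_lim_seq_le (fun _ => 1) _ 1 0 _ (is_lim_seq_const _) L).
    intros n. eapply Rle_trans; [apply P|]. eapply Rle_trans; [|apply re_le_Cmod].
    replace (part (fun n0 => gauss 0 1 (IZR n0)) (S n) - 0)%C with (part (fun n0 => gauss 0 1 (IZR n0)) (S n)) by ring.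
    apply Rle_abs. }
  lra.
Qed.

Lemma riem_1_lim : Clim (fun M => riem 0 1 (2 * M + 1)) 1.
Proof.
  pose proof (inversion_up_to_constant 1 0 ltac:(simpl; lra) ltac:(simpl; lra)) as H.
  set (T := ZSeries (fun n => gauss 0 1 (IZR n))).
  assert (E1 : ZSeries (fun n => gauss (1 * 0) 1 (IZR n)) = T).
  { apply ZSeries_ext. intros n. f_equal. ring. }
  assert (E2 : ZSeries (dual 1 0) = T).
  { apply ZSeries_ext. intros n. unfold dual, gauss, e. rewrite <- Cexp_add. f_equal. field. }
  rewrite E1, E2 in H.
  pose proof ZSeries_gauss_pos as HT. fold T in HT.
  apply (Clim_scal (- / T)) in H.
  pose proof (Clim_plus _ _ _ _ (Clim_const 1) H) as H'.
  replace (1 + - / T * 0)%C with (RtoC 1) in H' by ring.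
  refine (Clim_ext _ _ _ _ H'). intros n. cbv beta. field. exact HT.
Qed.

(** Jacobi's inversion: sum of s exp(-pi s^2 (z+n)^2) = sum of e(m z) exp(-pi m^2 / s^2). The
    condition Re s > 0 selects the right root of s^2. *)
Lemma theta_inversion (s z : C) : 0 < Re s -> 0 < Re (s * s) ->
  (s * ZSeries (fun n => gauss (s * z) s (IZR n)))%C = ZSeries (dual s z).
Proof.
  intros H1 H2.
  pose proof (inversion_up_to_constant s z H1 H2) as H.
  set (A := (s * ZSeries (fun n => gauss (s * z) s (IZR n)))%C) in *. set (D := ZSeries (dual s z)) in *.
  assert (L : Clim (fun M => A + (-(1)) * (riem 0 1 (2 * M + 1) * D))%C (A + (-(1)) * (D * 1))%C).
  { apply Clim_plus; [apply Clim_const|]. apply Clim_scal.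
    apply Clim_ext with (fun M => D * riem 0 1 (2 * M + 1))%C; [intros; ring|].
    apply Clim_scal, riem_1_lim. }
  pose proof (Clim_unique _ _ _ H L) as E.
  replace A with (D + (A + (-(1)) * (D * 1)))%C by ring. rewrite <- E. ring.
Qed.


Lemma Cexp_period (a b : C) (n : Z) :
  (a + 2 * RtoC PI * Ci * RtoC (IZR n))%C = b -> Cexp a = Cexp b.
Proof.
  intros <-. rewrite Cexp_add.
  replace (Cexp (2 * RtoC PI * Ci * RtoC (IZR n))) with (e (RtoC (IZR n)))
    by (unfold e; now rewrite RtoC_mult).
  rewrite e_Z. ring.
Qed.

(** * The eta function *)

Section Pentagonal.
Variable q : C.

Fixpoint tri (s : nat) : nat := match s with O => O | S p => (tri p + S p)%nat end.

(** The product of 1 - q^j over s < j <= n, that is (q)_n / (q)_s written without division. *)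
Fixpoint qprod (n s : nat) : C :=
  match n with
  | O => RtoC 1
  | S p => if (S p <=? s)%nat then RtoC 1 else (qprod p s * (1 - q ^ S p))%C
  end.

Lemma qprod_ge (n s : nat) : (n <= s)%nat -> qprod n s = 1.
Proof.
  intros H. destruct n as [|n]; [reflexivity|]. cbn [qprod].
  destruct (Nat.leb_spec (S n) s); [reflexivity|lia].
Qed.

Lemma qprod_step (n s : nat) : (s <= n)%nat -> qprod (S n) s = (qprod n s * (1 - q ^ S n))%C.
Proof. intros H. cbn [qprod]. destruct (Nat.leb_spec (S n) s); [lia|reflexivity]. Qed.

Lemma qprod_front (n s : nat) : (S s <= n)%nat ->
  qprod n s = (qprod n (S s) * (1 - q ^ S s))%C.
Proof.
  induction n as [|n IH]; intros H; [lia|].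
  rewrite (qprod_step n s) by lia.
  destruct (Nat.eq_dec s n) as [->|Hs].
  - rewrite !qprod_ge by lia. reflexivity.
  - rewrite (qprod_step n (S s)) by lia. rewrite IH by lia. ring.
Qed.

(** The side of the identity that tends to Euler's product: its term s = 0 is [qprod n 0]. *)
Definition shanks (n : nat) : C :=
  csum (fun s => (-(1)) ^ s * qprod n s * q ^ (s * n + tri s))%C (S n).

(* Shanks' finite form of the pentagonal number theorem: the difference of
   consecutive sums telescopes through [t]. *)
Lemma shanks_step (n : nat) :
  shanks (S n) = (shanks n + (-(1)) ^ S n * (q ^ (S n * S n + tri n) + q ^ (S n * S n + tri (S n))))%C.
Proof.
  set (N := S n).
  set (t := fun s => ((-(1)) ^ s * qprod n s * q ^ (S s * N + tri s))%C).
  (* [d s] is the change of the s-th summand from n to N: the product gains 1 - q^N and the power of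
     q gains q^s. *)
  set (d := fun s => ((-(1)) ^ s * qprod n s * q ^ (s * n + tri s) * (q ^ s - q ^ s * q ^ N - 1))%C).
  assert (Hd : forall p, (p <= n)%nat -> csum d (S p) = (- t p)%C).
  { induction p as [|p IH]; intros Hp.
    - unfold d, t. cbn [csum tri]. replace (1 * N + 0)%nat with N by lia.
      change (0 * n + 0)%nat with 0%nat. simpl Cpow. ring.
    - change (csum d (S (S p))) with (csum d (S p) + d (S p))%C. rewrite IH by lia.
      unfold t, d. rewrite (qprod_front n p) by lia. cbn [tri].
      replace (S (S p) * N + (tri p + S p))%nat with (S p * n + (tri p + S p) + S p + N)%nat
        by (unfold N; lia).
      replace (S p * N + tri p)%nat with (S p * n + (tri p + S p))%nat by (unfold N; lia).
      rewrite !(Cpow_add_r q (S p * n + (tri p + S p) + S p) N), !(Cpow_add_r q (S p * n + (tri p + S p)) (S p)).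
      rewrite (Cpow_S (-(1)) p). ring. }
  assert (E : csum (fun s => (-(1)) ^ s * qprod N s * q ^ (s * N + tri s))%C N = (shanks n + csum d N)%C).
  { unfold shanks. fold N. rewrite <- csum_plus. apply csum_ext. intros s Hs.
    unfold N at 1. rewrite qprod_step by (unfold N in Hs; lia). fold N. unfold d.
    replace (s * N + tri s)%nat with (s * n + tri s + s)%nat by (unfold N; lia).
    rewrite Cpow_add_r. ring. }
  unfold shanks at 1. fold N.
  change (csum (fun s : nat => (- (1)) ^ s * qprod N s * q ^ (s * N + tri s))%C (S N)) with
   (csum (fun s : nat => (- (1)) ^ s * qprod N s * q ^ (s * N + tri s))%C N +
      (- (1)) ^ N * qprod N N * q ^ (N * N + tri N))%C.
  rewrite E, (Hd n (le_n n) : csum d N = (- t n)%C). unfold t.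
  rewrite !qprod_ge by (unfold N; lia). fold N.
  replace ((- (1)) ^ N)%C with (- (-(1)) ^ n)%C by (unfold N; rewrite Cpow_S; ring).
  change (S n * N + tri n)%nat with (N * N + tri n)%nat. ring.
Qed.

Hypothesis Hq : Cmod q < 1.

(** Each factor has modulus at most 1 + rho^j <= exp(rho^j), and the exponents have a bounded
    geometric sum. *)
Lemma qprod_bounded : exists M, 0 <= M /\ forall n s, Cmod (qprod n s) <= M.
Proof.
  set (rho := Cmod q) in *. assert (Hr : 0 <= rho) by apply Cmod_ge_0.
  exists (exp (/ (1 - rho))). split; [left; apply exp_pos|].
  assert (G : forall n, (1 - rho) * sum_f_R0 (fun j => rho ^ j) n = 1 - rho ^ S n).
  { intros n. induction n as [|n IH]; [simpl; ring|]. rewrite tech5, Rmult_plus_distr_l, IH. simpl. ring. }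
  intros n s. apply Rle_trans with (exp (sum_f_R0 (fun j => rho ^ j) n)).
  - induction n as [|n IH].
    + simpl. rewrite Cmod_1. pose proof (exp_ineq1_le 1). lra.
    + assert (Hpos : 0 <= sum_f_R0 (fun j => rho ^ j) (S n)).
      { apply cond_pos_sum. intros j. now apply pow_le. }
      cbn [qprod]. destruct (S n <=? s)%nat.
      * rewrite Cmod_1. pose proof (exp_ineq1_le (sum_f_R0 (fun j => rho ^ j) (S n))). lra.
      * rewrite Cmod_mult, tech5, exp_plus. apply Rmult_le_compat; try apply Cmod_ge_0; auto.
        eapply Rle_trans; [apply Cmod_triangle|]. rewrite Cmod_opp, Cmod_1, Cmod_pow. fold rho.
        apply exp_ineq1_le.
  - assert (sum_f_R0 (fun j => rho ^ j) n <= / (1 - rho)).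
    { apply Rmult_le_reg_l with (1 - rho); [lra|]. rewrite G, Rinv_r by lra.
      pose proof (pow_le rho (S n) Hr). lra. }
    destruct H as [H|H]; [left; now apply exp_increasing|rewrite H; lra].
Qed.

Lemma tri_ge (s : nat) : (s <= tri s)%nat.
Proof. induction s as [|s IH]; simpl; lia. Qed.

(** Only s = 0 survives: for s >= 1 the exponent s n + s(s+1)/2 is at least n + s, so these terms
    sum to a quantity of order rho^n. *)
Lemma shanks_lim : Clim (fun n => shanks n + (-(1)) * qprod n 0)%C 0.
Proof.
  destruct qprod_bounded as [M [HM Hb]].
  set (rho := Cmod q) in *. assert (Hr : 0 <= rho) by apply Cmod_ge_0.
  apply Clim_squeeze with (fun n => (M / (1 - rho)) * rho ^ n).
  2:{ replace (Finite 0) with (Rbar_mult (M / (1 - rho)) 0) by (simpl; f_equal; ring).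
      apply is_lim_seq_scal_l, is_lim_seq_geom. rewrite Rabs_pos_eq; auto. }
  intros n.
  assert (E : forall p, Cmod (csum (fun s => (-(1)) ^ s * qprod n s * q ^ (s * n + tri s))%C (S p)
     - qprod n 0)%C <= M * rho ^ n * ((1 - rho ^ S p) / (1 - rho))).
  { induction p as [|p IH].
    - simpl. match goal with |- Cmod ?z <= _ => replace z with (RtoC 0) by ring end.
      rewrite Cmod_0. repeat apply Rmult_le_pos; auto; [now apply pow_le|lra|].
      left; apply Rinv_0_lt_compat; lra.
    - change (csum (fun s => (-(1)) ^ s * qprod n s * q ^ (s * n + tri s))%C (S (S p))) with
        (csum (fun s => (-(1)) ^ s * qprod n s * q ^ (s * n + tri s))%C (S p) +
           (-(1)) ^ (S p) * qprod n (S p) * q ^ (S p * n + tri (S p)))%C.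
      match goal with |- Cmod (?a + ?b - ?c)%C <= _ => replace (a + b - c)%C with ((a - c) + b)%C by ring end.
      eapply Rle_trans; [apply Cmod_triangle|].
      rewrite !Cmod_mult, !Cmod_pow, Cmod_opp, Cmod_1, pow1, Rmult_1_l. fold rho.
      replace (M * rho ^ n * ((1 - rho ^ S (S p)) / (1 - rho))) with
        (M * rho ^ n * ((1 - rho ^ S p) / (1 - rho)) + M * (rho ^ n * rho ^ S p)) by (simpl; field; lra).
      apply Rplus_le_compat; [exact IH|].
      apply Rmult_le_compat; auto; [apply Cmod_ge_0|now apply pow_le|].
      pose proof (tri_ge (S p)).
      replace (S p * n + tri (S p))%nat with (n + S p + (p * n + tri (S p) - S p))%nat by lia.
      rewrite pow_add, pow_add. rewrite <- (Rmult_1_r (rho ^ n * rho ^ S p)) at 2.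
      apply Rmult_le_compat_l; [apply Rmult_le_pos; now apply pow_le|].
      rewrite <- (pow1 (p * n + tri (S p) - S p)). apply pow_incr. lra. }
  replace (shanks n + -(1) * qprod n 0 - 0)%C with (shanks n - qprod n 0)%C by ring.
  eapply Rle_trans; [apply (E n)|].
  replace (M / (1 - rho) * rho ^ n) with (M * rho ^ n * (1 / (1 - rho))) by (field; lra).
  apply Rmult_le_compat_l; [apply Rmult_le_pos; auto; now apply pow_le|].
  apply Rmult_le_compat_r; [left; apply Rinv_0_lt_compat; lra|].
  pose proof (pow_le rho (S n) Hr). lra.
Qed.

End Pentagonal.

Lemma INR_tri (s : nat) : INR (tri s) = INR s * (INR s + 1) / 2.
Proof. induction s as [|s IH]; [simpl; field|]. cbn [tri]. rewrite plus_INR, IH, S_INR. field. Qed.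

Lemma e_half_nat (n : nat) : e (RtoC (INR n / 2)) = ((-(1)) ^ n)%C.
Proof.
  replace (-(1))%C with (e (RtoC (1 / 2))).
  - rewrite e_pow, <- RtoC_mult. do 2 f_equal. field.
  - rewrite e_R. replace (2 * PI * (1 / 2)) with PI by field.
    rewrite cos_PI, sin_PI. unfold Copp, RtoC. simpl. f_equal; ring.
Qed.

Lemma e_half_opp (n : Z) : e (RtoC (- (IZR n / 2))) = e (RtoC (IZR n / 2)).
Proof.
  replace (IZR n / 2) with (- (IZR n / 2) + IZR n) at 2 by field.
  rewrite RtoC_plus, e_add, e_Z. ring.
Qed.

(** Euler's term (-1)^n q^(n(3n-1)/2), its sign written as e(n/2) so that it makes sense for
    negative n and merges with the other exponentials. *)
Definition pent (tau : C) (n : Z) : C :=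
  (e (RtoC (IZR n / 2)) * e (RtoC (IZR n * (3 * IZR n - 1) / 2) * tau))%C.

(** Shanks' sum runs over -n <= j <= n, one index more than the window of [part]. *)
Lemma shanks_part (tau : C) (n : nat) :
  shanks (e tau) n = (part (pent tau) n + pent tau (Z.of_nat n))%C.
Proof.
  induction n as [|n IH].
  - unfold shanks, pent. simpl.
    replace (0 / 2) with 0 by field. replace (0 * (3 * 0 - 1) / 2) with 0 by field.
    rewrite Cmult_0_l, e_0. ring.
  - rewrite shanks_step, IH. cbn [part].
    assert (E1 : pent tau (Z.of_nat (S n)) = ((-(1)) ^ S n * e tau ^ (S n * S n + tri n))%C).
    { unfold pent. rewrite <- INR_IZR_INZ, e_half_nat, e_pow. do 4 f_equal.
      rewrite plus_INR, mult_INR, INR_tri, S_INR. field. }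
    assert (E2 : pent tau (- Z.of_nat (S n))%Z = ((-(1)) ^ S n * e tau ^ (S n * S n + tri (S n)))%C).
    { unfold pent. rewrite opp_IZR, Rdiv_opp_l, e_half_opp, <- INR_IZR_INZ, e_half_nat, e_pow. do 4 f_equal.
      rewrite plus_INR, mult_INR, INR_tri, S_INR. field. }
    rewrite E1, E2. ring.
Qed.

Lemma sqrt3_sq : (RtoC (sqrt 3) * RtoC (sqrt 3))%C = 3.
Proof. rewrite <- RtoC_mult, sqrt_sqrt by lra. reflexivity. Qed.

(** The square is completed by n(3n-1)/2 + 1/24 = (3/2)(n - 1/6)^2, so with r^2 = -i tau the
    pentagonal series times q^(1/24) is a signed Gaussian sum with s = sqrt 3 r. *)
Definition eta_term (r : C) (n : Z) : C :=
  (e (RtoC (IZR n / 2)) *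
   gauss (- (RtoC (sqrt 3) * r / 6)) (RtoC (sqrt 3) * r) (IZR n))%C.

Lemma dom_gauss (w s : C) : 0 < Re (s * s) -> dom (fun n => gauss w s (IZR n)).
Proof. intros H. destruct (gauss_env w s H) as [K [HK H']]. exists K. intros n. apply H'. Qed.

Lemma Re_sqrt3_sq (r : C) : 0 < Re (r * r) -> 0 < Re (RtoC (sqrt 3) * r * (RtoC (sqrt 3) * r)).
Proof.
  intros H. replace (RtoC (sqrt 3) * r * (RtoC (sqrt 3) * r))%C with (3 * (r * r))%C
    by (rewrite <- sqrt3_sq; ring).
  unfold Re in *. simpl in *. lra.
Qed.

Lemma dom_eta_term (r : C) : 0 < Re (r * r) -> dom (eta_term r).
Proof.
  intros H.
  apply dom_le with (fun n => gauss (- (RtoC (sqrt 3) * r / 6)) (RtoC (sqrt 3) * r) (IZR n)) 1; [lra| |].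
  - intros n. unfold eta_term. rewrite Cmod_mult, Cmod_e_R. lra.
  - now apply dom_gauss, Re_sqrt3_sq.
Qed.

Lemma eta_term_pent (tau r : C) (n : Z) : (r * r)%C = (- (Ci * tau))%C ->
  eta_term r n = (epow tau (1 / 24) * pent tau n)%C.
Proof.
  intros Hr. unfold eta_term, pent, epow, gauss.
  replace ((- (RtoC (sqrt 3) * r / 6) + RtoC (sqrt 3) * r * RtoC (IZR n)) *
     (- (RtoC (sqrt 3) * r / 6) + RtoC (sqrt 3) * r * RtoC (IZR n)))%C
    with ((RtoC (sqrt 3) * RtoC (sqrt 3)) * (r * r) * (RtoC (IZR n) - 1 / 6) * (RtoC (IZR n) - 1 / 6))%C by field.
  rewrite sqrt3_sq, Hr. unfold e. rewrite <- !Cexp_add. f_equal.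
  Cpush. field.
Qed.

Lemma Cprod_qprod (tau : C) (n : nat) :
  Cprod (fun j => RtoC 1 - epow tau (INR (S j)))%C n = qprod (e tau) n 0.
Proof.
  induction n as [|n IH]; [reflexivity|]. rewrite qprod_step by lia. cbn [Cprod]. rewrite IH, e_pow.
  reflexivity.
Qed.

(** By [shanks_lim] the partial products and the Shanks sums have the same limit, and the latter are
    windowed sums of the pentagonal series. *)
Lemma eta_series (tau r : C) : 0 < Im tau -> (r * r)%C = (- (Ci * tau))%C ->
  eta tau = ZSeries (eta_term r).
Proof.
  intros Ht Hr.
  assert (Hr' : 0 < Re (r * r)) by (rewrite Hr; unfold Re, Im in *; simpl; lra).
  pose proof (dom_eta_term r Hr') as d.
  assert (d' : dom (pent tau)).
  { apply dom_ext with (fun n => / epow tau (1 / 24) * eta_term r n)%C.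
    - intros n. rewrite (eta_term_pent tau r n Hr). field. apply e_neq_0.
    - now apply dom_scal. }
  unfold eta.
  replace (CProduct _) with (ZSeries (pent tau)).
  - rewrite <- ZSeries_scal by auto. apply ZSeries_ext. intros n. symmetry. now apply eta_term_pent.
  - symmetry.
    assert (L : Clim (Cprod (fun j => RtoC 1 - epow tau (INR (S j)))%C) (ZSeries (pent tau))).
    { assert (Hq : Cmod (e tau) < 1).
      { unfold e. rewrite Cmod_Cexp, <- exp_0. apply exp_increasing. pose proof PI_RGT_0.
        unfold Re, Im in *. simpl. nra. }
      pose proof (shanks_lim (e tau) Hq) as H.
      apply (Clim_ext (fun n => (part (pent tau) n + pent tau (Z.of_nat n)) +
         (-(1)) * (shanks (e tau) n + (-(1)) * qprod (e tau) n 0))%C).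
      { intros n. rewrite shanks_part, Cprod_qprod. ring. }
      replace (ZSeries (pent tau)) with ((ZSeries (pent tau) + 0) + (-(1)) * 0)%C by ring.
      apply Clim_plus; [apply Clim_plus; [now apply ZSeries_lim|now apply dom_lim_pos]|].
      now apply Clim_scal. }
    apply the_unique; [now apply Clim_filterlim|].
    intros y Hy. apply Clim_filterlim in Hy. now apply Clim_unique with (1 := Hy).
Qed.

Lemma Re_Cinv_pos (z : C) : 0 < Re z -> 0 < Re (/ z).
Proof.
  destruct z as [x y]. unfold Re, Cinv; simpl. intros H. apply Rdiv_lt_0_compat; nra.
Qed.

Lemma Re_pos_neq_0 (z : C) : 0 < Re z -> z <> 0.
Proof. intros H E. rewrite E in H. simpl in H. lra. Qed.

Lemma Cinv_sq (r : C) : r <> 0 -> (/ r * / r)%C = (/ (r * r))%C.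
Proof. intros H. field. auto. Qed.

(** The dual sum is split modulo 3. Classes 0 and 1 are copies of the eta series with factors exp(pi
    i/6) and exp(-pi i/6), which add up to sqrt 3; class 2 is antisymmetric and vanishes. *)
Lemma eta_term_inversion (r : C) : 0 < Re r -> 0 < Re (r * r) ->
  (r * ZSeries (eta_term r))%C = ZSeries (eta_term (/ r)).
Proof.
  intros H1 H2. pose proof (Re_pos_neq_0 r H1) as Hr0.
  assert (H3 : 0 < Re (/ r * / r)) by (rewrite Cinv_sq by auto; now apply Re_Cinv_pos).
  set (s := (RtoC (sqrt 3) * r)%C).
  assert (Hs3 : 0 < sqrt 3) by (apply sqrt_lt_R0; lra).
  assert (HS3 : RtoC (sqrt 3) <> 0) by (intros E; apply RtoC_inj in E; lra).
  assert (Hs2 : 0 < Re (s * s)) by now apply Re_sqrt3_sq.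
  assert (Hs1 : 0 < Re s).
  { unfold s. replace (Re (RtoC (sqrt 3) * r)) with (sqrt 3 * Re r) by (unfold Re; simpl; ring).
    now apply Rmult_lt_0_compat. }
  assert (Es : (s * s)%C = (3 * (r * r))%C) by (unfold s; rewrite <- sqrt3_sq; ring).
  (* -1/6 is the pentagonal shift; -i/(6 r^2) produces the sign e(n/2) when the square is expanded,
     and [c] removes the resulting constant. *)
  set (X := (- (1 / 6) - Ci / (6 * (r * r)))%C).
  set (c := Cexp (RtoC PI * Ci / 6 - RtoC PI / (12 * (r * r)))%C).
  set (v := fun m => (c * dual s X m)%C).
  assert (dd : dom (dual s X)) by now apply dom_dual.
  assert (dv : dom v) by now apply dom_scal.
  assert (Ev : forall m, v m = Cexp (- (RtoC PI * Ci * (2 * RtoC (IZR m) - 1) / 6)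
     - RtoC PI * (2 * RtoC (IZR m) - 1) * (2 * RtoC (IZR m) - 1) / (12 * (r * r)))%C).
  { intros m. unfold v, c, dual, e. rewrite Es, <- !Cexp_add. f_equal. unfold X. Cpush.
    replace (2 * RtoC PI * Ci * (RtoC (IZR m) * (- (1 / 6) - Ci / (6 * (r * r)))))%C with
     (2 * RtoC PI * RtoC (IZR m) * (- Ci / 6 - (Ci * Ci) / (6 * (r * r))))%C by (field; auto).
    rewrite Ci_Ci. field. auto. }
  assert (E1 : (RtoC (sqrt 3) * (r * ZSeries (eta_term r)))%C = ZSeries v).
  { unfold v. rewrite ZSeries_scal by auto.
    rewrite <- (theta_inversion s X Hs1 Hs2).
    rewrite (ZSeries_ext (eta_term r) (fun n => c * gauss (s * X) s (IZR n))%C).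
    - rewrite ZSeries_scal by now apply dom_gauss. unfold s. ring.
    - intros n. unfold eta_term, c, gauss, e. fold s. rewrite <- !Cexp_add. f_equal.
      replace ((s * X + s * RtoC (IZR n)) * (s * X + s * RtoC (IZR n)))%C with
        ((s * s) * (X + RtoC (IZR n)) * (X + RtoC (IZR n)))%C by ring.
      replace ((- (s / 6) + s * RtoC (IZR n)) * (- (s / 6) + s * RtoC (IZR n)))%C with
        ((s * s) * (RtoC (IZR n) - 1 / 6) * (RtoC (IZR n) - 1 / 6))%C by field.
      rewrite Es. unfold X. Cpush.
      replace (3 * (r * r) * (- (1 / 6) - Ci / (6 * (r * r)) + RtoC (IZR n))
         * (- (1 / 6) - Ci / (6 * (r * r)) + RtoC (IZR n)))%C with
       (3 * (r * r) * (RtoC (IZR n) - 1 / 6) * (RtoC (IZR n) - 1 / 6) - Ci * (RtoC (IZR n) - 1 / 6)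
          + (Ci * Ci) / (12 * (r * r)))%C by (field; auto).
      rewrite Ci_Ci. field. auto. }
  assert (E2 : ZSeries v = (RtoC (sqrt 3) * ZSeries (eta_term (/ r)))%C).
  { rewrite (ZSeries_mod_split v 0 3) by (auto; lia). cbn [csum].
    assert (Eg : forall n, eta_term (/ r) n = Cexp (RtoC PI * Ci * RtoC (IZR n)
       - RtoC PI * (6 * RtoC (IZR n) - 1) * (6 * RtoC (IZR n) - 1) / (12 * (r * r)))%C).
    { intros n. unfold eta_term, gauss, e. rewrite <- Cexp_add. f_equal.
      replace ((- (RtoC (sqrt 3) * / r / 6) + RtoC (sqrt 3) * / r * RtoC (IZR n)) *
         (- (RtoC (sqrt 3) * / r / 6) + RtoC (sqrt 3) * / r * RtoC (IZR n)))%C with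
        ((RtoC (sqrt 3) * RtoC (sqrt 3)) * (RtoC (IZR n) - 1 / 6) * (RtoC (IZR n) - 1 / 6) / (r * r))%C
        by (field; auto).
      rewrite sqrt3_sq. Cpush. field. auto. }
    pose proof (dom_eta_term (/ r) H3) as dg.
    assert (A0 : ZSeries (fun l => v (0 + Z.of_nat 0 + Z.of_nat 3 * l)%Z)
       = (Cexp (RtoC PI * Ci / 6) * ZSeries (eta_term (/ r)))%C).
    { rewrite <- ZSeries_scal by auto. apply ZSeries_ext. intros l. rewrite Ev, Eg, <- Cexp_add.
      apply Cexp_period with l.
      simpl Z.of_nat. rewrite !Z.add_0_l, mult_IZR, RtoC_mult. field. auto. }
    assert (A1 : ZSeries (fun l => v (0 + Z.of_nat 1 + Z.of_nat 3 * l)%Z)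
       = (Cexp (- (RtoC PI * Ci / 6)) * ZSeries (eta_term (/ r)))%C).
    { rewrite <- (ZSeries_opp (eta_term (/ r))) by auto.
      rewrite <- ZSeries_scal by now apply dom_opp. apply ZSeries_ext. intros l. rewrite Ev, Eg, <- Cexp_add.
      f_equal. simpl Z.of_nat. rewrite !Z.add_0_l, plus_IZR, mult_IZR, opp_IZR, RtoC_opp, RtoC_plus, RtoC_mult. field. auto. }
    (* The involution l -> -1-l keeps the quadratic part and reverses the sign of the term. *)
    assert (A2 : ZSeries (fun l => v (0 + Z.of_nat 2 + Z.of_nat 3 * l)%Z) = 0).
    { set (W := fun l => v (0 + Z.of_nat 2 + Z.of_nat 3 * l)%Z).
      assert (dW : dom W) by (apply (dom_affine v (0 + Z.of_nat 2) (Z.of_nat 3)); auto; lia).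
      assert (EW : ZSeries W = (-(1) * ZSeries W)%C).
      { rewrite <- (ZSeries_shift W (-1)) at 1 by auto.
        rewrite <- (ZSeries_opp (fun n => W (n + -1)%Z)) by now apply dom_shift.
        rewrite <- ZSeries_scal by auto. apply ZSeries_ext. intros l. unfold W. rewrite !Ev.
        assert (Em : (-(1))%C = Cexp (RtoC PI * Ci)).
        { pose proof (e_half_nat 1) as Eh. rewrite Cpow_1_r in Eh. rewrite <- Eh. unfold e. f_equal.
          simpl INR. Cpush. field. }
        rewrite Em, <- Cexp_add. apply Cexp_period with (- l)%Z.
        simpl Z.of_nat. rewrite !plus_IZR, !mult_IZR, !plus_IZR, !opp_IZR. Cpush. field. auto. }
      replace (ZSeries W) with (1 / 2 * (ZSeries W + ZSeries W))%C by field.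
      rewrite EW at 1. field. }
    rewrite A0, A1, A2.
    assert (Ec : (Cexp (RtoC PI * Ci / 6) + Cexp (- (RtoC PI * Ci / 6)))%C = RtoC (sqrt 3)).
    { replace (RtoC PI * Ci / 6)%C with (0, PI / 6).
      2:{ unfold RtoC, Ci, Cdiv, Cmult, Cinv; simpl. f_equal; field. }
      unfold Cexp, Cplus, Copp, RtoC; simpl. rewrite Ropp_0, exp_0, cos_neg, sin_neg, cos_PI6.
      f_equal; field. }
    rewrite <- Ec. ring. }
  rewrite E2 in E1.
  replace (r * ZSeries (eta_term r))%C with (/ RtoC (sqrt 3) * (RtoC (sqrt 3) * (r * ZSeries (eta_term r))))%C
    by (field; auto).
  rewrite E1. field. auto.
Qed.


(** * Coefficients of powers of theta *)

(** The angle of [v] is atan(Im v / Re v), within the prescribed range. The only competitor is -v,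
    excluded because that range forces a nonnegative real part. *)
Lemma Csqrt_unique (v w : C) : (v * v)%C = w -> 0 < Re v -> Csqrt w = v.
Proof.
  intros Hv Hpos. apply the_unique.
  - split; auto. exists (Cmod v), (atan (Im v / Re v)).
    pose proof (atan_bound (Im v / Re v)) as Hb.
    split; [apply Cmod_ge_0|]. split; [lra|].
    rewrite cos_atan, sin_atan.
    assert (E : sqrt (1 + (Im v / Re v)²) = Cmod v / Re v).
    { replace (Cmod v / Re v) with (sqrt ((Cmod v / Re v)²)).
      - f_equal. unfold Rsqr. replace (Cmod v / Re v * (Cmod v / Re v)) with (Cmod v ^ 2 / (Re v) ^ 2) by (field; lra).
        rewrite Cmod2_alt. field. lra.
      - apply sqrt_Rsqr. apply Rdiv_le_0_compat; [apply Cmod_ge_0|auto]. }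
    rewrite E.
    assert (0 < Cmod v).
    { apply Cmod_gt_0. now apply Re_pos_neq_0. }
    destruct v as [x y]. unfold Re, Im in *. simpl in *. f_equal; field; lra.
  - intros y [Hy (r & t & Hr & Ht & ->)].
    set (y := (r * cos t, r * sin t)) in *.
    assert (Hc : 0 <= cos t) by (apply cos_ge_0; lra).
    assert (E : ((y - v) * (y + v))%C = 0) by (replace ((y - v) * (y + v))%C with (y * y - v * v)%C by ring;
      rewrite Hy, Hv; ring).
    destruct (Ceq_dec (y - v) 0) as [E1|E1].
    { replace y with ((y - v) + v)%C by ring. rewrite E1. ring. }
    destruct (Ceq_dec (y + v) 0) as [E2|E2].
    { exfalso. assert (Re (y + v) = 0) by now rewrite E2.
      unfold Re, y in *. simpl in *. nra. }
    now destruct (Cmult_neq_0 _ _ E1 E2).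
Qed.

(** Half-angle formulas for the root of -i tau = x + i y, where x = Im tau > 0 and y = -Re tau. *)
Lemma upper_half_root (tau : C) : 0 < Im tau ->
  exists r : C, (r * r)%C = (- (Ci * tau))%C /\ 0 < Re r.
Proof.
  intros H. set (x := Im tau) in *. set (y := - Re tau).
  set (M := sqrt (x ^ 2 + y ^ 2)).
  assert (HM : M * M = x ^ 2 + y ^ 2) by (apply sqrt_sqrt; nra).
  assert (HM0 : 0 <= M) by apply sqrt_pos.
  assert (Hp : 0 < sqrt ((M + x) / 2)) by (apply sqrt_lt_R0; lra).
  assert (Hpp : sqrt ((M + x) / 2) * sqrt ((M + x) / 2) = (M + x) / 2) by (apply sqrt_sqrt; lra).
  set (p := sqrt ((M + x) / 2)) in *.
  exists (p, y / (2 * p)). split; [|exact Hp].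
  replace (- (Ci * tau))%C with (x, y).
  2:{ destruct tau as [a b]. unfold x, y, Re, Im, Ci, Cmult, Copp. simpl. f_equal; ring. }
  unfold Cmult; simpl. f_equal.
  - replace (p * p - y / (2 * p) * (y / (2 * p))) with (p * p - y ^ 2 / (4 * (p * p))) by (field; lra).
    rewrite Hpp. replace (y ^ 2) with ((M - x) * (M + x)) by lra. field. lra.
  - field. lra.
Qed.

Lemma e_quarter : e (RtoC (1 / 4)) = Ci.
Proof.
  rewrite e_R. replace (2 * PI * (1 / 4)) with (PI / 2) by field.
  now rewrite cos_PI2, sin_PI2.
Qed.

(** Re(r^2) > 0 and Re r > 0 give |Im r| < Re r, so rotating r by pi/4 keeps it in the right half
    plane. This is the origin of the 1/8 in the transformation matrix. *)
Lemma Csqrt_upper (tau r : C) : 0 < Im tau -> (r * r)%C = (- (Ci * tau))%C -> 0 < Re r ->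
  Csqrt tau = (e (RtoC (1 / 8)) * r)%C.
Proof.
  intros Ht Hr Hpos. apply Csqrt_unique.
  - replace (e (RtoC (1 / 8)) * r * (e (RtoC (1 / 8)) * r))%C with
      ((e (RtoC (1 / 8)) * e (RtoC (1 / 8))) * (r * r))%C by ring.
    rewrite <- e_add, <- RtoC_plus. replace (1 / 8 + 1 / 8) with (1 / 4) by field.
    rewrite e_quarter, Hr. replace (Ci * - (Ci * tau))%C with (- (Ci * Ci) * tau)%C by ring.
    rewrite Ci_Ci. ring.
  - assert (Hd : 0 < Re (r * r)) by (rewrite Hr; unfold Re, Im in *; simpl; lra).
    rewrite e_R. replace (2 * PI * (1 / 8)) with (PI / 4) by field.
    rewrite cos_PI4, sin_PI4. destruct r as [x y]. unfold Re in *. simpl in *.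
    assert (0 < 1 / sqrt 2).
    { apply Rdiv_lt_0_compat; [lra|]. apply sqrt_lt_R0; lra. }
    assert (0 < x - y) by nra. nra.
Qed.

Lemma Csqrt_1 : Csqrt 1 = 1.
Proof. apply Csqrt_unique; [ring|simpl; lra]. Qed.

Lemma epow_0 (z : C) : epow z 0 = 1.
Proof. unfold epow. rewrite Cmult_0_l. apply e_0. Qed.

Lemma epow_0_l (x : R) : epow 0 x = 1.
Proof. unfold epow. rewrite Cmult_0_r. apply e_0. Qed.

Lemma epow_plus (z : C) (x y : R) : epow z (x + y) = (epow z x * epow z y)%C.
Proof. unfold epow. rewrite <- e_add. f_equal. rewrite RtoC_plus. ring. Qed.

Lemma is_series_lin (c : C) (a b : nat -> C) (l m : C) :
  is_series (V := C_R_NormedModule) a l -> is_series (V := C_R_NormedModule) b m ->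
  is_series (V := C_R_NormedModule) (fun n => c * (a n + (-(1)) * b n))%C (c * (l + (-(1)) * m))%C.
Proof.
  intros Ha Hb. apply Clim_filterlim in Ha. apply Clim_filterlim in Hb.
  apply Clim_filterlim.
  apply Clim_ext with (fun n => c * (sum_n (G := C_R_NormedModule) a n
     + (-(1)) * sum_n (G := C_R_NormedModule) b n))%C.
  - induction n as [|n IH]; [now rewrite !sum_O|].
    rewrite !sum_Sn. etransitivity; [|apply f_equal2; [exact IH|reflexivity]].
    set (A := sum_n _ n). set (B := sum_n _ n). clearbody A B.
    change (c * ((A + a (S n)) + (-(1)) * (B + b (S n))) =
      c * (A + (-(1)) * B) + c * (a (S n) + (-(1)) * b (S n)))%C. ring.
  - apply Clim_scal, Clim_plus; [exact Ha|]. now apply Clim_scal.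
Qed.

Lemma is_Zseries_lin (c : C) (u v : Z -> C) (l m : C) : is_Zseries u l -> is_Zseries v m ->
  is_Zseries (fun n => c * (u n + (-(1)) * v n))%C (c * (l + (-(1)) * m))%C.
Proof.
  intros (l1 & l2 & H1 & H2 & ->) (m1 & m2 & H3 & H4 & ->).
  exists (c * (l1 + (-(1)) * m1))%C, (c * (l2 + (-(1)) * m2))%C.
  split; [exact (is_series_lin c _ _ _ _ H1 H3)|].
  split; [exact (is_series_lin c _ _ _ _ H2 H4)|]. ring.
Qed.

(** After multiplication by zeta^(-x) the difference has integer exponents and [zeta_coef_zero]
    applies. Identities between coefficients below come from two expansions of one function. *)
Lemma zeta_unique (x : R) (a b : Z -> C) (G : C -> C) :
  (forall z, is_Zseries (fun m => a m * epow z (x + IZR m))%C (G z)) ->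
  (forall z, is_Zseries (fun m => b m * epow z (x + IZR m))%C (G z)) ->
  forall m, a m = b m.
Proof.
  intros Ha Hb m0.
  assert (E : (a m0 + (-(1)) * b m0)%C = 0).
  { apply (zeta_coef_zero (fun m => a m + (-(1)) * b m)%C). intros z.
    pose proof (is_Zseries_lin (epow z (- x)) _ _ _ _ (Ha z) (Hb z)) as H.
    replace (epow z (- x) * (G z + - (1) * G z))%C with (RtoC 0) in H by ring.
    replace (fun m => ((a m + - (1) * b m) * e (IZR m * z))%C) with
     (fun n => (epow z (- x) * (a n * epow z (x + IZR n) + - (1) * (b n * epow z (x + IZR n))))%C); auto.
    apply functional_extensionality. intros m.
    replace (e (IZR m * z)) with (epow z (- x) * epow z (x + IZR m))%C; [ring|].
    rewrite <- epow_plus. unfold epow. do 2 f_equal. f_equal. ring. }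
  replace (a m0) with (a m0 + - (1) * b m0 + b m0)%C by ring. rewrite E. ring.
Qed.

Definition th (tau : C) (m : Z) : C :=
  Cexp (RtoC PI * Ci * (RtoC (IZR m + 1 / 2) * RtoC (IZR m + 1 / 2)) * tau)%C.

Definition Theta (tau z : C) : C := ZSeries (fun m => th tau m * epow z (IZR m + 1 / 2))%C.

(** The extra shift by 1/2 turns e(n/2) into e(n), which is -1 for half-integral n and is cancelled
    by the minus sign. *)
Lemma vartheta_Theta (tau z : C) : 0 < Im tau ->
  dom (fun m => th tau m * epow z (IZR m + 1 / 2))%C ->
  (- vartheta tau (z + RtoC (1 / 2)))%C = Theta tau z.
Proof.
  intros Ht d. unfold Theta, vartheta.
  replace (- ZSeries _)%C with ((-(1)) * ZSeries (fun m => (-(1)) * (th tau m * epow z (IZR m + 1 / 2)))%C)%C.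
  - rewrite ZSeries_scal by auto. ring.
  - match goal with |- (_ * ?a = - ?b)%C => replace b with a; [ring|] end.
    apply ZSeries_ext. intros m. cbv zeta.
    assert (E : (-(1))%C = Cexp (RtoC PI * Ci)).
    { pose proof (e_half_nat 1) as Eh. rewrite Cpow_1_r in Eh. rewrite <- Eh. unfold e. f_equal.
      simpl INR. Cpush. field. }
    rewrite E. unfold th, epow, e. rewrite <- !Cexp_add. apply Cexp_period with m.
    Cpush. field.
Qed.

Lemma dom_Theta (tau z : C) : 0 < Im tau -> dom (fun m => th tau m * epow z (IZR m + 1 / 2))%C.
Proof.
  intros Ht. destruct (upper_half_root tau Ht) as [r [Hr Hp]].
  assert (Ht0 : tau <> 0) by (intros E; rewrite E in Ht; simpl in Ht; lra).
  assert (Hr' : 0 < Re (r * r)) by (rewrite Hr; unfold Re, Im in *; simpl; lra).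
  apply dom_ext with (fun m => Cexp (- (RtoC PI * Ci * z * z / tau)) *
     gauss (r * (1 / 2 + z / tau)) r (IZR m))%C; [|now apply dom_scal, dom_gauss].
  intros m. unfold gauss, th, epow, e. rewrite <- !Cexp_add. f_equal.
  replace ((r * (1 / 2 + z / tau) + r * RtoC (IZR m)) * (r * (1 / 2 + z / tau) + r * RtoC (IZR m)))%C
    with ((r * r) * (1 / 2 + z / tau + RtoC (IZR m)) * (1 / 2 + z / tau + RtoC (IZR m)))%C by ring.
  rewrite Hr. Cpush. field. auto.
Qed.

(** The index m stands for the exponent k/2 + m of zeta; this keeps half-integers out of the
    convolutions. *)
Fixpoint theta_coef (tau : C) (k : nat) : Z -> C :=
  match k with
  | O => single 0 1
  | S p => conv (theta_coef tau p) (th tau)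
  end.

Lemma dom_th (tau : C) : 0 < Im tau -> dom (th tau).
Proof.
  intros Ht. apply dom_ext with (2 := dom_Theta tau 0 Ht). intros m. rewrite epow_0_l. ring.
Qed.

Lemma theta_coef_expansion (tau z : C) (k : nat) : 0 < Im tau ->
  dom (fun m => theta_coef tau k m * epow z (INR k / 2 + IZR m))%C /\
  ZSeries (fun m => theta_coef tau k m * epow z (INR k / 2 + IZR m))%C = (Theta tau z ^ k)%C.
Proof.
  intros Ht. revert z. induction k as [|k IH]; intros z.
  - assert (E : forall m, single 0 1 m = (theta_coef tau 0 m * epow z (INR 0 / 2 + IZR m))%C).
    { intros m. simpl. unfold single. destruct (Z.eqb_spec m 0) as [->|_]; [|ring].
      replace (0 / 2 + 0) with 0 by field. rewrite epow_0. ring. }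
    split; [apply dom_ext with (1 := E), dom_single|].
    rewrite <- (ZSeries_ext _ _ E), ZSeries_single. reflexivity.
  (* At z = 0 all powers of zeta are 1, so the induction hypothesis there dominates the bare
     coefficients. *)
  - assert (dk : dom (theta_coef tau k)).
    { apply dom_ext with (2 := proj1 (IH (RtoC 0))). intros m. rewrite epow_0_l. ring. }
    destruct (IH z) as [d1 e1]. pose proof (dom_Theta tau z Ht) as d2.
    assert (E : forall m, conv (fun m => theta_coef tau k m * epow z (INR k / 2 + IZR m))%C
        (fun m => th tau m * epow z (IZR m + 1 / 2))%C m
        = (theta_coef tau (S k) m * epow z (INR (S k) / 2 + IZR m))%C).
    { intros m. simpl theta_coef. unfold conv at 2. rewrite Cmult_comm, <- ZSeries_scal.
      - apply ZSeries_ext. intros j.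
        replace (INR (S k) / 2 + IZR m) with ((INR k / 2 + IZR j) + (IZR (m - j) + 1 / 2))
          by (rewrite S_INR, minus_IZR; field).
        rewrite (epow_plus z (INR k / 2 + IZR j) (IZR (m - j) + 1 / 2)). ring.
      - apply dom_conv_term; [exact dk|now apply dom_th]. }
    split.
    + apply dom_ext with (1 := E). now apply dom_conv.
    + rewrite <- (ZSeries_ext _ _ E), ZSeries_conv by auto. rewrite e1, Cpow_S. unfold Theta. ring.
Qed.

Lemma dom_theta_coef (tau : C) (k : nat) : 0 < Im tau -> dom (theta_coef tau k).
Proof.
  intros Ht. apply dom_ext with (2 := proj1 (theta_coef_expansion tau 0 k Ht)).
  intros m. rewrite epow_0_l. ring.
Qed.

Lemma theta_coef_is (tau z : C) (k : nat) : 0 < Im tau ->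
  is_Zseries (fun m => theta_coef tau k m * epow z (INR k / 2 + IZR m))%C (Theta tau z ^ k)%C.
Proof.
  intros Ht. destruct (theta_coef_expansion tau z k Ht) as [d E]. rewrite <- E. now apply ZSeries_correct.
Qed.

(** With the convention / 0 = 0 the identity covers b = 0 too; it is applied with a value of [eta]
    as [b]. *)
Lemma Cinv_mul (a b : C) : a <> 0 -> (/ (a * b))%C = (/ a * / b)%C.
Proof.
  intros Ha. destruct (Ceq_dec b 0) as [->|Hb]; [|field; auto].
  rewrite Cmult_0_r. replace (/ 0)%C with (RtoC 0); [ring|].
  unfold Cinv, RtoC; simpl. f_equal; unfold Rdiv; ring.
Qed.

Lemma CPsi_eq (k : nat) (tau : C) (m : Z) : 0 < Im tau ->
  CPsi k (INR k / 2 + IZR m) tau =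
    ((/ (epow tau (1 / 12) * eta tau)) ^ k * theta_coef tau k m)%C.
Proof.
  intros Ht. set (E := (/ (epow tau (1 / 12) * eta tau))%C).
  assert (HF : forall z, Fk k tau z = (E ^ k * Theta tau z ^ k)%C).
  { intros z. unfold Fk. rewrite vartheta_Theta; auto using dom_Theta.
    unfold Cdiv. fold E. rewrite Cpow_mult_l. ring. }
  assert (Hex : forall z, is_Zseries (fun m => E ^ k * theta_coef tau k m * epow z (INR k / 2 + IZR m))%C (Fk k tau z)).
  { intros z. rewrite HF. destruct (theta_coef_expansion tau z k Ht) as [d Ez]. rewrite <- Ez.
    rewrite <- ZSeries_scal by auto.
    replace (fun m => (E ^ k * theta_coef tau k m * epow z (INR k / 2 + IZR m))%C) with
      (fun m => (E ^ k * (theta_coef tau k m * epow z (INR k / 2 + IZR m)))%C).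
    - apply ZSeries_correct. now apply dom_scal.
    - apply functional_extensionality. intros; ring. }
  unfold CPsi. apply the_unique.
  (* The expansion needs a function on all of R; [Int_part] recovers the index m from k/2 + m, and
     the values elsewhere are arbitrary. *)
  - exists (fun x => E ^ k * theta_coef tau k (Int_part (x - INR k / 2)))%C.
    assert (HI : forall n, Int_part (INR k / 2 + IZR n - INR k / 2) = n).
    { intros n. symmetry. apply Int_part_spec. split; lra. }
    split; [|now rewrite HI].
    intros z. cbv zeta.
    replace (fun m0 => _) with (fun m => (E ^ k * theta_coef tau k m * epow z (INR k / 2 + IZR m))%C); auto.
    apply functional_extensionality. intros n. now rewrite HI.
  - intros y [c [Hc ->]].
    apply (zeta_unique (INR k / 2) (fun m => c (INR k / 2 + IZR m)) (fun m => E ^ k * theta_coef tau k m)%C (Fk k tau));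
      auto.
Qed.

(* [g_(k,beta)] of the header, for [beta = k/2 + m]. *)
Definition gk (tau : C) (k : nat) (m : Z) : C :=
  (theta_coef tau k m * epow tau (- ((INR k / 2 + IZR m) ^ 2 / (2 * INR k))))%C.

(** The factor q^(k/12) of [fk] cancels the k-th power of q^(1/12) in the denominator of [Fk]. *)
Lemma fk_eq (k : nat) (tau : C) (m : Z) : 0 < Im tau ->
  fk k (INR k / 2 + IZR m) tau = ((/ eta tau) ^ k * gk tau k m)%C.
Proof.
  intros Ht. unfold fk, gk. rewrite CPsi_eq by auto.
  unfold Rminus. rewrite epow_plus, Cinv_mul, Cpow_mult_l by apply e_neq_0.
  replace (epow tau (INR k / 12)) with (epow tau (1 / 12) ^ k)%C.
  2:{ unfold epow. rewrite e_pow. f_equal. Cpush. field. }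
  rewrite Cpow_inv by apply e_neq_0. field.
  apply Cpow_nz, e_neq_0.
Qed.

(** * Quasi-period and parity of theta *)

Lemma Theta_quasi_period (tau z : C) : 0 < Im tau ->
  Theta tau (z + tau) = (e (- (tau / 2) - z) * Theta tau z)%C.
Proof.
  intros Ht. unfold Theta at 2. pose proof (dom_Theta tau z Ht) as d.
  rewrite <- (ZSeries_shift1 (fun m => th tau m * epow z (IZR m + 1 / 2))%C) by auto.
  rewrite <- ZSeries_scal by apply (dom_shift _ 1 d). apply ZSeries_ext. intros m.
  unfold th, epow, e. rewrite <- !Cexp_add. f_equal. rewrite plus_IZR. Cpush. field.
Qed.

(** Both sides are coefficients of Theta(z + tau)^k: one expansion substitutes directly, the other
    uses the quasi-period and a shift of the index by k. *)
Lemma theta_coef_quasi_period (tau : C) (k : nat) (m : Z) : 0 < Im tau ->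
  (theta_coef tau k m * epow tau (INR k / 2 + IZR m))%C =
  (theta_coef tau k (m + Z.of_nat k) * epow tau (- (INR k / 2)))%C.
Proof.
  intros Ht. revert m.
  apply (zeta_unique (INR k / 2) _ _ (fun z => Theta tau (z + tau) ^ k)%C).
  - intros z.
    replace (fun m => _) with (fun m => theta_coef tau k m * epow (z + tau) (INR k / 2 + IZR m))%C;
      [now apply theta_coef_is|].
    apply functional_extensionality. intros m.
    rewrite <- Cmult_assoc. f_equal. unfold epow. rewrite <- e_add. f_equal. ring.
  - intros z. destruct (theta_coef_expansion tau z k Ht) as [d Ez].
    rewrite Theta_quasi_period, Cpow_mult_l, e_pow, <- Ez by auto.
    rewrite <- (ZSeries_shift _ (Z.of_nat k) d), <- ZSeries_scal by apply (dom_shift _ _ d).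
    match goal with |- is_Zseries ?u (ZSeries ?v) => replace u with v end.
    + apply ZSeries_correct, dom_scal, (dom_shift _ _ d).
    + apply functional_extensionality. intros m.
      rewrite plus_IZR, <- INR_IZR_INZ.
      transitivity (theta_coef tau k (m + Z.of_nat k) *
        (e (INR k * (- (tau / 2) - z)) * epow z (INR k / 2 + (IZR m + INR k))))%C; [ring|].
      rewrite <- Cmult_assoc. f_equal. unfold epow. rewrite <- !e_add. f_equal. Cpush. field.
Qed.

(** The normalising exponent is made for this: ((b+k)^2 - b^2)/(2k) = b + k/2 is the power of q in
    the quasi-period at b = k/2 + m. *)
Lemma gk_period (tau : C) (k : nat) (m : Z) : (1 <= k)%nat -> 0 < Im tau ->
  gk tau k (m + Z.of_nat k) = gk tau k m.
Proof.
  intros Hk Ht. assert (HK : 1 <= INR k) by (apply (le_INR 1); auto).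
  assert (HKC : RtoC (INR k) <> 0) by (intros E; apply RtoC_inj in E; lra).
  unfold gk. pose proof (theta_coef_quasi_period tau k m Ht) as E.
  replace (theta_coef tau k (m + Z.of_nat k)) with
    (theta_coef tau k (m + Z.of_nat k) * epow tau (- (INR k / 2)) * epow tau (INR k / 2))%C.
  - rewrite <- E, <- !Cmult_assoc. f_equal. rewrite <- !epow_plus. f_equal.
    rewrite plus_IZR, <- INR_IZR_INZ. field. lra.
  - rewrite <- Cmult_assoc, <- epow_plus. replace (- (INR k / 2) + INR k / 2) with 0 by ring.
    rewrite epow_0. ring.
Qed.

Lemma gk_period_mul (tau : C) (k : nat) (m l : Z) : (1 <= k)%nat -> 0 < Im tau ->
  gk tau k (m + Z.of_nat k * l) = gk tau k m.
Proof.
  intros Hk Ht.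
  assert (Hn : forall (n : nat) m, gk tau k (m + Z.of_nat k * Z.of_nat n) = gk tau k m).
  { induction n as [|n IH]; intros m'; [f_equal; lia|].
    rewrite <- (IH m'), <- (gk_period tau k (m' + Z.of_nat k * Z.of_nat n)) by auto. f_equal. lia. }
  destruct (Z_le_gt_dec 0 l) as [H|H].
  - rewrite <- (Hn (Z.to_nat l) m). f_equal. lia.
  - rewrite <- (Hn (Z.to_nat (- l)) (m + Z.of_nat k * l)%Z). f_equal. lia.
Qed.

Lemma Theta_even (tau z : C) : 0 < Im tau -> Theta tau (- z) = Theta tau z.
Proof.
  intros Ht. pose proof (dom_Theta tau (- z) Ht) as d. unfold Theta.
  rewrite <- (ZSeries_shift _ (-1) d).
  rewrite <- (ZSeries_opp _ (dom_shift _ (-1) d)). apply ZSeries_ext. intros m. cbv beta.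
  unfold th, epow, e. rewrite <- !Cexp_add. f_equal. rewrite plus_IZR, opp_IZR. Cpush. field.
Qed.

(** The index -k-m belongs to the exponent -(k/2+m), so this is the parity of Theta. *)
Lemma theta_coef_even (tau : C) (k : nat) (m : Z) : 0 < Im tau ->
  theta_coef tau k (- Z.of_nat k - m) = theta_coef tau k m.
Proof.
  intros Ht. revert m.
  apply (zeta_unique (INR k / 2) _ _ (fun z => Theta tau z ^ k)%C); [|intros z; now apply theta_coef_is].
  intros z. rewrite <- Theta_even by auto.
  destruct (theta_coef_expansion tau (- z) k Ht) as [d Ez]. rewrite <- Ez.
  rewrite <- (ZSeries_shift _ (- Z.of_nat k) d).
  pose proof (dom_opp _ (dom_shift _ (- Z.of_nat k) d)) as d'.
  rewrite <- (ZSeries_opp _ (dom_shift _ (- Z.of_nat k) d)).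
  match goal with |- is_Zseries ?u (ZSeries ?v) => replace u with v end;
    [now apply ZSeries_correct|].
  apply functional_extensionality. intros m. cbv beta.
  replace (- m + - Z.of_nat k)%Z with (- Z.of_nat k - m)%Z by ring. f_equal.
  unfold epow. f_equal. rewrite minus_IZR, opp_IZR, <- INR_IZR_INZ. Cpush. field.
Qed.

Lemma gk_even (tau : C) (k : nat) (m : Z) : 0 < Im tau ->
  gk tau k (- Z.of_nat k - m) = gk tau k m.
Proof.
  intros Ht. unfold gk. rewrite theta_coef_even by auto. do 2 f_equal.
  rewrite minus_IZR, opp_IZR, <- INR_IZR_INZ. f_equal. f_equal. field.
Qed.

(** * The transformation tau -> tau + 1 *)

(** (m + 1/2)^2 / 2 = m(m+1)/2 + 1/8, and m(m+1) is even. *)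
Lemma th_T (tau : C) (m : Z) : th (tau + 1) m = (e (RtoC (1 / 8)) * th tau m)%C.
Proof.
  unfold th, e. rewrite <- Cexp_add. symmetry.
  assert (H : exists p, (m * (m + 1) = 2 * p)%Z).
  { destruct (Z.Even_or_Odd m) as [[q ->]|[q ->]]; eexists; [instantiate (1 := (q * (2 * q + 1))%Z)|instantiate (1 := ((2 * q + 1) * (q + 1))%Z)]; ring. }
  destruct H as [p Hp]. apply Cexp_period with p.
  assert (HpC : RtoC (IZR p) = (RtoC (IZR m) * (RtoC (IZR m) + 1) / 2)%C).
  { apply (f_equal IZR) in Hp. rewrite !mult_IZR, plus_IZR in Hp.
    replace (IZR p) with (IZR m * (IZR m + 1) / 2) by lra. Cpush. reflexivity. }
  rewrite HpC. Cpush. field.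
Qed.

Lemma theta_coef_T (tau : C) (k : nat) (m : Z) : 0 < Im tau ->
  theta_coef (tau + 1) k m = (e (RtoC (INR k / 8)) * theta_coef tau k m)%C.
Proof.
  intros Ht. revert m. induction k as [|k IH]; intros m.
  - simpl. replace (0 / 8) with 0 by field. rewrite e_0. ring.
  - simpl theta_coef. unfold conv. rewrite <- ZSeries_scal.
    + apply ZSeries_ext. intros j. rewrite IH, th_T.
      replace (INR (S k) / 8) with (INR k / 8 + 1 / 8) by (rewrite S_INR; field).
      rewrite RtoC_plus, e_add. ring.
    + apply dom_conv_term; [now apply dom_theta_coef|now apply dom_th].
Qed.

Lemma eta_T (tau : C) : eta (tau + 1) = (e (RtoC (1 / 24)) * eta tau)%C.
Proof.
  unfold eta.
  replace (fun j : nat => (RtoC 1 - epow (tau + 1) (INR (S j)))%C) with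
    (fun j : nat => (RtoC 1 - epow tau (INR (S j)))%C).
  - unfold epow. rewrite Cmult_plus_distr_l, e_add, Cmult_1_r. ring.
  - apply functional_extensionality. intros j.
    unfold epow at 2. rewrite Cmult_plus_distr_l, e_add, Cmult_1_r, e_nat, Cmult_1_r. reflexivity.
Qed.

(** The phase k/12 is k/8 from Theta^k minus k/24 from eta^k; the rest comes from the normalising
    power of q. *)
Lemma fk_T (k : nat) (m : Z) (tau : C) : (1 <= k)%nat -> 0 < Im tau ->
  let beta := INR k / 2 + IZR m in
  fk k beta (tau + 1) = (e (RtoC (INR k / 12 - beta ^ 2 / (2 * INR k))) * fk k beta tau)%C.
Proof.
  intros Hk Ht beta. assert (HK : 1 <= INR k) by (apply (le_INR 1); auto).
  unfold beta. rewrite !fk_eq; auto.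
  2:{ unfold Im in *; simpl; lra. }
  unfold gk. rewrite theta_coef_T, eta_T, Cinv_mul, Cpow_mult_l, Cpow_inv, e_pow by (auto; apply e_neq_0).
  set (x := (INR k / 2 + IZR m) ^ 2 / (2 * INR k)).
  unfold epow. rewrite Cmult_plus_distr_l, e_add, Cmult_1_r.
  replace (e (RtoC (INR k / 12 - x))) with
    (/ e (INR k * (1 / 24)%R) * e (RtoC (INR k / 8)) * e (RtoC (- x)))%C; [ring|].
  replace (INR k / 12 - x) with (- (INR k * (1 / 24)) + INR k / 8 + - x) by field.
  rewrite (RtoC_plus (- _ + _)), e_add, (RtoC_plus (- _)), e_add. do 2 f_equal.
  rewrite <- RtoC_mult.
  assert (E : (e (RtoC (- (INR k * (1 / 24)))) * e (RtoC (INR k * (1 / 24))))%C = 1).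
  { rewrite <- e_add, <- RtoC_plus. replace (- (INR k * (1 / 24)) + INR k * (1 / 24)) with 0 by ring. apply e_0. }
  set (a := e (RtoC (INR k * (1 / 24)))) in *.
  assert (a <> 0) by apply e_neq_0.
  replace (e (RtoC (- (INR k * (1 / 24))))) with (e (RtoC (- (INR k * (1 / 24)))) * a * / a)%C by (field; auto).
  rewrite E. ring.
Qed.


(** * The transformation tau -> -1/tau *)

Section Inversion_S.
Variables (tau r : C).
Hypotheses (Ht : 0 < Im tau) (Hr : (r * r)%C = (- (Ci * tau))%C) (Hp : 0 < Re r).

Let sigma : C := (- / tau)%C.

Lemma tau_neq_0 : tau <> 0.
Proof. intros E. rewrite E in Ht. simpl in Ht. lra. Qed.

Lemma r_neq_0 : r <> 0.
Proof. now apply Re_pos_neq_0. Qed.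

Lemma Re_rr_pos : 0 < Re (r * r).
Proof. rewrite Hr. unfold Re, Im in *; simpl; lra. Qed.

(** Thus 1/r plays for [sigma] the role that r plays for [tau]. *)
Lemma inv_rr : (/ (r * r))%C = (- (Ci * sigma))%C.
Proof.
  rewrite Hr. unfold sigma. pose proof tau_neq_0 as H0.
  apply (f_equal (fun x => (x * / (Ci * tau))%C)) in Hr.
  assert (HC : Ci <> 0). { intros E. injection E. lra. }
  replace (/ - (Ci * tau))%C with (- (/ (Ci * Ci)) * (Ci / tau))%C by (field; auto).
  rewrite Ci_Ci. field. auto.
Qed.

Lemma Im_sigma : 0 < Im sigma.
Proof.
  pose proof (Re_Cinv_pos _ Re_rr_pos) as H. rewrite inv_rr in H.
  unfold Re, Im in *; simpl in *; lra.
Qed.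

Lemma eta_sigma : eta sigma = (r * eta tau)%C.
Proof.
  rewrite (eta_series tau r Ht Hr), (eta_series sigma (/ r) Im_sigma).
  - symmetry. apply eta_term_inversion; [exact Hp|apply Re_rr_pos].
  - rewrite <- inv_rr. apply Cinv_sq, r_neq_0.
Qed.

(** The half-integral index of [Theta tau] yields a character e(m/2) in the dual sum, which the
    shift of w by 1/2 cancels; the half-period added to the argument makes the dual exponents
    half-integral again. *)
Lemma Theta_sigma (w : C) :
  Theta sigma w = (r * Ci * Cexp (RtoC PI * Ci * tau * (w + 1 / 2) * (w + 1 / 2))
    * Theta tau ((w + 1 / 2) * tau + 1 / 2))%C.
Proof.
  pose proof tau_neq_0 as Ht0. pose proof r_neq_0 as Hr0.
  set (X := (1 / 2 + (w + 1 / 2) + 1 / (2 * tau))%C).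
  pose proof (theta_inversion r X Hp Re_rr_pos) as HI.
  set (c1 := Cexp (- (RtoC PI * Ci * tau * ((w + 1 / 2) + 1 / (2 * tau)) * ((w + 1 / 2) + 1 / (2 * tau))))).
  assert (E1 : Theta tau ((w + 1 / 2) * tau + 1 / 2) = (c1 * ZSeries (fun n => gauss (r * X) r (IZR n)))%C).
  { rewrite <- ZSeries_scal by (apply dom_gauss, Re_rr_pos). apply ZSeries_ext. intros m.
    unfold th, epow, c1, gauss, e. rewrite <- !Cexp_add. f_equal.
    replace ((r * X + r * RtoC (IZR m)) * (r * X + r * RtoC (IZR m)))%C with
      ((r * r) * (X + RtoC (IZR m)) * (X + RtoC (IZR m)))%C by ring.
    rewrite Hr. unfold X. Cpush. field. auto. }
  set (c2 := Cexp (RtoC PI * Ci * w + RtoC PI * Ci / (4 * tau))%C).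
  assert (E2 : ZSeries (dual r X) = (c2 * Theta sigma w)%C).
  { rewrite <- (ZSeries_shift1 (dual r X)) by (apply dom_dual; [exact Hp|apply Re_rr_pos]).
    unfold Theta. rewrite <- ZSeries_scal by (apply dom_Theta, Im_sigma). apply ZSeries_ext. intros m.
    unfold dual, th, epow, c2, e. rewrite <- !Cexp_add. apply Cexp_period with (- (m + 1))%Z.
    unfold Cdiv at 1. rewrite inv_rr. unfold X, sigma. rewrite opp_IZR, plus_IZR. Cpush. field. auto. }
  rewrite E1.
  transitivity (Ci * Cexp (RtoC PI * Ci * tau * (w + 1 / 2) * (w + 1 / 2)) * c1 *
     (r * ZSeries (fun n => gauss (r * X) r (IZR n))))%C; [|ring].
  rewrite HI, E2.
  transitivity (Ci * (Cexp (RtoC PI * Ci * tau * (w + 1 / 2) * (w + 1 / 2)) * c1 * c2) * Theta sigma w)%C; [|ring].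
  replace (Cexp (RtoC PI * Ci * tau * (w + 1 / 2) * (w + 1 / 2)) * c1 * c2)%C with (- Ci)%C.
  - replace (Ci * - Ci)%C with (- (Ci * Ci))%C by ring. rewrite Ci_Ci. ring.
  - rewrite <- Ci_inv. replace (/ Ci)%C with (/ e (RtoC (1 / 4)))%C by now rewrite e_quarter.
    unfold c1, c2. rewrite <- !Cexp_add.
    transitivity (e (RtoC (- (1 / 4)))).
    + pose proof (e_neq_0 (RtoC (1 / 4))).
      replace (e (RtoC (- (1 / 4)))) with (/ e (RtoC (1 / 4)) * (e (RtoC (1 / 4)) * e (RtoC (- (1 / 4)))))%C
        by (field; auto).
      rewrite <- e_add, <- RtoC_plus. replace (1 / 4 + - (1 / 4)) with 0 by ring. rewrite e_0. ring.
    + unfold e. f_equal. Cpush. field. auto.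
Qed.

Variable k : nat.
Hypothesis Hk : (1 <= k)%nat.

Let K1 : 1 <= INR k.
Proof. apply (le_INR 1); auto. Qed.

Let KC : RtoC (INR k) <> 0.
Proof. intros E. apply RtoC_inj in E. pose proof K1. lra. Qed.

Let sK : 0 < sqrt (INR k).
Proof. apply sqrt_lt_R0. pose proof K1. lra. Qed.

Let s : C := (RtoC (sqrt (INR k)) * r)%C.

Lemma s_sq : (s * s)%C = (RtoC (INR k) * (r * r))%C.
Proof.
  unfold s.
  replace (RtoC (INR k)) with (RtoC (sqrt (INR k)) * RtoC (sqrt (INR k)))%C; [ring|].
  rewrite <- RtoC_mult, sqrt_sqrt; [reflexivity|]. pose proof K1. lra.
Qed.

Lemma Re_s_pos : 0 < Re s.
Proof.
  unfold s. replace (Re (RtoC (sqrt (INR k)) * r)) with (sqrt (INR k) * Re r) by (unfold Re; simpl; ring).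
  apply Rmult_lt_0_compat; [apply sK|exact Hp].
Qed.

Lemma Re_ss_pos : 0 < Re (s * s).
Proof.
  rewrite s_sq. pose proof Re_rr_pos. pose proof K1.
  replace (Re (RtoC (INR k) * (r * r))) with (INR k * Re (r * r)) by (unfold Re; simpl; ring). nra.
Qed.

(** Up to factors independent of m and b0, the coefficient of e(w)^(k/2+m) contributed by one class:
    the phase e(beta/2) will be i^(2 beta), and the last factor is the kernel of the discrete
    Fourier transform. *)
Definition S_coef (b0 : Z) (m : Z) : C :=
  (epow sigma ((INR k / 2 + IZR m) ^ 2 / (2 * INR k)) * e (RtoC ((INR k / 2 + IZR m) / 2))
    * e (RtoC ((INR k / 2 + IZR m + INR k / 2) * (INR k / 2 + IZR b0) / INR k)))%C.

(* One class modulo [k] of the expansion of [Theta tau (v tau + 1/2) ^ k], with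
   [v = w + 1/2], is a Gaussian sum, to which [theta_inversion] applies. *)
Lemma class_inversion (w : C) (b0 : Z) :
  let beta l := INR k / 2 + IZR (b0 + Z.of_nat k * l) in
  let u l := (epow tau (beta l ^ 2 / (2 * INR k)) * epow ((w + 1 / 2) * tau + 1 / 2) (beta l))%C in
  let v m := (S_coef b0 m * epow w (INR k / 2 + IZR m))%C in
  dom u /\ dom v /\
  (Cexp (RtoC (INR k) * (RtoC PI * Ci * tau * (w + 1 / 2) * (w + 1 / 2))) * (s * ZSeries u))%C
  = ZSeries v.
Proof.
  intros beta u v. pose proof tau_neq_0 as Ht0. pose proof K1 as HK. pose proof KC as HKC.
  pose proof r_neq_0 as Hr0.
  (* Centre of the square completed in l: the class k/2 + b0, divided by k, joins the shift w + 1/2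
     and the half-period. *)
  set (X := ((w + 1 / 2) + RtoC ((INR k / 2 + IZR b0) / INR k) + 1 / (2 * tau))%C).
  set (c1 := Cexp (RtoC (- PI) * Ci * RtoC (INR k) / (4 * tau) - RtoC PI * Ci * RtoC (INR k) * (w + 1 / 2))).
  set (c0 := Cexp (RtoC (INR k) * (RtoC PI * Ci * tau * (w + 1 / 2) * (w + 1 / 2)))).
  assert (Hc0 : c0 <> 0) by apply Cexp_neq_0.
  assert (Eu : forall l, u l = (/ c0 * (c1 * gauss (s * X) s (IZR l)))%C).
  { intros l. replace (u l) with (/ c0 * (c0 * u l))%C by (field; auto). f_equal.
    unfold u, c0, c1, gauss, epow, e. rewrite <- !Cexp_add. f_equal.
    replace ((s * X + s * RtoC (IZR l)) * (s * X + s * RtoC (IZR l)))%C with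
      ((s * s) * (X + RtoC (IZR l)) * (X + RtoC (IZR l)))%C by ring.
    rewrite s_sq, Hr. unfold X, beta. rewrite plus_IZR, mult_IZR, <- INR_IZR_INZ. Cpush. field. auto. }
  assert (du : dom u).
  { apply dom_ext with (fun l => (/ c0 * (c1 * gauss (s * X) s (IZR l)))%C); [intros; now rewrite Eu|].
    do 2 apply dom_scal. apply dom_gauss, Re_ss_pos. }
  assert (dd : dom (dual s X)) by (apply dom_dual; [apply Re_s_pos|apply Re_ss_pos]).
  (* The part 1/(2 tau) of [X] moves the centre of the dual square to k/2, so the exponent k/2 + m
     sits at dual index m + k. *)
  assert (Ev : forall m, v m = (c1 * dual s X (m + Z.of_nat k)%Z)%C).
  { intros m. unfold v, S_coef, c1, dual, epow, e. rewrite s_sq, <- !Cexp_add. f_equal.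
    replace (RtoC (- PI) * (RtoC (IZR (m + Z.of_nat k)) * RtoC (IZR (m + Z.of_nat k))) / (RtoC (INR k) * (r * r)))%C
     with (RtoC (- PI) * (RtoC (IZR (m + Z.of_nat k)) * RtoC (IZR (m + Z.of_nat k))) / RtoC (INR k) * / (r * r))%C
     by (field; auto).
    rewrite inv_rr. unfold X, sigma. rewrite plus_IZR, <- INR_IZR_INZ. Cpush. field. auto. }
  assert (dv : dom v).
  { apply dom_ext with (fun m => c1 * dual s X (m + Z.of_nat k)%Z)%C; [intros; now rewrite Ev|].
    now apply dom_scal, dom_shift. }
  split; [exact du|]. split; [exact dv|].
  rewrite (ZSeries_ext u _ Eu), (ZSeries_ext v _ Ev).
  rewrite !ZSeries_scal; auto using dom_shift, dom_scal, dom_gauss, Re_ss_pos.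
  rewrite (ZSeries_shift _ _ dd), <- theta_inversion by (apply Re_s_pos || apply Re_ss_pos).
  fold c0. field. auto.
Qed.

(** By periodicity [gk] is constant on each class modulo k and leaves the inner sum, so that a pure
    Gaussian sum remains. *)
Lemma theta_coef_S (c : Z) (m : Z) :
  theta_coef sigma k m = (r ^ k * Ci ^ k / s *
    csum (fun i => gk tau k (c + Z.of_nat i) * S_coef (c + Z.of_nat i) m) k)%C.
Proof.
  revert m. pose proof r_neq_0 as Hr0. pose proof (Re_pos_neq_0 s Re_s_pos) as Hs0.
  apply (zeta_unique (INR k / 2) _ _ (fun w => Theta sigma w ^ k)%C).
  { intros w. apply theta_coef_is, Im_sigma. }
  intros w. rewrite Theta_sigma, !Cpow_mult_l, Cexp_pow.
  destruct (theta_coef_expansion tau ((w + 1 / 2) * tau + 1 / 2) k Ht) as [d E]. rewrite <- E. clear E.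
  rewrite (ZSeries_mod_split _ c k) by (auto; lia).
  set (beta := fun i l => INR k / 2 + IZR (c + Z.of_nat i + Z.of_nat k * l)).
  set (u := fun i l => (epow tau (beta i l ^ 2 / (2 * INR k)) * epow ((w + 1 / 2) * tau + 1 / 2) (beta i l))%C).
  set (v := fun i m => (S_coef (c + Z.of_nat i) m * epow w (INR k / 2 + IZR m))%C).
  assert (H : forall i, dom (u i) /\ dom (v i) /\
    (Cexp (RtoC (INR k) * (RtoC PI * Ci * tau * (w + 1 / 2) * (w + 1 / 2))) * (s * ZSeries (u i)))%C
      = ZSeries (v i)) by (intros i; apply class_inversion).
  rewrite (csum_ext _ (fun i => gk tau k (c + Z.of_nat i) * ZSeries (u i))%C).
  2:{ intros i _. rewrite <- ZSeries_scal by apply H. apply ZSeries_ext. intros l. unfold u.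
      rewrite <- (gk_period_mul tau k (c + Z.of_nat i) l) by auto. unfold gk, beta.
      rewrite (Cmult_assoc (_ * _)), <- (Cmult_assoc (theta_coef _ _ _) (epow _ _)), <- epow_plus.
      match goal with |- context [epow tau ?x] => replace x with 0 by ring end.
      rewrite epow_0. ring. }
  set (c0 := Cexp _) in *.
  match goal with |- is_Zseries ?a ?b =>
    replace b with (r ^ k * Ci ^ k / s * csum (fun i => gk tau k (c + Z.of_nat i) * ZSeries (v i)) k)%C end.
  2:{ rewrite (csum_ext _ (fun i => (c0 * s) * (gk tau k (c + Z.of_nat i) * ZSeries (u i)))%C).
      - rewrite csum_scal. field. auto.
      - intros i _. rewrite <- (proj2 (proj2 (H i))). ring. }
  rewrite (csum_ext _ (fun i => ZSeries (fun m => gk tau k (c + Z.of_nat i) * v i m)%C)).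
  2:{ intros i _. symmetry. apply ZSeries_scal, H. }
  destruct (ZSeries_csum (fun i m => gk tau k (c + Z.of_nat i) * v i m)%C k) as [E1 d1].
  { intros i. apply dom_scal, H. }
  rewrite <- E1, <- ZSeries_scal by exact d1.
  match goal with |- is_Zseries ?a (ZSeries ?b) => replace a with b end.
  { now apply ZSeries_correct, dom_scal. }
  apply functional_extensionality. intros m.
  rewrite <- Cmult_assoc. f_equal. rewrite Cmult_comm, <- csum_scal. apply csum_ext. intros i _.
  unfold v. ring.
Qed.

Lemma gk_S (c m : Z) :
  gk sigma k m = (r ^ k * Ci ^ k / s * (e (RtoC ((INR k / 2 + IZR m) / 2)) *
    csum (fun i => gk tau k (c + Z.of_nat i) *
      e (RtoC ((INR k / 2 + IZR m + INR k / 2) * (INR k / 2 + IZR (c + Z.of_nat i)) / INR k))) k))%C.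
Proof.
  unfold gk at 1. rewrite (theta_coef_S c m), <- Cmult_assoc. f_equal.
  rewrite Cmult_comm, <- !csum_scal. apply csum_ext. intros i _. unfold S_coef.
  set (x := (INR k / 2 + IZR m) ^ 2 / (2 * INR k)).
  transitivity ((epow sigma (- x) * epow sigma x) * (e (RtoC ((INR k / 2 + IZR m) / 2)) *
    (gk tau k (c + Z.of_nat i) *
      e (RtoC ((INR k / 2 + IZR m + INR k / 2) * (INR k / 2 + IZR (c + Z.of_nat i)) / INR k)))))%C; [ring|].
  rewrite <- epow_plus. replace (- x + x) with 0 by ring. rewrite epow_0. ring.
Qed.

(** The factor r^k of Theta^k cancels against that of eta^k; the r remaining in the denominator is
    moved to the left-hand side. *)
Lemma fk_S (c m : Z) : let beta := INR k / 2 + IZR m in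
  (r * fk k beta sigma)%C = (Ci ^ k * RtoC (/ sqrt (INR k)) * (e (RtoC (beta / 2)) *
    csum (fun i => fk k (INR k / 2 + IZR (c + Z.of_nat i)) tau *
      e (RtoC ((beta + INR k / 2) * (INR k / 2 + IZR (c + Z.of_nat i)) / INR k))) k))%C.
Proof.
  intros beta. pose proof r_neq_0 as Hr0. pose proof sK as HsK.
  assert (HsKC : RtoC (sqrt (INR k)) <> 0) by (intros E; apply RtoC_inj in E; lra).
  unfold beta. rewrite fk_eq by apply Im_sigma.
  rewrite eta_sigma, Cinv_mul, Cpow_mult_l, Cpow_inv, (gk_S c m) by auto.
  rewrite (csum_ext (fun i => (fk _ _ _ * _)%C) (fun i => ((/ eta tau) ^ k * (gk tau k (c + Z.of_nat i) *
      e (RtoC ((INR k / 2 + IZR m + INR k / 2) * (INR k / 2 + IZR (c + Z.of_nat i)) / INR k))))%C)).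
  2:{ intros i _. rewrite fk_eq by auto. ring. }
  rewrite csum_scal, RtoC_inv by lra. unfold s. set (A := ((/ eta tau) ^ k)%C). field.
  split; auto. split; auto. now apply Cpow_nz.
Qed.

End Inversion_S.

(** * Folding a full period onto [frakB] *)

Lemma csum_rev (f : nat -> C) (n : nat) : csum (fun j => f (n - 1 - j)%nat) n = csum f n.
Proof.
  assert (L : forall (g : nat -> C) p, csum g (S p) = (g 0%nat + csum (fun j => g (S j)) p)%C).
  { intros g p. induction p as [|p IH]; [simpl; ring|].
    change (csum g (S (S p))) with (csum g (S p) + g (S p))%C. rewrite IH. simpl. ring. }
  induction n as [|n IH]; [reflexivity|]. rewrite L.
  simpl csum at 2. rewrite <- IH. replace (S n - 1 - 0)%nat with n by lia.
  rewrite (csum_ext _ (fun j => f (n - 1 - j)%nat)); [ring|].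
  intros j Hj. f_equal. lia.
Qed.

Lemma csum_shift1 (g : nat -> C) (p : nat) : csum (fun j => g (S j)) p = (csum g p + g p - g 0%nat)%C.
Proof. induction p as [|p IH]; simpl; [ring|rewrite IH; ring]. Qed.

Lemma csum_fold (g : R -> C) (f : nat -> R) (n : nat) :
  fold_right Cplus (RtoC 0) (map g (map f (seq 0 n))) = csum (fun j => g (f j)) n.
Proof.
  induction n as [|n IH]; [reflexivity|].
  rewrite seq_S, !map_app, fold_right_app. cbn [csum]. rewrite <- IH. simpl.
  generalize (map g (map f (seq 0 n))). intros l. rewrite Cplus_0_r.
  induction l as [|a l IHl]; simpl; [ring|rewrite IHl; ring].
Qed.

(** With [k / 2] rounded down, the real k/2 minus it is 0 or 1/2, so one parametrisation serves both
    parities. *)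
Lemma frakB_sum (k : nat) (g : R -> C) :
  sum_frakB k g = csum (fun j => g (INR k / 2 + IZR (Z.of_nat j - Z.of_nat (k / 2)))) (S (k / 2)).
Proof.
  unfold sum_frakB, frakB. pose proof (Nat.div_mod k 2 ltac:(lia)) as Hd.
  destruct (Nat.even k) eqn:Ek.
  - rewrite csum_fold. apply csum_ext. intros j _. f_equal.
    apply Nat.even_spec in Ek. destruct Ek as [p ->].
    replace (2 * p / 2)%nat with p by (symmetry; rewrite Nat.mul_comm; apply Nat.div_mul; lia).
    rewrite minus_IZR, <- !INR_IZR_INZ, mult_INR. simpl INR. field.
  - rewrite csum_fold. apply csum_ext. intros j _. f_equal.
    assert (Ho : Nat.odd k = true) by (unfold Nat.odd; now rewrite Ek).
    apply Nat.odd_spec in Ho. destruct Ho as [p ->].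
    replace ((2 * p + 1) / 2)%nat with p by (apply (Nat.div_unique _ 2 p 1); lia).
    rewrite minus_IZR, <- !INR_IZR_INZ, plus_INR, mult_INR. simpl INR. field.
Qed.

Lemma frakB_index (k : nat) (beta : R) : In beta (frakB k) ->
  exists j : nat, beta = INR k / 2 + IZR (Z.of_nat j - Z.of_nat (k / 2))
    /\ exists n : nat, 2 * beta = INR n.
Proof.
  unfold frakB. destruct (Nat.even k) eqn:Ek; intros H; apply in_map_iff in H; destruct H as [j [<- _]];
    exists j; split.
  - apply Nat.even_spec in Ek. destruct Ek as [p ->].
    replace (2 * p / 2)%nat with p by (symmetry; rewrite Nat.mul_comm; apply Nat.div_mul; lia).
    rewrite minus_IZR, <- !INR_IZR_INZ, mult_INR. simpl INR. field.
  - exists (2 * j)%nat. rewrite mult_INR. simpl INR. ring.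
  - assert (Ho : Nat.odd k = true) by (unfold Nat.odd; now rewrite Ek).
    apply Nat.odd_spec in Ho. destruct Ho as [p ->].
    replace ((2 * p + 1) / 2)%nat with p by (apply (Nat.div_unique _ 2 p 1); lia).
    rewrite minus_IZR, <- !INR_IZR_INZ, plus_INR, mult_INR. simpl INR. field.
  - exists (2 * j + 1)%nat. rewrite plus_INR, mult_INR. simpl INR. field.
Qed.

Lemma mu_half (t : R) : t = 0 \/ t = 1 / 2 -> mu t = 1 / 2.
Proof.
  intros H. unfold mu. destruct (Req_EM_T t 0); [reflexivity|].
  destruct (Req_EM_T t (1 / 2)); [reflexivity|]. lra.
Qed.

Lemma mu_one (t : R) : t <> 0 -> t <> 1 / 2 -> mu t = 1.
Proof.
  intros H1 H2. unfold mu. destruct (Req_EM_T t 0); [lra|].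
  destruct (Req_EM_T t (1 / 2)); [lra|reflexivity].
Qed.

(* The reflection [beta' -> k - beta'] (that is, [j -> 2 (k/2) - j]) preserves [D], so a full
   period folds onto [frakB k], its fixed points being counted once. *)
Lemma period_fold (k : nat) (D : Z -> C) : (1 <= k)%nat ->
  (forall j, D (j + Z.of_nat k)%Z = D j) ->
  (forall j, D (2 * Z.of_nat (k / 2) - j)%Z = D j) ->
  csum (fun i => D (Z.of_nat i)) k =
  csum (fun j => RtoC (2 * mu ((INR k / 2 + IZR (Z.of_nat j - Z.of_nat (k / 2))) / INR k))
     * D (Z.of_nat j))%C (S (k / 2)).
Proof.
  intros Hk Hper Hsym. assert (HK : 1 <= INR k) by (apply (le_INR 1); auto).
  set (h := (k / 2)%nat) in *.
  assert (Hh : k = (2 * h)%nat \/ k = (2 * h + 1)%nat).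
  { pose proof (Nat.div_mod k 2 ltac:(lia)). pose proof (Nat.mod_upper_bound k 2 ltac:(lia)). fold h in H. lia. }
  assert (Full : csum (fun i => D (Z.of_nat i)) (2 * h + 1)
     = (D (Z.of_nat h) + 2 * csum (fun j => D (Z.of_nat j)) h)%C).
  { assert (G : forall p, (p <= h)%nat -> csum (fun i => D (Z.of_nat i)) (h + 1 + p)
      = (csum (fun i => D (Z.of_nat i)) (h + 1) + csum (fun i => D (Z.of_nat (h - 1 - i))) p)%C).
    { induction p as [|p IH]; intros Hp; [rewrite Nat.add_0_r; simpl; ring|].
      replace (h + 1 + S p)%nat with (S (h + 1 + p)) by lia. cbn [csum]. rewrite IH by lia.
      rewrite <- (Hsym (Z.of_nat (h + 1 + p))).
      replace (2 * Z.of_nat h - Z.of_nat (h + 1 + p))%Z with (Z.of_nat (h - 1 - p)) by lia. ring. }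
    replace (2 * h + 1)%nat with (h + 1 + h)%nat by lia. rewrite (G h) by lia.
    rewrite (csum_rev (fun j => D (Z.of_nat j)) h).
    replace (h + 1)%nat with (S h) by lia. cbn [csum]. ring. }
  cbn [csum].
  assert (Mlast : INR k / 2 + IZR (Z.of_nat h - Z.of_nat h) = INR k / 2) by (rewrite Z.sub_diag; ring).
  rewrite Mlast, (mu_half (INR k / 2 / INR k)) by (right; field; lra).
  assert (Mval : forall j, (j < h)%nat -> (INR k / 2 + IZR (Z.of_nat j - Z.of_nat h)) / INR k <> 1 / 2).
  { intros j Hj E. apply (f_equal (fun x => x * INR k)) in E.
    unfold Rdiv in E at 1. rewrite Rmult_assoc, Rinv_l in E by lra.
    assert (IZR (Z.of_nat j - Z.of_nat h) < 0) by (apply IZR_lt; lia). lra. }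
  destruct Hh as [Hh|Hh].
  - assert (Hh1 : (1 <= h)%nat) by lia.
    assert (HI : INR k = 2 * INR h) by (rewrite Hh, mult_INR; simpl INR; ring).
    (* For even k a period is one term shorter than the symmetric range 0..2h. The surplus term
       equals D(0), so beta' = 0 is counted once, in agreement with mu = 1/2 there. *)
    assert (E1 : csum (fun i => D (Z.of_nat i)) k = (csum (fun i => D (Z.of_nat i)) (2 * h + 1) - D 0%Z)%C).
    { replace (2 * h + 1)%nat with (S k) by lia. cbn [csum].
      replace (D (Z.of_nat k)) with (D 0%Z) by (now rewrite <- (Hper 0%Z)). ring. }
    assert (E2 : forall p, (1 <= p <= h)%nat -> csum (fun j =>
        RtoC (2 * mu ((INR k / 2 + IZR (Z.of_nat j - Z.of_nat h)) / INR k)) * D (Z.of_nat j))%C p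
        = (2 * csum (fun j => D (Z.of_nat j)) p - D 0%Z)%C).
    { induction p as [|p IH]; intros Hp; [lia|]. cbn [csum].
      destruct (Nat.eq_dec p 0) as [->|Hp0].
      - simpl csum. rewrite mu_half; [|left].
        + replace (2 * (1 / 2)) with 1 by field. simpl Z.of_nat. ring.
        + rewrite minus_IZR, <- !INR_IZR_INZ. simpl (INR 0). rewrite HI. field. lra.
      - rewrite IH by lia. rewrite mu_one.
        + rewrite Rmult_1_r. ring.
        + rewrite minus_IZR, <- !INR_IZR_INZ, HI.
          replace (2 * INR h / 2 + (INR p - INR h)) with (INR p) by field.
          assert (1 <= INR p) by (apply (le_INR 1); lia).
          apply Rgt_not_eq. apply Rdiv_lt_0_compat; lra.
        + apply Mval. lia. }
    rewrite E1, E2, Full by lia. replace (2 * (1 / 2)) with 1 by field. ring.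
  - assert (HI : INR k = 2 * INR h + 1) by (rewrite Hh, plus_INR, mult_INR; simpl INR; ring).
    rewrite Hh at 1. rewrite Full.
    rewrite (csum_ext (fun j => (RtoC _ * D _)%C) (fun j => 2 * D (Z.of_nat j))%C).
    + rewrite csum_scal. replace (2 * (1 / 2)) with 1 by field. ring.
    + intros j Hj. rewrite mu_one.
      * now rewrite Rmult_1_r.
      * rewrite minus_IZR, <- !INR_IZR_INZ, HI.
        replace ((2 * INR h + 1) / 2 + (INR j - INR h)) with (INR j + 1 / 2) by field.
        pose proof (pos_INR j). pose proof (pos_INR h).
        apply Rgt_not_eq. apply Rdiv_lt_0_compat; lra.
      * now apply Mval.
Qed.

(** The reflected window is again a full period: 1..k for even k, 0..k-1 for odd k. *)
Lemma period_reflect (k : nat) (P : Z -> C) : (1 <= k)%nat ->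
  (forall j, P (j + Z.of_nat k)%Z = P j) ->
  csum (fun i => P (2 * Z.of_nat (k / 2) - Z.of_nat i)%Z) k = csum (fun i => P (Z.of_nat i)) k.
Proof.
  intros Hk Hper. set (h := (k / 2)%nat) in *.
  assert (Hh : k = (2 * h)%nat \/ k = (2 * h + 1)%nat).
  { pose proof (Nat.div_mod k 2 ltac:(lia)). pose proof (Nat.mod_upper_bound k 2 ltac:(lia)). fold h in H. lia. }
  rewrite <- (csum_rev (fun i => P (2 * Z.of_nat h - Z.of_nat i)%Z)).
  destruct Hh as [Hh|Hh].
  - rewrite (csum_ext _ (fun i => P (Z.of_nat (S i)))).
    + rewrite (csum_shift1 (fun i => P (Z.of_nat i)) k).
      replace (P (Z.of_nat k)) with (P (Z.of_nat 0)); [ring|]. now rewrite <- (Hper (Z.of_nat 0)).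
    + intros i Hi. f_equal. lia.
  - apply csum_ext. intros i Hi. f_equal. lia.
Qed.

Lemma fk_period (k : nat) (tau : C) (m : Z) : (1 <= k)%nat -> 0 < Im tau ->
  fk k (INR k / 2 + IZR (m + Z.of_nat k)) tau = fk k (INR k / 2 + IZR m) tau.
Proof. intros Hk Ht. rewrite !fk_eq, gk_period; auto. Qed.

Lemma fk_even (k : nat) (tau : C) (m : Z) : 0 < Im tau ->
  fk k (INR k / 2 + IZR (- Z.of_nat k - m)) tau = fk k (INR k / 2 + IZR m) tau.
Proof. intros Ht. rewrite !fk_eq, gk_even; auto. Qed.

Lemma e_cos (x : R) : (e (RtoC x) + e (RtoC (- x)))%C = RtoC (2 * cos (2 * PI * x)).
Proof.
  rewrite !e_R. replace (2 * PI * - x) with (- (2 * PI * x)) by ring. rewrite cos_neg, sin_neg.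
  unfold RtoC, Cplus; simpl. f_equal; ring.
Qed.

(** Averaging the sum with its reflection b -> k - b turns exponentials into cosines. The frequency
    [a], to be beta + k/2, is an integer, and this makes the phases k-periodic in b. *)
Lemma csum_to_frakB (k : nat) (tau : C) (a : Z) : (1 <= k)%nat -> 0 < Im tau ->
  csum (fun i => fk k (INR k / 2 + IZR (- Z.of_nat (k / 2) + Z.of_nat i)) tau *
      e (RtoC (IZR a * (INR k / 2 + IZR (- Z.of_nat (k / 2) + Z.of_nat i)) / INR k)))%C k
  = sum_frakB k (fun b => RtoC (2 * mu (b / INR k)) * (RtoC (cos (2 * PI * b * IZR a / INR k)) * fk k b tau))%C.
Proof.
  intros Hk Ht. assert (HK : 1 <= INR k) by (apply (le_INR 1); auto).
  set (h := (k / 2)%nat).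
  set (b := fun j : Z => INR k / 2 + IZR (- Z.of_nat h + j)).
  set (P := fun j : Z => (fk k (b j) tau * e (RtoC (IZR a * b j / INR k)))%C).
  set (D := fun j : Z => (RtoC (cos (2 * PI * b j * IZR a / INR k)) * fk k (b j) tau)%C).
  assert (bper : forall j, b (j + Z.of_nat k)%Z = b j + INR k).
  { intros j. unfold b. rewrite Z.add_assoc, (plus_IZR _ (Z.of_nat k)), <- INR_IZR_INZ. ring. }
  assert (fper : forall j, fk k (b (j + Z.of_nat k)%Z) tau = fk k (b j) tau).
  { intros j. unfold b. rewrite Z.add_assoc. now apply fk_period. }
  assert (Pper : forall j, P (j + Z.of_nat k)%Z = P j).
  { intros j. unfold P. rewrite fper, bper. f_equal.
    replace (IZR a * (b j + INR k) / INR k) with (IZR a * b j / INR k + IZR a) by (field; lra).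
    rewrite RtoC_plus, e_add, e_Z. ring. }
  assert (PD : forall j, (P j + P (2 * Z.of_nat h - j)%Z)%C = (2 * D j)%C).
  { intros j.
    assert (Eb : b (2 * Z.of_nat h - j)%Z = - b j + INR k).
    { unfold b. rewrite !plus_IZR, minus_IZR, mult_IZR, opp_IZR. field. }
    assert (Ef : fk k (b (2 * Z.of_nat h - j)%Z) tau = fk k (b j) tau).
    { unfold b. rewrite <- (fk_even k tau (- Z.of_nat h + j)) by auto.
      rewrite <- (fk_period k tau (- Z.of_nat k - (- Z.of_nat h + j))) by auto. f_equal. f_equal. f_equal. ring. }
    unfold P, D. rewrite Ef, Eb.
    replace (IZR a * (- b j + INR k) / INR k) with (- (IZR a * b j / INR k) + IZR a) by (field; lra).
    rewrite (RtoC_plus (- _)), e_add, e_Z.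
    replace (2 * PI * b j * IZR a / INR k) with (2 * PI * (IZR a * b j / INR k)) by (field; lra).
    pose proof (e_cos (IZR a * b j / INR k)) as E. rewrite RtoC_mult in E.
    transitivity (fk k (b j) tau * (e (RtoC (IZR a * b j / INR k)) + e (RtoC (- (IZR a * b j / INR k)))))%C; [ring|].
    rewrite E. ring. }
  assert (E1 : csum (fun i => P (Z.of_nat i)) k = csum (fun i => D (Z.of_nat i)) k).
  { assert (E : (2 * csum (fun i => P (Z.of_nat i)) k = 2 * csum (fun i => D (Z.of_nat i)) k)%C).
    { rewrite <- (csum_scal 2 (fun i => D (Z.of_nat i))).
      rewrite (csum_ext (fun i => 2 * D (Z.of_nat i))%C
        (fun i => P (Z.of_nat i) + P (2 * Z.of_nat h - Z.of_nat i)%Z)%C) by (intros; now rewrite PD).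
      rewrite csum_plus. unfold h. rewrite period_reflect by auto. ring. }
    replace (csum (fun i => P (Z.of_nat i)) k) with (1 / 2 * (2 * csum (fun i => P (Z.of_nat i)) k))%C by field.
    rewrite E. field. }
  change (csum (fun i => P (Z.of_nat i)) k = sum_frakB k (fun b => RtoC (2 * mu (b / INR k)) * (RtoC (cos (2 * PI * b * IZR a / INR k)) * fk k b tau))%C).
  rewrite E1, period_fold.
  - rewrite frakB_sum. fold h. apply csum_ext. intros j _. unfold D, b.
    replace (- Z.of_nat h + Z.of_nat j)%Z with (Z.of_nat j - Z.of_nat h)%Z by ring. reflexivity.
  - auto.
  - intros j. unfold D. rewrite fper, bper. do 2 f_equal.
    replace (2 * PI * (b j + INR k) * IZR a / INR k) with (2 * PI * b j * IZR a / INR k + 2 * IZR a * PI) by (field; lra).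
    pose proof (e_R ((b j * IZR a / INR k) + IZR a)) as A. rewrite RtoC_plus, e_add, e_Z, Cmult_1_r, e_R in A.
    injection A as A _.
    replace (2 * PI * b j * IZR a / INR k + 2 * IZR a * PI) with (2 * PI * (b j * IZR a / INR k + IZR a)) by (field; lra).
    rewrite <- A. f_equal. field. lra.
  - intros j.
    assert (E : (2 * D (2 * Z.of_nat h - j)%Z = 2 * D j)%C).
    { rewrite <- !PD. replace (2 * Z.of_nat h - (2 * Z.of_nat h - j))%Z with j by ring. ring. }
    fold h. replace (D j) with (1 / 2 * (2 * D j))%C by field. rewrite <- E. field.
Qed.

Theorem theorem1p1 (k : nat) (beta : R)
  (hk : (1 <= k)%nat) (hbeta : In beta (frakB k)) :
  (forall tau : C, 0 < Im tau ->
     slash (fk k beta) matT tau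
     = (e (RtoC (INR k / 12 - beta ^ 2 / (2 * INR k))) * fk k beta tau)%C)
  /\
  (forall tau : C, 0 < Im tau ->
     slash (fk k beta) matS tau
     = sum_frakB k (fun beta' => smat k beta beta' * fk k beta' tau)%C).
Proof.
  assert (HK : 1 <= INR k) by (apply (le_INR 1); auto).
  destruct (frakB_index k beta hbeta) as [j [Hb [n Hn]]].
  set (m := (Z.of_nat j - Z.of_nat (k / 2))%Z) in *.
  split; intros tau Ht.
  - unfold slash, matT; cbn [ma mb mc md].
    replace (0 * tau + 1)%C with (RtoC 1) by ring. rewrite Csqrt_1, Cmult_1_l.
    replace ((1 * tau + 1) / 1)%C with (tau + 1)%C by field.
    rewrite Hb. now apply fk_T.
  - destruct (upper_half_root tau Ht) as [r [Hr Hp]].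
    assert (Ht0 : tau <> 0) by (now apply (tau_neq_0 tau)).
    unfold slash, matS; cbn [ma mb mc md].
    replace (1 * tau + 0)%C with tau by ring.
    replace ((0 * tau + -1) / tau)%C with (- / tau)%C by (field; auto).
    rewrite (Csqrt_upper tau r Ht Hr Hp), <- Cmult_assoc, Hb.
    (* Starting the classes at minus the rounded-down k/2 makes the first index beta' equal to 0 or
       1/2, the least element of [frakB]. *)
    rewrite (fk_S tau r Ht Hr Hp k hk (- Z.of_nat (k / 2)) m).
    set (a := (m + Z.of_nat k)%Z).
    assert (Ha : INR k / 2 + IZR m + INR k / 2 = IZR a).
    { unfold a. rewrite plus_IZR, <- INR_IZR_INZ. field. }
    rewrite Ha, csum_to_frakB by auto. rewrite <- Hb.
    unfold sum_frakB.
    assert (Hlin : forall (c : C) (g g' : R -> C) (L : list R), (forall x, g' x = (c * g x)%C) ->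
       (c * fold_right Cplus (RtoC 0) (map g L))%C = fold_right Cplus (RtoC 0) (map g' L)).
    { intros c g g' L H. induction L as [|x L IH]; simpl; [ring|]. rewrite <- IH, H. ring. }
    rewrite !Cmult_assoc. apply Hlin. intros b. unfold smat.
    assert (Hfloor : Int_part (2 * beta) = Z.of_nat n).
    { symmetry. apply Int_part_spec. rewrite Hn, INR_IZR_INZ. lra. }
    rewrite Hfloor, Nat2Z.id.
    assert (E1 : e (RtoC (beta / 2)) = (Ci ^ n)%C).
    { rewrite <- e_quarter, e_pow, <- RtoC_mult, <- Hn. do 2 f_equal. field. }
    (* (2k+1)/8 = 1/8 + k/4: the eighth root comes from the principal root of tau, and i^k from the
       k factors Theta. *)
    assert (E2 : e (RtoC ((2 * INR k + 1) / 8)) = (e (RtoC (1 / 8)) * Ci ^ k)%C).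
    { rewrite <- e_quarter, e_pow, <- RtoC_mult, <- e_add, <- RtoC_plus. do 2 f_equal. field. }
    rewrite E1, E2, !RtoC_mult. unfold Rdiv at 3. rewrite RtoC_mult.
    replace (beta + INR k / 2) with (IZR a) by (rewrite Hb; lra).
    ring.
Qed.
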